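(* Let $p$ be a prime, let $\mathcal{O}$ be a complete discrete valuation ring in which $p$ is a prime element, and let $k=\mathcal{O}$ or $k=\mathcal{O}/p\mathcal{O}$. Let $F$ be a finite field extension of $\mathbb{Q}_p$, and let $\mathbb{U}_n$ be the affine group scheme of upper unitriangular matrices in $\mathbb{GL}_n$. Let $U$ be a closed subgroup of $\mathbb{U}_n(F)$, with the $p$-adic topology. Then the augmented Iwasawa algebra $kU$ is a coherent ring.
   Context: $\mathcal{O}$ carries the $p$-adic topology and $\mathcal{O}/p\mathcal{O}$ the discrete topology. For a profinite group $H$, the completed group ring is $kH=\varprojlim_{N} k[H/N]$, the limit over open normal subgroups $N$ of $H$. A locally profinite group is a topological group with an open profinite subgroup. For a locally profinite group $G$ and an open profinite subgroup $K\le G$, the augmented Iwasawa algebra is $kG=kK\otimes_{k[K]}k[G]$, with the unique $k$-algebra structure such that the natural maps $k[G]\to kG$ and $kK\to kG$ are $k$-algebra homomorphisms; it is independent of the choice of $K$ up to canonical isomorphism. A ring is left coherent if every finitely-generated left ideal is finitely-presented. Since $kG$ is isomorphic to its opposite ring, $kG$ is left coherent if and only if it is right coherent, and one simply says ''coherent''. *)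

(* Defs.v *)
From HB Require Import structures.
From mathcomp Require Import all_boot all_order all_algebra all_field.
From mathcomp Require Import finmap all_classical topology.

Set Implicit Arguments.
Unset Strict Implicit.
Unset Printing Implicit Defensive.

Import GRing.Theory.

Local Open Scope classical_set_scope.
Local Open Scope ring_scope.

Section LinearCombinations.
Variables (R : pzRingType) (n : nat).

Definition lcomb (c a : 'I_n -> R) : R := \sum_(i < n) c i * a i.

End LinearCombinations.

Section Coherence.
Variable R : nzRingType.

Definition left_ideal (I : set R) : Prop :=
  [/\ I 0, (forall x y, I x -> I y -> I (x + y))
         & (forall a x, I x -> I (a * x))].

Definition fg_left_ideal (I : set R) : Prop :=
  left_ideal I /\
  exists (n : nat) (a : 'I_n -> R), I = [set lcomb c a | c in [set: 'I_n -> R]].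

(* There is an exact sequence R^m -> R^n -> I -> 0 of left R-modules; the second
   map sends the basis to a and the first one sends the basis to r. *)
Definition fp_left_ideal (I : set R) : Prop :=
  left_ideal I /\
  exists (n : nat) (a : 'I_n -> R) (m : nat) (r : 'I_m -> 'I_n -> R),
    I = [set lcomb c a | c in [set: 'I_n -> R]] /\
    (forall c : 'I_n -> R, lcomb c a = 0 <->
       exists d : 'I_m -> R, forall i, c i = lcomb d (r^~ i)).

Definition left_coherent : Prop :=
  forall I : set R, fg_left_ideal I -> fp_left_ideal I.

End Coherence.

(* For a ring isomorphic to its opposite, such as an augmented Iwasawa algebra,
   the two conditions are equivalent. *)
Definition coherent (R : nzRingType) : Prop :=
  left_coherent R /\ left_coherent R^c.

Section DiscreteValuationRings.
Variable O : idomainType.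

Definition principal_ideal (x : O) : set O := [set c * x | c in [set: O]].

Definition prime_element (x : O) : Prop :=
  [/\ x != 0, x \isn't a GRing.unit
    & forall a b, principal_ideal x (a * b) ->
        principal_ideal x a \/ principal_ideal x b].

Definition maximal_ideal (m : set O) : Prop :=
  [/\ left_ideal m, ~ m 1
    & forall I, left_ideal I -> m `<=` I -> ~ I 1 -> I = m].

Definition dvr : Prop :=
  (forall I : set O, left_ideal I -> exists x, I = principal_ideal x) /\
  exists! m : set O, maximal_ideal m /\ m <> [set 0].

(* every Cauchy sequence for the (x)-adic topology converges *)
Definition adically_complete (x : O) : Prop :=
  forall u : nat -> O,
    (forall n, exists N, forall i j, (N <= i)%N -> (N <= j)%N ->
       principal_ideal (x ^+ n) (u i - u j)) ->
    exists l : O, forall n, exists N, forall i, (N <= i)%N ->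
       principal_ideal (x ^+ n) (u i - l).

(* The n-th power of the maximal ideal (x) is (x ^+ n). *)
Definition complete_dvr : Prop :=
  dvr /\ forall x, maximal_ideal (principal_ideal x) -> adically_complete x.

End DiscreteValuationRings.

Section QuotientByPrime.
Variables (O : idomainType) (x : O) (x_prime : prime_element x).

Definition in_principal : pred O := fun y => `[< principal_ideal x y >].

Lemma in_principal_idealr : idealr_closed in_principal.
Proof.
case: x_prime => x0 xU _; split.
- by apply/asboolP; exists 0; rewrite ?mul0r.
- apply/negP => /asboolP [c _ cx]; case/negP: xU.
  by apply/unitrP; exists c; split => //; rewrite mulrC.
- move=> a u v /asboolP [c _ <-] /asboolP [d _ <-]; apply/asboolP.
  by exists (a * c + d) => //; rewrite mulrDl mulrA.
Qed.

Definition prime_ideal_of : {pred O} :=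
  let _ := x_prime in in_principal.

HB.instance Definition _ := isIdealr.Build O prime_ideal_of
  in_principal_idealr.

Definition quotient_by_prime : comNzRingType := {ideal_quot prime_ideal_of}.

End QuotientByPrime.

Section PadicIntegers.
Variables (p : nat) (p_pr : prime p).

Definition padic_compat (x : forall n : nat, 'Z_(p ^ n.+1)) : bool :=
  `[< forall n, (x n.+1 : nat)%:R = x n >].

(* The inverse limit of the rings Z/p^(n+1). The exponent is shifted because
   'Z_1 is not the zero ring; p_pr is kept as a parameter so that the integral
   domain structure can be found by unification. *)
Definition Zp : Type :=
  let _ := p_pr in {x : forall n : nat, 'Z_(p ^ n.+1) | padic_compat x}.

HB.instance Definition _ := [isSub for (@sval _ _ : Zp -> _)].
HB.instance Definition _ := [Choice of Zp by <:].

Let pn_gt1 n : (1 < p ^ n.+1)%N.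
Proof. by rewrite -(exp1n n.+1) ltn_exp2r // prime_gt1. Qed.

Let Zpn_natr_mod n m : (m %% p ^ n.+1)%:R = m%:R :> 'Z_(p ^ n.+1).
Proof. by apply: Zp_nat_mod; exact: pn_gt1. Qed.

Let Zpn_val_natr n m : (m%:R : 'Z_(p ^ n.+1)) = (m %% p ^ n.+1)%N :> nat.
Proof. by rewrite val_Zp_nat // pn_gt1. Qed.

Let Zpn_red_mod n m :
  ((m %% p ^ n.+2)%N)%:R = m%:R :> 'Z_(p ^ n.+1).
Proof.
by rewrite -Zpn_natr_mod modn_dvdm ?dvdn_exp2l // Zpn_natr_mod.
Qed.

Let Zpn_val n (z : 'Z_(p ^ n.+1)) : (z : nat)%:R = z.
Proof. exact: natr_Zp. Qed.

Fact Zp_compat0 : padic_compat (fun n => 0).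
Proof. by apply/asboolP. Qed.

Fact Zp_compat1 : padic_compat (fun n => 1).
Proof.
by apply/asboolP.
Qed.

Fact Zp_compatD x y : padic_compat x -> padic_compat y ->
  padic_compat (fun n => x n + y n).
Proof.
move=> /asboolP xP /asboolP yP; apply/asboolP => n.
rewrite -{1}(Zpn_val (x n.+1)) -{1}(Zpn_val (y n.+1)) -natrD.
by rewrite Zpn_val_natr Zpn_red_mod natrD xP yP.
Qed.

Fact Zp_compatM x y : padic_compat x -> padic_compat y ->
  padic_compat (fun n => x n * y n).
Proof.
move=> /asboolP xP /asboolP yP; apply/asboolP => n.
rewrite -{1}(Zpn_val (x n.+1)) -{1}(Zpn_val (y n.+1)) -natrM.
by rewrite Zpn_val_natr Zpn_red_mod natrM xP yP.
Qed.

Fact Zp_compatN x : padic_compat x -> padic_compat (fun n => - x n).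
Proof.
move=> /asboolP xP; apply/asboolP => n.
apply/eqP; rewrite -subr_eq0 opprK -{1}(xP n) -natrD.
rewrite -Zpn_red_mod -Zpn_val_natr natrD !Zpn_val addNr.
by [].
Qed.

Let mkZp x (xP : padic_compat x) : Zp := @exist _ (fun x => padic_compat x) x xP.

Definition Zp_zero : Zp := mkZp Zp_compat0.
Definition Zp_one : Zp := mkZp Zp_compat1.
Definition Zp_add (x y : Zp) : Zp := mkZp (Zp_compatD (valP x) (valP y)).
Definition Zp_mul (x y : Zp) : Zp := mkZp (Zp_compatM (valP x) (valP y)).
Definition Zp_opp (x : Zp) : Zp := mkZp (Zp_compatN (valP x)).

Let Zp_eq (x y : Zp) : (forall n, val x n = val y n) -> x = y.
Proof. by move=> xy; apply: val_inj; apply: functional_extensionality_dep. Qed.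

Fact Zp_addA : associative Zp_add.
Proof. by move=> x y z; apply: Zp_eq => n; apply: addrA. Qed.
Fact Zp_addC : commutative Zp_add.
Proof. by move=> x y; apply: Zp_eq => n; apply: addrC. Qed.
Fact Zp_add0 : left_id Zp_zero Zp_add.
Proof. by move=> x; apply: Zp_eq => n; apply: add0r. Qed.
Fact Zp_addN : left_inverse Zp_zero Zp_opp Zp_add.
Proof. by move=> x; apply: Zp_eq => n; apply: addNr. Qed.
Fact Zp_mulA : associative Zp_mul.
Proof. by move=> x y z; apply: Zp_eq => n; apply: mulrA. Qed.
Fact Zp_mulC : commutative Zp_mul.
Proof. by move=> x y; apply: Zp_eq => n; apply: mulrC. Qed.
Fact Zp_mul1 : left_id Zp_one Zp_mul.
Proof. by move=> x; apply: Zp_eq => n; apply: mul1r. Qed.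
Fact Zp_mulD : left_distributive Zp_mul Zp_add.
Proof. by move=> x y z; apply: Zp_eq => n; apply: mulrDl. Qed.
Fact Zp_oner_neq0 : Zp_one != Zp_zero.
Proof. by apply/eqP => /(congr1 (fun x : Zp => val x 0%N)) /eqP; rewrite oner_eq0. Qed.

HB.instance Definition _ :=
  GRing.isZmodule.Build Zp Zp_addA Zp_addC Zp_add0 Zp_addN.
HB.instance Definition _ := GRing.Zmodule_isComNzRing.Build Zp
  Zp_mulA Zp_mulC Zp_mul1 Zp_mulD Zp_oner_neq0.

Definition Zp_unit : {pred Zp} := fun x => `[< exists y : Zp, y * x = 1 >].
Definition Zp_inv (x : Zp) : Zp :=
  if pselect (exists y : Zp, y * x = 1) is left h then sval (cid h) else x.

Fact Zp_mulVr : {in Zp_unit, left_inverse 1 Zp_inv *%R}.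
Proof.
by move=> x /asboolP xU; rewrite /Zp_inv; case: pselect => // h; case: cid.
Qed.
Fact Zp_unitP (x y : Zp) : y * x = 1 -> Zp_unit x.
Proof. by move=> yx; apply/asboolP; exists y. Qed.
Fact Zp_invr_out : {in [predC Zp_unit], Zp_inv =1 id}.
Proof.
by move=> x /asboolPn xU; rewrite /Zp_inv; case: pselect.
Qed.

HB.instance Definition _ := GRing.ComNzRing_hasMulInverse.Build Zp
  Zp_mulVr Zp_unitP Zp_invr_out.

Let Zp_red (x : Zp) i j : (i <= j)%N -> (val x j : nat)%:R = val x i.
Proof.
move=> /subnK <-; elim: (j - i)%N => [|d IH]; first by rewrite add0n Zpn_val.
have /asboolP xP := valP x.
rewrite addSn -IH -[in RHS](xP (d + i)%N) Zpn_val_natr -Zpn_natr_mod.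
by rewrite -[in RHS]Zpn_natr_mod modn_dvdm // dvdn_exp2l // ltnS leq_addl.
Qed.

Let Zp_logn (x : Zp) i j : (i <= j)%N -> val x i != 0 ->
  (0 < nat_of_ord (val x j))%N /\ (logn p (nat_of_ord (val x j)) <= i)%N.
Proof.
move=> ij; rewrite -(Zp_red x ij) => xi.
have ndv : ~~ (p ^ i.+1 %| nat_of_ord (val x j))%N.
  by apply: contra xi => /eqP xi; rewrite -Zpn_natr_mod xi.
have xj : (0 < nat_of_ord (val x j))%N by case: (nat_of_ord (val x j)) ndv; rewrite ?dvdn0.
by split => //; rewrite leqNgt -pfactor_dvdn.
Qed.

Let Zp_neq0 (x : Zp) : x != 0 -> exists i, val x i != 0.
Proof.
move=> x0; apply: contrapT => /forallNP h; move/eqP: x0; apply.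
by apply: Zp_eq => n; apply/eqP; apply: contrapT => /negP; apply: h.
Qed.

Fact Zp_domain : GRing.integral_domain_axiom Zp.
Proof.
move=> x y xy0; apply: contrapT => /negP; rewrite negb_or => /andP [/Zp_neq0 [i xi] /Zp_neq0 [j yj]].
pose N := (i + j).+1.
have [x0 xl] := @Zp_logn x i N (leqW (leq_addr _ _)) xi.
have [y0 yl] := @Zp_logn y j N (leqW (leq_addl _ _)) yj.
have : val (x * y) N = 0 by rewrite xy0.
rewrite -[val (x * y) N]/(val x N * val y N).
rewrite -{1}(Zpn_val (val x N)) -{1}(Zpn_val (val y N)) -natrM.
move=> /(congr1 (@nat_of_ord _)); rewrite Zpn_val_natr => /eqP h.
have : (p ^ N.+1 %| nat_of_ord (val x N) * nat_of_ord (val y N))%N by apply: h.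
rewrite pfactor_dvdn // ?muln_gt0 ?x0 //; rewrite lognM //.
move=> /leq_trans /(_ (leq_add xl yl)).
by rewrite ltnNge leqnSn.
Qed.

HB.instance Definition _ := GRing.ComUnitRing_isIntegral.Build Zp Zp_domain.

End PadicIntegers.

Definition Qp (p : nat) (p_pr : prime p) : fieldType := {fraction (Zp p_pr)}.

Section PadicTopology.
Variables (p : nat) (p_pr : prime p) (F : fieldExtType (Qp p_pr)).

Definition Zp_to_ext : Zp p_pr -> F := in_alg F \o @tofrac (Zp p_pr).

(* the ring of integers of F is the integral closure of Z_p in F *)
Definition padic_integer (x : F) : Prop := integralOver Zp_to_ext x.

(* F with its p-adic topology: the sets x + p^m O_F, for O_F the ring of
   integers, form a basis of neighbourhoods of x *)
Definition padic_field : Type := F.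

HB.instance Definition _ := GRing.Field.on padic_field.

Definition padic_nbhs (x : padic_field) (A : set padic_field) : Prop :=
  exists m : nat, forall z : F, padic_integer z -> A ((x : F) + p%:R ^+ m * z).

HB.instance Definition _ := hasNbhs.Build padic_field padic_nbhs.

Fact padic_nbhs_filter (x : padic_field) : ProperFilter (nbhs x).
Proof.
split.
  move=> [m /(_ 0)]; apply.
  exact: (integral0 (in_alg F \o @tofrac (Zp p_pr))).
split.
- by exists 0%N.
- move=> A B [m Am] [l Bl]; exists (m + l)%N => z zI; split.
  + rewrite exprD -mulrA; apply: Am; rewrite -natrX.
    exact: (integral_mul (integral_nat (in_alg F \o @tofrac (Zp p_pr)) _) zI).
  + rewrite addnC exprD -mulrA; apply: Bl; rewrite -natrX.
    exact: (integral_mul (integral_nat (in_alg F \o @tofrac (Zp p_pr)) _) zI).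
- by move=> A B AB [m Am]; exists m => z /Am /AB.
Qed.

Fact padic_nbhs_singleton (x : padic_field) (A : set padic_field) :
  nbhs x A -> A x.
Proof.
move=> [m /(_ 0)]; rewrite mulr0 addr0; apply.
exact: (integral0 (in_alg F \o @tofrac (Zp p_pr))).
Qed.

Fact padic_nbhs_nbhs (x : padic_field) (A : set padic_field) :
  nbhs x A -> nbhs x (nbhs^~ A).
Proof.
move=> [m Am]; exists m => z zI; exists m => w wI.
rewrite -addrA -mulrDr; apply: Am.
exact: (@integral_add _ _ (in_alg F \o @tofrac (Zp p_pr)) _ _ zI wI).
Qed.

HB.instance Definition _ := Nbhs_isNbhsTopological.Build padic_field
  padic_nbhs_filter padic_nbhs_singleton padic_nbhs_nbhs.

End PadicTopology.

(* The continuity of the group operations is the separate predicate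
   topological_group. *)
#[short(type="topGroupType")]
HB.structure Definition TopGroup := {G of Group G & Topological G}.

Section Subgroups.
Variable G : groupType.

Record subgroup := Subgroup {
  subgroup_set :> set G;
  _ : subgroup_set 1%g;
  _ : forall x y, subgroup_set x -> subgroup_set y -> subgroup_set (x * y)%g;
  _ : forall x, subgroup_set x -> subgroup_set (x^-1)%g
}.

Variable H : subgroup.

Lemma subgroup1 : subgroup_set H 1%g. Proof. by case: H. Qed.
Lemma subgroupM x y : subgroup_set H x -> subgroup_set H y -> subgroup_set H (x * y)%g.
Proof. by case: H => A ? AM ? /=; exact: AM. Qed.
Lemma subgroupV x : subgroup_set H x -> subgroup_set H (x^-1)%g.
Proof. by case: H => A ? ? AV /=; exact: AV. Qed.

Definition subgroup_type : Type := set_type (H : set G).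

HB.instance Definition _ := SubType.on subgroup_type.
HB.instance Definition _ := Choice.on subgroup_type.

Fact subgroup_group_closed : group_closed [in (H : set G)].
Proof.
split; first by rewrite inE; exact: subgroup1.
move=> x y; rewrite !inE => Hx Hy.
by apply: subgroupM => //; exact: subgroupV.
Qed.

HB.instance Definition _ := SubChoice_isSubGroup.Build G
  [in (H : set G)] subgroup_type subgroup_group_closed.

Definition subgroup_incl : subgroup_type -> G := val.

Definition normal : Prop := forall g x, subgroup_set H x -> subgroup_set H (g * x * g^-1)%g.

End Subgroups.

HB.instance Definition _ (G : topGroupType) (H : subgroup G) :=
  Topological.copy (subgroup_type H) (set_type (H : set G)).

Definition topological_group (G : topGroupType) : Prop :=
  continuous (fun xy : G * G => (xy.1 * xy.2)%g) /\
  continuous (fun x : G => x^-1%g).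

Definition profinite (G : topGroupType) : Prop :=
  [/\ topological_group G, compact [set: G], hausdorff_space G
    & totally_disconnected [set: G]].

Section QuotientGroup.
Variables (G : groupType).

Record normal_subgroup := NormalSubgroup {
  normal_subgroup_sub :> subgroup G;
  _ : normal normal_subgroup_sub
}.

Variable N : normal_subgroup.

Lemma normalP x g : subgroup_set N x -> subgroup_set N (g * x * g^-1)%g.
Proof. by case: N => M Mn /=; exact: Mn. Qed.

Definition lcoset_of (x : G) : set G := [set (x * y)%g | y in (N : set G)].

Definition is_lcoset (A : set G) : bool := `[< exists x, A = lcoset_of x >].

(* G / N, the set of cosets with the setwise operations *)
Definition quotient_group : Type := {A : set G | is_lcoset A}.

HB.instance Definition _ := SubType.copy quotient_group {A : set G | is_lcoset A}.
HB.instance Definition _ := Choice.copy quotient_group {A : set G | is_lcoset A}.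

Definition set_mulg (A B : set G) : set G :=
  [set (ab.1 * ab.2)%g | ab in A `*` B].
Definition set_invg (A : set G) : set G := [set a^-1%g | a in A].

Let mem_lcosetP x y : lcoset_of x y <-> subgroup_set N (x^-1 * y)%g.
Proof.
split; first by move=> [n Nn <-]; rewrite mulKg.
by move=> Nxy; exists (x^-1 * y)%g => //; rewrite mulVKg.
Qed.

Let set_mulg_lcoset x y :
  set_mulg (lcoset_of x) (lcoset_of y) = lcoset_of (x * y)%g.
Proof.
apply/seteqP; split => z.
- move=> [[_ _] [/= [n Nn <-] [m Nm <-]] <-] /=.
  apply/mem_lcosetP.
  have -> : ((x * y)^-1 * (x * n * (y * m)) = y^-1 * n * y^-1^-1 * m)%g.
    by rewrite invgM invgK !mulgA -(mulgA y^-1 x^-1 x)%g mulVg mulg1.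
  by apply: subgroupM => //; exact: normalP.
- move=> [n Nn <-]; exists (x, y * n)%g => /=; last by rewrite mulgA.
  split; last by exists n.
  by exists 1%g; [exact: subgroup1 | rewrite mulg1].
Qed.

Let set_invg_lcoset x : set_invg (lcoset_of x) = lcoset_of (x^-1)%g.
Proof.
apply/seteqP; split => z.
- move=> [_ [n Nn <-] <-]; apply/mem_lcosetP.
  by rewrite invgK invgM mulgA; apply: normalP; exact: subgroupV.
- move=> [n Nn <-]; exists (n^-1 * x)%g; last by rewrite invgM invgK.
  apply/mem_lcosetP; rewrite mulgA -{2}(invgK x).
  by apply: normalP; exact: subgroupV.
Qed.

Fact is_lcoset_of x : is_lcoset (lcoset_of x).
Proof. by apply/asboolP; exists x. Qed.

Fact is_lcosetM A B : is_lcoset A -> is_lcoset B -> is_lcoset (set_mulg A B).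
Proof.
move=> /asboolP [x ->] /asboolP [y ->]; rewrite set_mulg_lcoset.
exact: is_lcoset_of.
Qed.

Fact is_lcosetV A : is_lcoset A -> is_lcoset (set_invg A).
Proof.
by move=> /asboolP [x ->]; rewrite set_invg_lcoset; exact: is_lcoset_of.
Qed.

Let mkquo A (AP : is_lcoset A) : quotient_group :=
  @exist _ (fun A => is_lcoset A) A AP.

Definition quo_proj (x : G) : quotient_group := mkquo (is_lcoset_of x).
Definition quo_mul (A B : quotient_group) : quotient_group :=
  mkquo (is_lcosetM (valP A) (valP B)).
Definition quo_inv (A : quotient_group) : quotient_group :=
  mkquo (is_lcosetV (valP A)).

Lemma quo_projP (A : quotient_group) : exists x, A = quo_proj x.
Proof.
case: A => A AP; have /asboolP [x Ax] := AP; exists x.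
exact: val_inj.
Qed.

Let quo_projM x y : quo_mul (quo_proj x) (quo_proj y) = quo_proj (x * y)%g.
Proof. by apply: val_inj; exact: set_mulg_lcoset. Qed.
Let quo_projV x : quo_inv (quo_proj x) = quo_proj (x^-1)%g.
Proof. by apply: val_inj; exact: set_invg_lcoset. Qed.

Fact quo_mulA : associative quo_mul.
Proof.
move=> A B C; have [x ->] := quo_projP A; have [y ->] := quo_projP B.
by have [z ->] := quo_projP C; rewrite !quo_projM mulgA.
Qed.
Fact quo_mul1g : left_id (quo_proj 1%g) quo_mul.
Proof. by move=> A; have [x ->] := quo_projP A; rewrite quo_projM mul1g. Qed.
Fact quo_mulg1 : right_id (quo_proj 1%g) quo_mul.
Proof. by move=> A; have [x ->] := quo_projP A; rewrite quo_projM mulg1. Qed.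
Fact quo_mulVg : left_inverse (quo_proj 1%g) quo_inv quo_mul.
Proof.
by move=> A; have [x ->] := quo_projP A; rewrite quo_projV quo_projM mulVg.
Qed.
Fact quo_mulgV : right_inverse (quo_proj 1%g) quo_inv quo_mul.
Proof.
by move=> A; have [x ->] := quo_projP A; rewrite quo_projV quo_projM mulgV.
Qed.

HB.instance Definition _ := isGroup.Build quotient_group
  quo_mulA quo_mul1g quo_mulg1 quo_mulVg quo_mulgV.

Lemma quo_proj1 : quo_proj 1%g = 1%g. Proof. by []. Qed.
Lemma quo_projMg x y : quo_proj (x * y)%g = (quo_proj x * quo_proj y)%g.
Proof. by rewrite -quo_projM. Qed.

End QuotientGroup.

Section QuotientMap.
Variables (G : groupType) (N N' : normal_subgroup G).

(* the projection xN |-> xN', meaningful for N contained in N' (see quo_mapE) *)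
Definition quo_map (A : quotient_group N) : quotient_group N' :=
  quo_proj N' (xget 1%g (val A)).

Lemma quo_mapE x : N `<=` N' -> quo_map (quo_proj N x) = quo_proj N' x.
Proof.
move=> NN'; apply: val_inj => /=.
have : lcoset_of N x (xget 1%g (lcoset_of N x)).
  by apply: xgetPex; exists x; exists 1%g; [exact: subgroup1 | rewrite mulg1].
move=> [n Nn <-]; apply/seteqP; split => _ [m Nm <-].
- by exists (n * m)%g; [apply: subgroupM => //; exact: NN' | rewrite mulgA].
- exists (n^-1 * m)%g; last by rewrite -mulgA mulVKg.
  by apply: subgroupM => //; apply: subgroupV; exact: NN'.
Qed.

End QuotientMap.

Section GroupRing.
Variable k : comNzRingType.

(* k[G]: the finitely supported functions G -> k *)
Definition group_ring (G : groupType) : Type := {fsfun G -> k with 0}.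

HB.instance Definition _ (G : groupType) := Choice.on (group_ring G).

Section Operations.
Variable G : groupType.
Implicit Types (f g h : group_ring G).

Definition gr_coef f (x : G) : k := (f : {fsfun G -> k with 0}) x.
Definition gr_supp f : {fset G} := finsupp (f : {fsfun G -> k with 0}).

Definition gr_single (x : G) : group_ring G := [fsfun y in [fset x]%fset => 1].

Definition gr_zero : group_ring G := [fsfun].
Definition gr_opp f : group_ring G := [fsfun x in gr_supp f => - gr_coef f x].
Definition gr_add f g : group_ring G :=
  [fsfun x in (gr_supp f `|` gr_supp g)%fset => gr_coef f x + gr_coef g x].
Definition gr_scale (c : k) f : group_ring G :=
  [fsfun x in gr_supp f => c * gr_coef f x].
Definition gr_mul f g : group_ring G :=
  [fsfun z in [fset (x * y)%g | x in gr_supp f, y in gr_supp g]%fset =>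
     \sum_(x <- gr_supp f) \sum_(y <- gr_supp g | (x * y)%g == z)
        gr_coef f x * gr_coef g y].

(* the k-linear extension of w : G -> k *)
Definition gr_eval (w : G -> k) f : k := \sum_(x <- gr_supp f) gr_coef f x * w x.

Let memNsupp f x : x \notin gr_supp f -> gr_coef f x = 0.
Proof. exact: fsfun_dflt. Qed.

Lemma gr_evalS (A : {fset G}) w f : (gr_supp f `<=` A)%fset ->
  gr_eval w f = \sum_(x <- A) gr_coef f x * w x.
Proof.
move=> fA; rewrite /gr_eval; apply: big_fset_incl => // x _ /memNsupp ->.
by rewrite mul0r.
Qed.

Lemma gr_evalE f x : gr_eval (fun y => (y == x)%:R) f = gr_coef f x.
Proof.
rewrite (@gr_evalS (x |` gr_supp f)%fset) ?fsubsetU1 //.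
rewrite (big_fsetD1 x) ?fset1U1 //= eqxx mulr1 big1_fset ?addr0 // => y.
by rewrite !inE => /andP [/negPf ->] _ _; rewrite mulr0.
Qed.

Lemma gr_eval_inj f g : (forall w, gr_eval w f = gr_eval w g) -> f = g.
Proof.
by move=> fg; apply/fsfunP => x; rewrite -!/(gr_coef _ _) -!gr_evalE fg.
Qed.

Lemma eq_gr_eval w w' f : w =1 w' -> gr_eval w f = gr_eval w' f.
Proof. by move=> ww'; apply: eq_bigr => x _; rewrite ww'. Qed.

Lemma gr_eval0 w : gr_eval w gr_zero = 0.
Proof. by rewrite /gr_eval big1 // => x _; rewrite /gr_coef fsfunE mul0r. Qed.

Lemma gr_eval_single w x : gr_eval w (gr_single x) = w x.
Proof.
rewrite (@gr_evalS [fset x]%fset); last first.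
  by apply/fsubsetP => y; rewrite mem_finsupp fsfunE; case: ifP; rewrite ?eqxx.
by rewrite big_seq_fset1 /gr_coef fsfunE inE eqxx mul1r.
Qed.

Lemma gr_evalN w f : gr_eval w (gr_opp f) = - gr_eval w f.
Proof.
rewrite (@gr_evalS (gr_supp f)); last first.
  by apply/fsubsetP => y; rewrite mem_finsupp fsfunE; case: ifP; rewrite ?eqxx.
rewrite -sumrN; apply: eq_big_seq => x xf.
by rewrite {1}/gr_coef fsfunE xf mulNr.
Qed.

Lemma gr_evalZ w c f : gr_eval w (gr_scale c f) = c * gr_eval w f.
Proof.
rewrite (@gr_evalS (gr_supp f)); last first.
  by apply/fsubsetP => y; rewrite mem_finsupp fsfunE; case: ifP; rewrite ?eqxx.
rewrite mulr_sumr; apply: eq_big_seq => x xf.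
by rewrite {1}/gr_coef fsfunE xf mulrA.
Qed.

Lemma gr_evalD w f g : gr_eval w (gr_add f g) = gr_eval w f + gr_eval w g.
Proof.
rewrite !(@gr_evalS (gr_supp f `|` gr_supp g)%fset) ?fsubsetUl ?fsubsetUr //.
  rewrite -big_split; apply: eq_big_seq => x xfg.
  by rewrite {1}/gr_coef fsfunE xfg mulrDl.
by apply/fsubsetP => y; rewrite mem_finsupp fsfunE; case: ifP; rewrite ?eqxx.
Qed.

Lemma gr_evalM w f g : gr_eval w (gr_mul f g) =
  gr_eval (fun x => gr_eval (fun y => w (x * y)%g) g) f.
Proof.
set A := [fset (x * y)%g | x in gr_supp f, y in gr_supp g]%fset.
rewrite (@gr_evalS A); last first.
  by apply/fsubsetP => y; rewrite mem_finsupp fsfunE; case: ifP; rewrite ?eqxx.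
under eq_big_seq => z zA do rewrite {1}/gr_coef fsfunE zA mulr_suml.
rewrite exchange_big; apply: eq_big_seq => x xf /=.
rewrite /gr_eval.
under eq_bigr => z _ do rewrite mulr_suml big_mkcond.
rewrite exchange_big mulr_sumr; apply: eq_big_seq => y yg /=.
have xyA : (x * y)%g \in A by apply/imfset2P; exists x => //; exists y.
rewrite (big_fsetD1 (x * y)%g) //= eqxx big1_fset ?addr0 ?mulrA // => z.
by rewrite !inE eq_sym => /andP [/negPf ->].
Qed.

Lemma gr_eval_add w w' f :
  gr_eval (fun x => w x + w' x) f = gr_eval w f + gr_eval w' f.
Proof. by rewrite -big_split; apply: eq_bigr => x _; rewrite mulrDr. Qed.

Lemma gr_eval_scale c w f : gr_eval (fun x => c * w x) f = c * gr_eval w f.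
Proof. by rewrite mulr_sumr; apply: eq_bigr => x _; rewrite mulrCA. Qed.

Fact gr_addA : associative gr_add.
Proof. by move=> f g h; apply: gr_eval_inj => w; rewrite !gr_evalD addrA. Qed.
Fact gr_addC : commutative gr_add.
Proof. by move=> f g; apply: gr_eval_inj => w; rewrite !gr_evalD addrC. Qed.
Fact gr_add0 : left_id gr_zero gr_add.
Proof. by move=> f; apply: gr_eval_inj => w; rewrite gr_evalD gr_eval0 add0r. Qed.
Fact gr_addN : left_inverse gr_zero gr_opp gr_add.
Proof.
by move=> f; apply: gr_eval_inj => w; rewrite gr_evalD gr_evalN gr_eval0 addNr.
Qed.

HB.instance Definition _ := GRing.isZmodule.Build (group_ring G)
  gr_addA gr_addC gr_add0 gr_addN.

Fact gr_mulA : associative gr_mul.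
Proof.
move=> f g h; apply: gr_eval_inj => w; rewrite !gr_evalM.
apply: eq_gr_eval => x; rewrite gr_evalM; apply: eq_gr_eval => y.
by apply: eq_gr_eval => z; rewrite mulgA.
Qed.
Fact gr_mul1r : left_id (gr_single 1%g) gr_mul.
Proof.
move=> f; apply: gr_eval_inj => w; rewrite gr_evalM gr_eval_single.
by apply: eq_gr_eval => x; rewrite mul1g.
Qed.
Fact gr_mulr1 : right_id (gr_single 1%g) gr_mul.
Proof.
move=> f; apply: gr_eval_inj => w; rewrite gr_evalM.
by apply: eq_gr_eval => x; rewrite gr_eval_single mulg1.
Qed.
Fact gr_mulDl : left_distributive gr_mul +%R.
Proof.
move=> f g h; apply: gr_eval_inj => w.
by rewrite gr_evalD !gr_evalM gr_evalD.
Qed.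
Fact gr_mulDr : right_distributive gr_mul +%R.
Proof.
move=> f g h; apply: gr_eval_inj => w.
rewrite gr_evalD !gr_evalM -gr_eval_add; apply: eq_gr_eval => x.
by rewrite gr_evalD.
Qed.
Fact gr_oner_neq0 : gr_single 1%g != 0 :> group_ring G.
Proof.
apply/eqP => /(congr1 (gr_eval (fun => 1))) /eqP.
by rewrite gr_eval_single gr_eval0 oner_eq0.
Qed.

HB.instance Definition _ := GRing.Zmodule_isNzRing.Build (group_ring G)
  gr_mulA gr_mul1r gr_mulr1 gr_mulDl gr_mulDr gr_oner_neq0.

Fact gr_scaleA a b f : gr_scale a (gr_scale b f) = gr_scale (a * b) f.
Proof. by apply: gr_eval_inj => w; rewrite !gr_evalZ mulrA. Qed.
Fact gr_scale1 : left_id 1 gr_scale.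
Proof. by move=> f; apply: gr_eval_inj => w; rewrite gr_evalZ mul1r. Qed.
Fact gr_scaleDr : right_distributive gr_scale +%R.
Proof.
by move=> a f g; apply: gr_eval_inj => w; rewrite !(gr_evalZ, gr_evalD) mulrDr.
Qed.
Fact gr_scaleDl f : {morph gr_scale^~ f : a b / a + b}.
Proof.
by move=> a b; apply: gr_eval_inj => w; rewrite !(gr_evalZ, gr_evalD) mulrDl.
Qed.

HB.instance Definition _ := GRing.Zmodule_isLmodule.Build k (group_ring G)
  gr_scaleA gr_scale1 gr_scaleDr gr_scaleDl.

Fact gr_scaleAl (a : k) (f g : group_ring G) : a *: (f * g) = (a *: f) * g.
Proof.
by apply: gr_eval_inj => w; rewrite !(gr_evalZ, gr_evalM).
Qed.

HB.instance Definition _ := GRing.Lmodule_isLalgebra.Build k (group_ring G)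
  gr_scaleAl.

Fact gr_scaleAr (a : k) (f g : group_ring G) : a *: (f * g) = f * (a *: g).
Proof.
apply: gr_eval_inj => w; rewrite gr_evalZ !gr_evalM -gr_eval_scale.
by apply: eq_gr_eval => x; rewrite gr_evalZ.
Qed.

HB.instance Definition _ := GRing.Lalgebra_isAlgebra.Build k (group_ring G)
  gr_scaleAr.

End Operations.

(* the k-linear extension k[G] -> k[H] of phi : G -> H *)
Definition gr_map (G H : groupType) (phi : G -> H) (f : group_ring G) :
    group_ring H :=
  [fsfun z in [fset phi x | x in gr_supp f]%fset =>
     \sum_(x <- gr_supp f | phi x == z) gr_coef f x].

Lemma gr_eval_map (G H : groupType) (phi : G -> H) w (f : group_ring G) :
  gr_eval w (gr_map phi f) = gr_eval (w \o phi) f.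
Proof.
set A := [fset phi x | x in gr_supp f]%fset.
rewrite (@gr_evalS _ A); last first.
  by apply/fsubsetP => y; rewrite mem_finsupp fsfunE; case: ifP; rewrite ?eqxx.
under eq_big_seq => z zA do rewrite {1}/gr_coef fsfunE zA mulr_suml big_mkcond.
rewrite exchange_big; apply: eq_big_seq => x xf /=.
have xA : phi x \in A by apply/imfsetP; exists x.
rewrite (big_fsetD1 (phi x)) //= eqxx big1_fset ?addr0 // => z.
by rewrite !inE eq_sym => /andP [/negPf ->].
Qed.

Section Map.
Variables (G H : groupType) (phi : G -> H).

Lemma gr_mapD : {morph @gr_map G H phi : f g / f + g}.
Proof.
move=> f g; apply: gr_eval_inj => w.
by rewrite gr_evalD !gr_eval_map -gr_evalD.
Qed.
Lemma gr_map0 : gr_map phi 0 = 0.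
Proof. by apply: gr_eval_inj => w; rewrite gr_eval_map !gr_eval0. Qed.
Lemma gr_mapN : {morph @gr_map G H phi : f / - f}.
Proof.
move=> f; apply: gr_eval_inj => w.
by rewrite gr_evalN !gr_eval_map -gr_evalN.
Qed.
Lemma gr_mapZ a : {morph @gr_map G H phi : f / a *: f}.
Proof.
move=> f; apply: gr_eval_inj => w.
by rewrite gr_evalZ !gr_eval_map -gr_evalZ.
Qed.
Lemma gr_map1 : phi 1%g = 1%g -> gr_map phi 1 = 1.
Proof.
by move=> phi1; apply: gr_eval_inj => w; rewrite gr_eval_map !gr_eval_single /= phi1.
Qed.
Lemma gr_mapM : {morph phi : x y / (x * y)%g} -> {morph gr_map phi : f g / f * g}.
Proof.
move=> phiM f g; apply: gr_eval_inj => w; rewrite gr_evalM !gr_eval_map gr_evalM.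
apply: eq_gr_eval => x; rewrite /= gr_eval_map.
by apply: eq_gr_eval => y; rewrite /= phiM.
Qed.
End Map.

Lemma gr_map_comp (G1 G2 G3 : groupType) (phi : G1 -> G2) (psi : G2 -> G3) f :
  gr_map psi (gr_map phi f) = gr_map (psi \o phi) f.
Proof. by apply: gr_eval_inj => w; rewrite !gr_eval_map. Qed.

Lemma eq_gr_map (G H : groupType) (phi psi : G -> H) f :
  phi =1 psi -> gr_map phi f = gr_map psi f.
Proof.
move=> e; apply: gr_eval_inj => w; rewrite !gr_eval_map.
by apply: eq_gr_eval => x /=; rewrite e.
Qed.

End GroupRing.

Arguments quo_map {G} N N' A.

Section CompletedGroupRing.
Variables (k : comNzRingType) (H : topGroupType).

Record open_normal := OpenNormal {
  open_normal_sub :> normal_subgroup H;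
  _ : open (open_normal_sub : set H)
}.

Definition whole_subgroup : subgroup H :=
  @Subgroup H setT I (fun _ _ _ _ => I) (fun _ _ => I).
Definition whole_normal : normal_subgroup H :=
  @NormalSubgroup H whole_subgroup (fun _ _ _ => I).
Definition whole_open_normal : open_normal := @OpenNormal whole_normal openT.

Definition cgr_family := forall N : open_normal, group_ring k (quotient_group N).

Definition cgr_compat (a : cgr_family) : bool :=
  `[< forall N N' : open_normal, N `<=` N' -> gr_map (quo_map N N') (a N) = a N' >].

(* kH, the limit of the group rings k[H/N] over the open normal subgroups N *)
Definition completed_group_ring : Type := {a : cgr_family | cgr_compat a}.

HB.instance Definition _ := SubType.copy completed_group_ring {a : cgr_family | cgr_compat a}.
HB.instance Definition _ := Choice.copy completed_group_ring {a : cgr_family | cgr_compat a}.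

Let quo_map1 (N N' : open_normal) : N `<=` N' -> quo_map N N' 1%g = 1%g.
Proof. by move=> NN'; rewrite -quo_proj1 quo_mapE. Qed.

Let quo_mapM (N N' : open_normal) : N `<=` N' ->
  {morph quo_map N N' : x y / (x * y)%g}.
Proof.
move=> NN' A B; have [x ->] := quo_projP A; have [y ->] := quo_projP B.
by rewrite -quo_projMg !quo_mapE // quo_projMg.
Qed.

Fact cgr_compat0 : cgr_compat (fun=> 0).
Proof. by apply/asboolP => N N' _; rewrite gr_map0. Qed.
Fact cgr_compat1 : cgr_compat (fun=> 1).
Proof. by apply/asboolP => N N' NN'; rewrite gr_map1 // quo_map1. Qed.
Fact cgr_compatN a : cgr_compat a -> cgr_compat (fun N => - a N).
Proof. by move=> /asboolP aP; apply/asboolP => N N' ?; rewrite gr_mapN aP. Qed.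
Fact cgr_compatZ c a : cgr_compat a -> cgr_compat (fun N => c *: a N).
Proof. by move=> /asboolP aP; apply/asboolP => N N' ?; rewrite gr_mapZ aP. Qed.
Fact cgr_compatD a b : cgr_compat a -> cgr_compat b ->
  cgr_compat (fun N => a N + b N).
Proof.
move=> /asboolP aP /asboolP bP; apply/asboolP => N N' ?.
by rewrite gr_mapD aP // bP.
Qed.
Fact cgr_compatM a b : cgr_compat a -> cgr_compat b ->
  cgr_compat (fun N => a N * b N).
Proof.
move=> /asboolP aP /asboolP bP; apply/asboolP => N N' NN'.
by rewrite gr_mapM ?aP ?bP //; exact: quo_mapM.
Qed.

Let mk a (aP : cgr_compat a) : completed_group_ring :=
  @exist _ (fun a => cgr_compat a) a aP.

Definition cgr_zero := mk cgr_compat0.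
Definition cgr_one := mk cgr_compat1.
Definition cgr_opp (a : completed_group_ring) := mk (cgr_compatN (valP a)).
Definition cgr_scale (c : k) (a : completed_group_ring) :=
  mk (cgr_compatZ c (valP a)).
Definition cgr_add (a b : completed_group_ring) :=
  mk (cgr_compatD (valP a) (valP b)).
Definition cgr_mul (a b : completed_group_ring) :=
  mk (cgr_compatM (valP a) (valP b)).

Lemma cgr_eq (a b : completed_group_ring) : (forall N, val a N = val b N) -> a = b.
Proof. by move=> ab; apply: val_inj; apply: functional_extensionality_dep. Qed.

Fact cgr_addA : associative cgr_add.
Proof. by move=> a b c; apply: cgr_eq => N; apply: addrA. Qed.
Fact cgr_addC : commutative cgr_add.
Proof. by move=> a b; apply: cgr_eq => N; apply: addrC. Qed.
Fact cgr_add0 : left_id cgr_zero cgr_add.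
Proof. by move=> a; apply: cgr_eq => N; apply: add0r. Qed.
Fact cgr_addN : left_inverse cgr_zero cgr_opp cgr_add.
Proof. by move=> a; apply: cgr_eq => N; apply: addNr. Qed.

HB.instance Definition _ := GRing.isZmodule.Build completed_group_ring
  cgr_addA cgr_addC cgr_add0 cgr_addN.

Fact cgr_mulA : associative cgr_mul.
Proof. by move=> a b c; apply: cgr_eq => N; apply: mulrA. Qed.
Fact cgr_mul1r : left_id cgr_one cgr_mul.
Proof. by move=> a; apply: cgr_eq => N; apply: mul1r. Qed.
Fact cgr_mulr1 : right_id cgr_one cgr_mul.
Proof. by move=> a; apply: cgr_eq => N; apply: mulr1. Qed.
Fact cgr_mulDl : left_distributive cgr_mul +%R.
Proof. by move=> a b c; apply: cgr_eq => N; apply: mulrDl. Qed.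
Fact cgr_mulDr : right_distributive cgr_mul +%R.
Proof. by move=> a b c; apply: cgr_eq => N; apply: mulrDr. Qed.
Fact cgr_oner_neq0 : cgr_one != 0.
Proof.
apply/eqP => /(congr1 (fun a : completed_group_ring => val a whole_open_normal)).
by move=> /eqP; rewrite oner_eq0.
Qed.

HB.instance Definition _ := GRing.Zmodule_isNzRing.Build completed_group_ring
  cgr_mulA cgr_mul1r cgr_mulr1 cgr_mulDl cgr_mulDr cgr_oner_neq0.

Fact cgr_scaleA a b f : cgr_scale a (cgr_scale b f) = cgr_scale (a * b) f.
Proof. by apply: cgr_eq => N; apply: scalerA. Qed.
Fact cgr_scale1 : left_id 1 cgr_scale.
Proof. by move=> f; apply: cgr_eq => N; apply: scale1r. Qed.
Fact cgr_scaleDr : right_distributive cgr_scale +%R.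
Proof. by move=> a f g; apply: cgr_eq => N; apply: scalerDr. Qed.
Fact cgr_scaleDl f : {morph cgr_scale^~ f : a b / a + b}.
Proof. by move=> a b; apply: cgr_eq => N; apply: scalerDl. Qed.

HB.instance Definition _ := GRing.Zmodule_isLmodule.Build k completed_group_ring
  cgr_scaleA cgr_scale1 cgr_scaleDr cgr_scaleDl.

Fact cgr_scaleAl (a : k) (f g : completed_group_ring) :
  a *: (f * g) = (a *: f) * g.
Proof. by apply: cgr_eq => N; apply: scalerAl. Qed.

HB.instance Definition _ := GRing.Lmodule_isLalgebra.Build k completed_group_ring
  cgr_scaleAl.

Fact cgr_scaleAr (a : k) (f g : completed_group_ring) :
  a *: (f * g) = f * (a *: g).
Proof. by apply: cgr_eq => N; apply: scalerAr. Qed.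

HB.instance Definition _ := GRing.Lalgebra_isAlgebra.Build k completed_group_ring
  cgr_scaleAr.

Fact gr_completion_compat (f : group_ring k H) :
  cgr_compat (fun N => gr_map (quo_proj N) f).
Proof.
apply/asboolP => N N' NN'; rewrite gr_map_comp; apply: eq_gr_map => x.
exact: quo_mapE.
Qed.

(* the natural map k[H] -> kH *)
Definition gr_completion (f : group_ring k H) : completed_group_ring :=
  mk (gr_completion_compat f).

End CompletedGroupRing.

Section TensorProduct.
Variables (R M N : nzRingType) (f : R -> M) (g : R -> N).

(* M is a right R-module via f, and N is a left R-module via g. *)
Definition balanced (B : zmodType) (t : M -> N -> B) : Prop :=
  [/\ forall x x' y, t (x + x') y = t x y + t x' y,
      forall x y y', t x (y + y') = t x y + t x y'
    & forall x r y, t (x * f r) y = t x (g r * y)].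

(* The universal property of M (x)_R N; the pure tensors are the t x y. *)
Definition is_tensor_product (T : zmodType) (t : M -> N -> T) : Prop :=
  balanced t /\
  forall (B : zmodType) (u : M -> N -> B), balanced u ->
    exists phi : {additive T -> B},
      (forall x y, phi (t x y) = u x y) /\
      (forall psi : {additive T -> B},
         (forall x y, psi (t x y) = u x y) -> psi =1 phi).

End TensorProduct.

(* A is the augmented Iwasawa algebra kG, with respect to the subgroup K of G:
   the natural maps a : kK -> A and b : k[G] -> A are homomorphisms of
   k-algebras, and A = kK (x)_{k[K]} k[G] with x (x) y = a x * b y. The last
   equation makes the algebra structure on the tensor product unique. *)
Definition is_augmented_iwasawa_algebra (k : comNzRingType) (G : topGroupType)
    (K : subgroup G) (A : algType k) : Prop :=
  exists (a : {lrmorphism completed_group_ring k (subgroup_type K) -> A})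
         (b : {lrmorphism group_ring k G -> A}),
    is_tensor_product
      (@gr_completion k (subgroup_type K)) (gr_map (@subgroup_incl G K))
      (fun x y => a x * b y).

Section Unitriangular.
Variables (F : fieldType) (n : nat).

Definition is_unitriangular (A : 'M[F]_n) : bool :=
  [forall i, A i i == 1] && [forall i : 'I_n, forall (j : 'I_n | (j < i)%N), A i j == 0].

(* U_n(F), upper triangular matrices with 1 on the diagonal *)
Definition unitriangular : Type := {A : 'M[F]_n | is_unitriangular A}.

HB.instance Definition _ := SubType.copy unitriangular {A : 'M[F]_n | is_unitriangular A}.
HB.instance Definition _ := Choice.copy unitriangular {A : 'M[F]_n | is_unitriangular A}.

Let unitriP (A : 'M[F]_n) : reflect
  ((forall i, A i i = 1) /\ (forall i j : 'I_n, (j < i)%N -> A i j = 0))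
  (is_unitriangular A).
Proof.
apply: (iffP andP) => -[h1 h2]; split.
- by move=> i; apply/eqP; move/forallP: h1.
- by move=> i j ji; apply/eqP; move/forallP/(_ i)/forall_inP: h2; apply.
- by apply/forallP => i; rewrite h1.
- by apply/forallP => i; apply/forall_inP => j ji; rewrite h2.
Qed.

Let unitri_unit (A : 'M[F]_n) : is_unitriangular A -> A \in unitmx.
Proof.
move=> /unitriP [A1 A0]; rewrite unitmxE -det_tr det_trig.
  by rewrite big1 ?unitr1 // => i _; rewrite mxE A1.
by apply/is_trig_mxP => i j ij; rewrite mxE A0.
Qed.

Fact unitriangular1 : is_unitriangular 1%:M.
Proof.
apply/unitriP; split => [i|i j ji]; rewrite mxE ?eqxx //.
by case: eqP ji => // ->; rewrite ltnn.
Qed.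

Fact unitriangularM (A B : 'M[F]_n) :
  is_unitriangular A -> is_unitriangular B -> is_unitriangular (A *m B).
Proof.
move=> /unitriP [A1 A0] /unitriP [B1 B0]; apply/unitriP; split => [i|i j ji].
  rewrite mxE (bigD1 i) //= A1 B1 mulr1 big1 ?addr0 // => l li.
  case: (ltngtP l i) => [h|h|/val_inj h]; first by rewrite A0 // mul0r.
    by rewrite B0 // mulr0.
  by rewrite h eqxx in li.
rewrite mxE big1 // => l _; case: (ltnP l i) => h; first by rewrite A0 // mul0r.
by rewrite B0 ?mulr0 //; exact: leq_trans h.
Qed.

Fact unitriangularV (A : 'M[F]_n) : is_unitriangular A -> is_unitriangular (invmx A).
Proof.
move=> AU; have AV := mulmxV (unitri_unit AU).
have /unitriP [A1 A0] := AU.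
have key d : forall i j : 'I_n, (n - i <= d)%N -> (j <= i)%N ->
    invmx A i j = (i == j)%:R.
  elim: d => [|d IH] i j; first by rewrite leqn0 subn_eq0 leqNgt ltn_ord.
  move=> nid ji; have /matrixP/(_ i j) := AV; rewrite !mxE => <-.
  rewrite (bigD1 i) //= A1 mul1r big1 ?addr0 // => l li.
  case: (ltngtP l i) => [h|h|/val_inj h]; first by rewrite A0 // mul0r.
    rewrite IH; first by rewrite -val_eqE /= gtn_eqF ?mulr0 //; exact: leq_ltn_trans h.
    - move: nid; rewrite !leq_subLR => /leq_trans; apply.
      by rewrite addnS -addSn leq_add2r.
    - by apply: ltnW; exact: leq_ltn_trans h.
  by rewrite h eqxx in li.
apply/unitriP; split => [i|i j ji]; rewrite (key n) ?leq_subr //.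
- by rewrite eqxx.
- by rewrite -val_eqE /= gtn_eqF.
- exact: ltnW.
Qed.

Let mk A (AU : is_unitriangular A) : unitriangular :=
  @exist _ (fun A => is_unitriangular A) A AU.

Definition unitri_one := mk unitriangular1.
Definition unitri_mul (A B : unitriangular) :=
  mk (unitriangularM (valP A) (valP B)).
Definition unitri_inv (A : unitriangular) := mk (unitriangularV (valP A)).

Fact unitri_mulA : associative unitri_mul.
Proof. by move=> A B C; apply: val_inj; apply: mulmxA. Qed.
Fact unitri_mul1g : left_id unitri_one unitri_mul.
Proof. by move=> A; apply: val_inj; apply: mul1mx. Qed.
Fact unitri_mulg1 : right_id unitri_one unitri_mul.
Proof. by move=> A; apply: val_inj; apply: mulmx1. Qed.
Fact unitri_mulVg : left_inverse unitri_one unitri_inv unitri_mul.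
Proof. by move=> A; apply: val_inj; apply: mulVmx; exact: unitri_unit (valP A). Qed.
Fact unitri_mulgV : right_inverse unitri_one unitri_inv unitri_mul.
Proof. by move=> A; apply: val_inj; apply: mulmxV; exact: unitri_unit (valP A). Qed.

HB.instance Definition _ := isGroup.Build unitriangular
  unitri_mulA unitri_mul1g unitri_mulg1 unitri_mulVg unitri_mulgV.

End Unitriangular.

(* U_n(F) with the p-adic topology *)
Definition padic_unitriangular (p : nat) (p_pr : prime p)
    (F : fieldExtType (Qp p_pr)) (n : nat) : Type := unitriangular F n.

Section PadicUnitriangular.
Variables (p : nat) (p_pr : prime p) (F : fieldExtType (Qp p_pr)) (n : nat).

Definition padic_unitriangular_val (A : padic_unitriangular F n) :
  'M[padic_field F]_n := sval A.

HB.instance Definition _ := Group.copy (padic_unitriangular F n) (unitriangular F n).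
HB.instance Definition _ := Topological.copy (padic_unitriangular F n)
  (initial_topology padic_unitriangular_val).

End PadicUnitriangular.

(* Main.v *)
From HB Require Import structures.
Require Import Defs.
From mathcomp Require Import all_boot all_order all_algebra all_field.
From mathcomp Require Import finmap all_classical topology.
Set Implicit Arguments.
Unset Strict Implicit.
Unset Printing Implicit Defensive.
Import GRing.Theory.
Local Open Scope classical_set_scope.
Local Open Scope ring_scope.

(** Let G be the group U. The completed group ring kK is Noetherian on both
    sides, and kG is a directed union of subrings that are finite over kK and over
    which kG is free; coherence follows formally. Indeed, a finite family in kG lies
    in the subring B of the elements supported on some subgroup K' that contains K
    with finite index, because a group of unipotent matrices over F is the directed
    union of such K' (K_union). A syzygy over kG
    between elements of B decomposes along the cosets of K' into syzygies over B,
    and these form a finitely generated module, B being finite over kK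
    (coherent_of_noetherian_pieces).

    For kK, matrices are filtered by their superdiagonals. This gives topological
    generators g_0, ..., g_(r-1) of K such that the commutator of g_l with any
    element is generated by later ones (unipotent_chain), and K is pro-p. Give
    weights to p and to the g_j - 1: primes q_0 = 2, q_1, ..., each larger than
    the square of the previous one, so that weights can be multiplied and a
    monomial can be read off from its weight. Let filt n be the closure of the span
    of the words of weight at least n. A commutator of two letters involves only
    later letters, hence has larger weight than their product, so filt n modulo
    filt (n + 1) is spanned by a single standard word over the residue field
    (filt_lead): the graded ring is essentially a commutative polynomial ring in
    r + 1 variables. The filtration defines the topology of kK (filt_open and
    filt_nbhd), so kK is complete for it, and Dickson's lemma bounds the number of
    generators of an ideal (filtered_fg). One-sided ideals are closed as well, and
    therefore the kernel of kK -> k[K/N] is generated by the nu - 1 with nu in N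
    (completed_generation).

    As kG is only known as a tensor product, it is studied by pairing it with
    functions G -> k that are invariant on both sides under an open subgroup (ev).
    How left multiplication by an element of G interacts with kK is not part of
    the universal property; completed_generation makes this multiplication
    continuous (ev_lmul). Supports and decompositions along cosets are then defined
    by duality. *)

(** * Noetherian modules and a criterion for coherence *)

Section Span.
Variables (S : nzRingType) (V : lmodType S).

(** Recursion on the list serves to eliminate one coefficient at a time. *)
Fixpoint lspan (s : seq V) (x : V) : Prop :=
  if s is v :: s' then exists c : S, lspan s' (x - c *: v) else x = 0.

Lemma lspanP (s : seq V) x : lspan s x ->
  exists c : 'I_(size s) -> S, x = \sum_i c i *: s`_i.
Proof.
elim: s x => [|v s IH] x /=.
  by move=> ->; exists (fun=> 0); rewrite big_ord0.
move=> [c /IH [d xE]]; exists (fun i => oapp d c (unlift ord0 i)).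
rewrite big_ord_recl unlift_none /= -[LHS](subrK (c *: v)) addrC xE; congr (_ + _).
by apply: eq_bigr => i _; rewrite liftK.
Qed.

Lemma lspan_family (I : finType) (a : I -> V) (c : I -> S) :
  lspan [seq a i | i <- enum I] (\sum_i c i *: a i).
Proof.
rewrite -big_enum; elim: (enum I) => [|i l IH] /=; first by rewrite big_nil.
by exists (c i); rewrite big_cons addrAC subrr add0r.
Qed.

Lemma lspan_cat (s t : seq V) x y : lspan s (x - y) -> lspan t y -> lspan (s ++ t) x.
Proof.
elim: s x => [|v s IH] x /=; first by move=> /eqP; rewrite subr_eq0 => /eqP ->.
by move=> [c h] ty; exists c; apply: IH => //; rewrite addrAC.
Qed.

End Span.

Definition left_noetherian (S : nzRingType) : Prop :=
  forall I : set S, left_ideal I ->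
    exists s : seq S^o, (forall x, x \in s -> I x) /\ forall x, I x -> lspan s x.

Definition submodule (S : nzRingType) (V : lmodType S) (Q : set V) : Prop :=
  [/\ Q 0, (forall x y, Q x -> Q y -> Q (x + y)) & (forall c x, Q x -> Q (c *: x))].

Section SubmoduleOfFree.
Variables (S : nzRingType) (I : finType).
Let V := {ffun I -> S^o}.

Let lift_seq (Q : set V) i (s : seq S^o) :
  (forall x, x \in s -> exists2 v, Q v & v i = x) ->
  exists s' : seq V, (forall v, v \in s' -> Q v) /\ map (fun v : V => v i) s' = s.
Proof.
elim: s => [|x s IH] h; first by exists [::].
have [|s' [s'Q s'E]] := IH; first by move=> y ys; apply: h; rewrite inE ys orbT.
have [|v Qv vx] := h x; first by rewrite inE eqxx.
exists (v :: s'); split; last by rewrite /= vx s'E.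
by move=> w; rewrite inE => /predU1P [->|/s'Q].
Qed.

Let lift_span (i : I) (s : seq V) (x : V) :
  lspan (map (fun v : V => v i) s) (x i : S^o) ->
  exists2 y : V, y i = 0 & lspan s (x - y).
Proof.
elim: s x => [|v s IH] x /=; first by move=> xi; exists x => //; rewrite subrr.
move=> [c h]; have [|y yi ys] := IH (x - c *: v); first by rewrite !ffunE.
by exists y => //; exists c; rewrite addrAC.
Qed.

Let lspan_sub (Q : set V) s x : submodule Q -> (forall v, v \in s -> Q v) ->
  lspan s x -> Q x.
Proof.
move=> [Q0 QD QZ]; elim: s x => [|v s IH] x h /=; first by move=> ->.
move=> [c /IH Qx]; rewrite -(subrK (c *: v) x); apply: QD.
  by apply: Qx => w ws; apply: h; rewrite inE ws orbT.
by apply: QZ; apply: h; rewrite inE eqxx.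
Qed.

(** A left Noetherian ring has Noetherian finite free modules: coordinates are
    eliminated one at a time, the values of one coordinate forming a left
    ideal. *)
Lemma noetherian_submodule (Q : set V) : left_noetherian S -> submodule Q ->
  exists s : seq V, (forall v, v \in s -> Q v) /\ forall x, Q x -> lspan s x.
Proof.
move=> noeth Qm.
have: forall v, Q v -> forall i, v i != 0 -> i \in enum I.
  by move=> v _ i _; rewrite mem_enum.
elim: (enum I) Q Qm => [|i l IH] Q Qm supp.
  exists [::]; split => // x Qx /=; apply/ffunP => i; rewrite ffunE.
  by apply: contrapT => /eqP /(supp x Qx).
have [Q0 QD QZ] := Qm.
have J_ideal : left_ideal [set y : S | exists2 v, Q v & v i = y].
  split; first by exists 0 => //; rewrite ffunE.
  - by move=> _ _ [v Qv <-] [w Qw <-]; exists (v + w); [exact: QD|rewrite ffunE].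
  - by move=> a _ [v Qv <-]; exists (a *: v); [exact: QZ|rewrite ffunE].
have [s [sJ spanJ]] := noeth _ J_ideal.
have [s' [s'Q s'E]] := lift_seq sJ.
have [||t [tQ spanT]] := IH (Q `&` [set v | v i = 0]).
- split; first by split => //; rewrite /= ffunE.
  + move=> x y [Qx /= xi] [Qy /= yi]; split; first exact: QD.
    by rewrite /= ffunE xi yi addr0.
  + by move=> c x [Qx /= xi]; split; [exact: QZ|rewrite /= ffunE xi scaler0].
- move=> v [Qv /= vi] j vj; have := supp v Qv j vj; rewrite inE.
  by case/predU1P => // ji; move: vj; rewrite ji vi eqxx.
exists (s' ++ t); split.
  by move=> v; rewrite mem_cat => /orP [/s'Q|/tQ []].
move=> x Qx; have [|y yi ys] := @lift_span i s' x.
  by rewrite s'E; apply: spanJ; exists x.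
apply: (lspan_cat ys); apply: spanT; split => //.
rewrite -(subKr x y); apply: QD => //; rewrite -scaleN1r; apply: QZ.
exact: lspan_sub ys.
Qed.

End SubmoduleOfFree.

Section CoherenceCriterion.
Variables (S R : nzRingType) (f : {rmorphism S -> R}).

(** Syzygies over R of elements of a subring B, over which R is flat as the
    decompositions show, come from syzygies over B; as B is finite over the
    Noetherian ring S these are finitely generated. *)
Lemma coherent_of_noetherian_pieces : left_noetherian S ->
  (forall (n : nat) (a : 'I_n -> R), exists B : set R,
     [/\ forall i, B (a i),
         [/\ B 0, forall x y, B x -> B y -> B (x + y),
             forall x y, B x -> B y -> B (x * y) & forall s, B (f s)],
         exists2 e : seq R, forall x, x \in e -> B x &
           forall x, B x -> exists c : 'I_(size e) -> S, x = \sum_i f (c i) * e`_i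
       & forall c : 'I_n -> R, exists (m : nat) (u : 'I_m -> R) (y : 'I_m -> 'I_n -> R),
           [/\ forall j i, B (y j i), forall i, c i = \sum_j u j * y j i
             & forall z : 'I_m -> R, (forall j, B (z j)) ->
                 \sum_j u j * z j = 0 -> forall j, z j = 0]]) ->
  left_coherent R.
Proof.
move=> noeth pieces I [Iid [n [a Ia]]]; split => //.
have [B [Ba [B0 BD BM Bf] [e eB spanB] dec]] := pieces n a.
pose V := {ffun 'I_n * 'I_(size e) -> S^o}.
pose toB (t : V) i := \sum_j f (t (i, j)) * e`_j.
have toB_D t t' i : toB (t + t') i = toB t i + toB t' i.
  by rewrite /toB -big_split; apply: eq_bigr => j _; rewrite ffunE rmorphD mulrDl.
have toB_Z c t i : toB (c *: t) i = f c * toB t i.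
  by rewrite /toB mulr_sumr; apply: eq_bigr => j _; rewrite ffunE rmorphM mulrA.
have toB_0 i : toB 0 i = 0.
  by rewrite /toB big1 // => j _; rewrite ffunE rmorph0 mul0r.
have [|s [sQ spanQ]] :=
    @noetherian_submodule S _ [set t : V | lcomb (toB t) a = 0] noeth.
  split; first by rewrite /= /lcomb big1 // => i _; rewrite toB_0 mul0r.
  - move=> x y /= x0 y0; rewrite -[RHS](addr0 0) -{1}x0 -y0 -big_split.
    by apply: eq_bigr => i _; rewrite toB_D mulrDl.
  - move=> c x /= x0; rewrite -(mulr0 (f c)) -x0 mulr_sumr.
    by apply: eq_bigr => i _; rewrite toB_Z mulrA.
exists n, a, (size s), (fun l => toB s`_l); split => // c; split; last first.
  move=> [d cd]; rewrite /lcomb.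
  under eq_bigr => i _ do rewrite cd mulr_suml.
  rewrite exchange_big big1 // => l _ /=.
  have /= := sQ s`_l (mem_nth 0 (ltn_ord l)) => s0.
  transitivity (d l * lcomb (toB s`_l) a); last by rewrite s0 mulr0.
  by rewrite mulr_sumr; apply: eq_bigr => i _; rewrite mulrA.
move=> c0; have [m [u [y [yB cE udir]]]] := dec c.
have y0 : forall j, lcomb (y j) a = 0.
  apply: udir => [j|].
    by rewrite /lcomb; elim/big_ind: _ => // i _; exact: BM.
  rewrite -[RHS]c0; under eq_bigr => j _ do rewrite mulr_sumr.
  rewrite exchange_big; apply: eq_bigr => i _.
  by rewrite cE mulr_suml; apply: eq_bigr => j _; rewrite mulrA.
have /choice [t tE] : forall j, exists t : V, toB t = y j.
  move=> j; have /choice [t tE] := fun i => spanB _ (yB j i).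
  exists [ffun ij => t ij.1 ij.2]; apply/funext => i.
  by rewrite /toB tE; apply: eq_bigr => l _; rewrite ffunE.
have /choice [d dE] : forall j, exists d : 'I_(size s) -> S, t j = \sum_l d l *: s`_l.
  by move=> j; apply: lspanP; apply: spanQ; rewrite /= tE.
exists (fun l => \sum_j u j * f (d j l)) => i.
rewrite cE /lcomb; under [RHS]eq_bigr => l _ do rewrite mulr_suml.
rewrite exchange_big; apply: eq_bigr => j _ /=.
under eq_bigr => l _ do rewrite -mulrA.
rewrite -mulr_sumr -tE; congr (_ * _); rewrite dE.
rewrite (big_morph (toB^~ i) (fun v w => toB_D v w i) (toB_0 i)).
by apply: eq_bigr => l _; rewrite toB_Z.
Qed.

End CoherenceCriterion.

Section Dickson.

(** Monomials in variables with weights Q, encoded by their own weight; when Q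
    consists of distinct primes, divisibility of weights is divisibility of
    monomials. *)
Fixpoint smooth (Q : seq nat) (m : nat) : Prop :=
  if Q is q :: Q' then exists e m', smooth Q' m' /\ m = (q ^ e * m')%N else m = 1%N.

(** Dickson's lemma, for monomials written as products of powers of the entries
    of Q. *)
Lemma dickson (Q : seq nat) (P : nat -> Prop) :
  exists ms : seq nat, (forall m, m \in ms -> smooth Q m /\ P m) /\
    forall x, smooth Q x -> P x ->
      exists m d, [/\ m \in ms, smooth Q d & x = (d * m)%N].
Proof.
elim: Q P => [|q Q IH] P.
  have [P1|nP1] := pselect (P 1%N).
    exists [:: 1%N]; split; first by move=> m; rewrite inE => /eqP ->.
    by move=> x /= -> _; exists 1%N, 1%N; rewrite inE.
  by exists [::]; split => // x /= ->.
have [s [sP sdiv]] := IH (fun m => exists e, P (q ^ e * m)%N).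
have [E [t [tP tdiv]]] : exists E (t : seq nat), (forall m, m \in t -> smooth (q :: Q) m /\ P m) /\
    forall m', m' \in s -> exists2 e, (e <= E)%N & (q ^ e * m')%N \in t.
  elim: s sP {sdiv} => [|m' s IHs] sP; first by exists 0%N, [::].
  have [|E [t [tP tdiv]]] := IHs; first by move=> m ms; apply: sP; rewrite inE ms orbT.
  have [m'Q [e Pe]] := sP m' (mem_head _ _).
  exists (maxn e E), ((q ^ e * m')%N :: t); split.
    move=> m; rewrite inE => /predU1P [->|/tP //]; split => //.
    by exists e, m'.
  move=> m; rewrite inE => /predU1P [->|/tdiv [e' e'E mt]].
    by exists e; rewrite ?leq_maxl // inE eqxx.
  by exists e'; rewrite ?inE ?mt ?orbT // (leq_trans e'E) ?leq_maxr.
have [w [wP wdiv]] : exists w : seq nat, (forall m, m \in w -> smooth (q :: Q) m /\ P m) /\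
    forall e m', (e < E)%N -> smooth Q m' -> P (q ^ e * m')%N ->
      exists m d, [/\ m \in w, smooth (q :: Q) d & (q ^ e * m')%N = (d * m)%N].
  elim: (E) => [|E' [w [wP wdiv]]]; first by exists [::].
  have [v [vP vdiv]] := IH (fun m => P (q ^ E' * m)%N).
  exists (map (muln (q ^ E')%N) v ++ w); split.
    move=> m; rewrite mem_cat => /orP [/mapP [m' /vP [m'Q Pm'] ->]|/wP //].
    by split => //; exists E', m'.
  move=> e m'; rewrite ltnS leq_eqVlt => /predU1P [->|eE'] m'Q Pm'; last first.
    have [m [d [mw dQ mE]]] := wdiv e m' eE' m'Q Pm'.
    by exists m, d; rewrite mem_cat mw orbT.
  have [m [d [mv dQ ->]]] := vdiv m' m'Q Pm'.
  exists (q ^ E' * m)%N, d; split; last by rewrite mulnCA.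
  - by rewrite mem_cat map_f.
  - by exists 0%N, d; rewrite mul1n.
exists (t ++ w); split; first by move=> m; rewrite mem_cat => /orP [/tP|/wP].
move=> x /= [e [m' [m'Q ->]]] Px.
have [eE|Ee] := ltnP e E.
  have [m [d [mw dQ mE]]] := wdiv e m' eE m'Q Px.
  by exists m, d; rewrite mem_cat mw orbT.
have [m0 [d [m0s dQ m'E]]] := sdiv m' m'Q (ex_intro _ e Px).
have [e' e'E mt] := tdiv m0 m0s.
exists (q ^ e' * m0)%N, (q ^ (e - e') * d)%N; split; first by rewrite mem_cat mt.
  by exists (e - e')%N, d.
by rewrite m'E mulnACA -expnD subnK ?(leq_trans e'E).
Qed.

End Dickson.

(** The filtration is indexed multiplicatively: F a * F b lies in F (a * b). T m
    stands for the monomial of weight m, and F_lead says that F m / F (m + 1) is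
    either zero or a line spanned by T m. *)
Section FilteredRing.
Variables (R : nzRingType) (F : nat -> set R) (T : nat -> R) (Q : seq nat).
Hypothesis Q_gt0 : forall q, q \in Q -> (0 < q)%N.
Hypothesis F1 : forall x, F 1 x.
Hypothesis F0 : forall m, F m 0.
Hypothesis FB : forall m x y, F m x -> F m y -> F m (x - y).
Hypothesis F_anti : forall m n x, (m <= n)%N -> F n x -> F m x.
Hypothesis FM : forall a b x y, F a x -> F b y -> F (a * b) (x * y).
Hypothesis FT : forall m, F m (T m).
Hypothesis TM : forall a b, smooth Q a -> smooth Q b ->
  F (a * b).+1 (T a * T b - T (a * b)).
Hypothesis F_lead : forall m x, (0 < m)%N -> F m x ->
  F m.+1 x \/ smooth Q m /\ exists v v' : R, F m.+1 (v * x - T m) /\ F m.+1 (x - v' * T m).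
Hypothesis F_sep : forall x, (forall m, F m x) -> x = 0.
Hypothesis F_compl : forall y : nat -> R,
  (forall m, exists N, forall n, (N <= n)%N -> F m (y n)) ->
  exists z, forall m, exists N, forall n, (N <= n)%N -> F m (z - \sum_(i < n) y i).

Let smooth_gt0 m : smooth Q m -> (0 < m)%N.
Proof.
elim: Q Q_gt0 m => [|q Q' IH] h m /=; first by move=> ->.
move=> [e [m' [m'Q ->]]]; rewrite muln_gt0 expn_gt0 h ?mem_head //=.
by apply: IH => // q' q'Q; apply: h; rewrite inE q'Q orbT.
Qed.

Let FN m x : F m x -> F m (- x).
Proof. by move=> Fx; rewrite -sub0r; apply: FB. Qed.
Let FD m x y : F m x -> F m y -> F m (x + y).
Proof. by move=> Fx Fy; rewrite -(opprK y); apply: FB => //; exact: FN. Qed.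
Let FMl m a x : F m x -> F m (a * x).
Proof. by move=> Fx; rewrite -[m]mul1n; apply: FM. Qed.
Let FMr m a x : F m x -> F m (x * a).
Proof. by move=> Fx; rewrite -[m]muln1; apply: FM. Qed.
Let F_sum m n (x : 'I_n -> R) : (forall i, F m (x i)) -> F m (\sum_i x i).
Proof. by move=> h; elim/big_ind: _ => // x' y; exact: FD. Qed.

Variable I : set R.
Hypothesis I_ideal : left_ideal I.

Let leading m := exists2 x, I x & F m.+1 (x - T m).

(** As F m / F (m + 1) has rank one, an element of the closure of I is reduced to
    0 by subtracting multiples of finitely many elements of I whose leading
    monomials divide all others; the quotients converge. *)
Lemma filtered_fg : exists n (a : 'I_n -> R), (forall i, I (a i)) /\
  forall x, (forall m, exists2 y, I y & F m (x - y)) -> exists c, x = lcomb c a.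
Proof.
have [I0 ID IM] := I_ideal.
have [ms [msP msdiv]] := dickson Q leading.
have /choice [a aE] : forall j : 'I_(size ms), exists x, I x /\ F (nth 0%N ms j).+1 (x - T (nth 0%N ms j)).
  by move=> j; have [_ [x Ix Fx]] := msP _ (mem_nth 0%N (ltn_ord j)); exists x.
exists (size ms), a; split=> [i|x xI]; first by have [] := aE i.
pose cl := [set x | forall m, exists2 y, I y & F m (x - y)].
have clD u v : cl u -> I v -> cl (u - v).
  move=> clu Iv m; have [y Iy Fy] := clu m; exists (y - v).
    by apply: ID => //; rewrite -mulN1r; exact: IM.
  by rewrite opprB addrA subrK.
have step m u : cl u -> F m.+1 u -> exists c : 'I_(size ms) -> R,
    F m.+2 (u - lcomb c a) /\ forall j : 'I_(size ms), F (m.+1 %/ (nth 0%N ms j))%N (c j).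
  move=> clu Fu; have [Fu'|[sm [v [v' [vF v'F]]]]] := F_lead (ltn0Sn m) Fu.
    exists (fun=> 0); split => //; rewrite /lcomb big1 ?subr0 // => i _.
    by rewrite mul0r.
  have lead_m : leading m.+1.
    have [y Iy Fy] := clu m.+2; exists (v * y); first exact: IM.
    rewrite -(subrK (v * u) (v * y)) -addrA; apply: FD => //.
    by rewrite -mulrBr; apply: FMl; rewrite -opprB; exact: FN.
  have [m' [d [m's dQ mE]]] := msdiv _ sm lead_m.
  have j_lt : (index m' ms < size ms)%N by rewrite index_mem.
  pose j := Ordinal j_lt; have msj : (nth 0%N ms j) = m' by rewrite /= nth_index.
  have m'Q : smooth Q m' by have [] := msP m' m's.
  have m'0 := smooth_gt0 m'Q; have d0 := smooth_gt0 dQ.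
  exists (fun i => if i == j then v' * T d else 0); split; last first.
    move=> i; case: eqP => [->|_]; last exact: F0.
    by rewrite msj mE mulnK //; apply: FMl.
  rewrite /lcomb (bigD1 j) //= eqxx big1 ?addr0 => [|i /negPf ->]; last by rewrite mul0r.
  have [_ Faj] := aE j; rewrite msj in Faj.
  have FTd : F m.+2 (T d * a j - T m.+1).
    rewrite -(subrK (T d * T m') (T d * a j)) -addrA; apply: FD; last first.
      by rewrite mE; exact: TM.
    rewrite -mulrBr; apply: F_anti (FM (FT d) Faj).
    by rewrite mE -addn1 mulnS addnC leq_add.
  rewrite -(subrK (v' * T m.+1) u) -addrA; apply: FD => //.
  rewrite -mulrA -mulrBr; apply: FMl; rewrite -opprB; exact: FN.
have /choice [stepc stepP] : forall mu : nat * R, exists c : 'I_(size ms) -> R,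
    cl mu.2 -> F mu.1.+1 mu.2 ->
    F mu.1.+2 (mu.2 - lcomb c a) /\ forall j : 'I_(size ms), F (mu.1.+1 %/ (nth 0%N ms j))%N (c j).
  move=> [m u]; have [[clu Fu]|nh] := pselect (cl u /\ F m.+1 u).
    by have [c cP] := step m u clu Fu; exists c.
  by exists (fun=> 0) => clu Fu; case: nh.
pose rem := fix rem m := if m is m'.+1 then rem m' - lcomb (stepc (m', rem m')) a else x.
have remP m : cl (rem m) /\ F m.+1 (rem m).
  elim: m => [//|m [clm Fm]] /=.
  have [Fm' _] := stepP (m, rem m) clm Fm; split => //; apply: clD => //.
  by rewrite /lcomb; elim/big_ind: _ => // i _; apply: IM; have [] := aE i.
pose c m := stepc (m, rem m).
have cF m (j : 'I_(size ms)) : F (m.+1 %/ (nth 0%N ms j))%N (c m j).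
  by have [clm Fm] := remP m; have [_] := stepP (m, rem m) clm Fm; apply.
have msj0 (j : 'I_(size ms)) : (0 < (nth 0%N ms j))%N.
  by apply: smooth_gt0; have [] := msP _ (mem_nth 0%N (ltn_ord j)).
have /choice [z zE] : forall j : 'I_(size ms), exists z : R, forall m, exists N : nat, forall n, (N <= n)%N ->
    F m (z - \sum_(i < n) c i j).
  move=> j; apply: (@F_compl (fun n => c n j)) => m; exists (m * (nth 0%N ms j))%N => n mn.
  by apply: F_anti (cF n j); rewrite leq_divRL // (leq_trans mn).
exists z; apply/eqP; rewrite -subr_eq0; apply/eqP; apply: F_sep => m.
have xE n : x = rem n + lcomb (fun j => \sum_(i < n) c i j) a.
  elim: n => [|n IH].
    by rewrite /lcomb big1 ?addr0 // => j _; rewrite big_ord0 mul0r.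
  rewrite {1}IH /= -addrA; congr (_ + _); rewrite addrC.
  apply/eqP; rewrite eq_sym subr_eq eq_sym -big_split; apply/eqP.
  by apply: eq_bigr => j _; rewrite big_ord_recr /= mulrDl.
have [N NP] : exists N : nat, forall j n, (N <= n)%N -> F m (z j - \sum_(i < n) c i j).
  have /choice [N NP] := fun j => zE j m.
  exists (\max_j N j) => j n jn; apply: NP; apply: leq_trans jn.
  exact: leq_bigmax.
rewrite (xE (N + m)%N) -addrA; apply: FD.
  by have [_] := remP (N + m)%N; apply: F_anti; exact: leqW (leq_addl _ _).
rewrite -sumrB; apply: F_sum => j; rewrite -mulrBl; apply: FMr.
by rewrite -opprB; apply: FN; apply: NP; exact: leq_addr.
Qed.

End FilteredRing.

(** * Group rings, quotients and open normal subgroups *)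

Section GroupRingFacts.
Variable (k : comNzRingType).

Definition geval (G : groupType) (V : lmodType k) (w : G -> V) (f : group_ring k G) : V :=
  \sum_(x <- gr_supp f) gr_coef f x *: w x.

Variables (G : groupType) (V : lmodType k).
Implicit Types (w : G -> V) (f g : group_ring k G).

Lemma gr_coefE f x : gr_coef f x = gr_eval (fun y => (y == x)%:R) f.
Proof. by rewrite gr_evalE. Qed.

Lemma gr_coefP f g : (forall x, gr_coef f x = gr_coef g x) -> f = g.
Proof. by move=> fg; apply/fsfunP. Qed.

Lemma gr_coefD f g x : gr_coef (f + g) x = gr_coef f x + gr_coef g x.
Proof. by rewrite !gr_coefE gr_evalD. Qed.
Lemma gr_coefZ c f x : gr_coef (c *: f) x = c * gr_coef f x.
Proof. by rewrite !gr_coefE gr_evalZ. Qed.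
Lemma gr_coefN f x : gr_coef (- f) x = - gr_coef f x.
Proof. by rewrite !gr_coefE gr_evalN. Qed.
Lemma gr_coef0 x : gr_coef (0 : group_ring k G) x = 0.
Proof. by rewrite gr_coefE gr_eval0. Qed.

Lemma geval_supp (A : {fset G}) w f : (gr_supp f `<=` A)%fset ->
  geval w f = \sum_(x <- A) gr_coef f x *: w x.
Proof.
move=> fA; rewrite /geval; apply: big_fset_incl => // x _ xf.
by rewrite /gr_coef (fsfun_dflt xf) scale0r.
Qed.

Lemma geval_single w x : geval w (gr_single k x) = w x.
Proof.
rewrite (@geval_supp [fset x]%fset); last first.
  by apply/fsubsetP => y; rewrite mem_finsupp fsfunE; case: ifP; rewrite ?eqxx.
by rewrite big_seq_fset1 /gr_coef fsfunE inE eqxx scale1r.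
Qed.

Lemma geval_is_linear w : linear (geval w : group_ring k G -> V).
Proof.
move=> c f g.
pose A := (gr_supp (c *: f + g)%R `|` (gr_supp f `|` gr_supp g))%fset.
rewrite !(@geval_supp A); first last.
- exact: fsubsetUl.
- by rewrite (fsubset_trans (fsubsetUl _ (gr_supp g))) // fsubsetUr.
- by rewrite (fsubset_trans (fsubsetUr (gr_supp f) _)) // fsubsetUr.
rewrite scaler_sumr -big_split; apply: eq_bigr => x _.
by rewrite gr_coefD gr_coefZ scalerDl scalerA.
Qed.

HB.instance Definition _ w := GRing.isLinear.Build k (group_ring k G) V _ (geval w)
  (geval_is_linear w).

Lemma gr_decomp f : f = \sum_(x <- gr_supp f) gr_coef f x *: gr_single k x.
Proof.
apply: gr_eval_inj => w.
rewrite (big_morph (gr_eval w) (gr_evalD w) (gr_eval0 w)).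
by apply: eq_bigr => x _; rewrite gr_evalZ gr_eval_single.
Qed.

Lemma geval_eq w w' f : w =1 w' -> geval w f = geval w' f.
Proof. by move=> ww'; apply: eq_bigr => x _; rewrite ww'. Qed.

End GroupRingFacts.

Section QuotientFacts.
Variables (G : groupType) (N : normal_subgroup G).

Lemma lcoset_ofP x y : lcoset_of N x y <-> subgroup_set N (x^-1 * y)%g.
Proof.
split; first by move=> [n Nn <-]; rewrite mulKg.
by move=> Nxy; exists (x^-1 * y)%g => //; rewrite mulVKg.
Qed.

Lemma quo_proj_eqP x y : quo_proj N x = quo_proj N y <-> subgroup_set N (x^-1 * y)%g.
Proof.
split => [/(congr1 val) /= e|Nxy].
  by rewrite -lcoset_ofP e lcoset_ofP mulVg; exact: subgroup1.
apply: val_inj; apply/seteqP; split => z /=; rewrite !lcoset_ofP => h.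
  have -> : (y^-1 * z = (x^-1 * y)^-1 * (x^-1 * z))%g by rewrite invgM invgK mulgA mulgK.
  by apply: subgroupM => //; exact: subgroupV.
have -> : (x^-1 * z = (x^-1 * y) * (y^-1 * z))%g by rewrite mulgA mulgK.
exact: subgroupM.
Qed.

Definition quo_repr (A : quotient_group N) : G := xget 1%g (val A).

Lemma quo_reprK A : quo_proj N (quo_repr A) = A.
Proof.
have [x ->] := quo_projP A; apply/esym/quo_proj_eqP/lcoset_ofP.
by apply: xgetPex; exists x; apply/lcoset_ofP; rewrite mulVg; exact: subgroup1.
Qed.

Lemma quo_repr_proj x : subgroup_set N ((quo_repr (quo_proj N x))^-1 * x)%g.
Proof. by apply/quo_proj_eqP; rewrite quo_reprK. Qed.

Lemma normalJ x g : subgroup_set N x -> subgroup_set N (g^-1 * x * g)%g.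
Proof. by move=> Nx; rewrite -{2}(invgK g); exact: Defs.normalP. Qed.

End QuotientFacts.

Section OpenNormal.
Variable H : topGroupType.

Let capsub (A B : subgroup H) : subgroup H.
Proof.
apply: (@Subgroup H ((A : set H) `&` (B : set H))).
- by split; exact: subgroup1.
- by move=> x y [? ?] [? ?]; split; exact: subgroupM.
- by move=> x [? ?]; split; exact: subgroupV.
Defined.

Let capnormal (A B : normal_subgroup H) : normal_subgroup H.
Proof.
apply: (@NormalSubgroup H (capsub A B)).
by move=> g x [? ?]; split; exact: Defs.normalP.
Defined.

Lemma open_normal_open (N : open_normal H) : open (N : set H).
Proof. by case: N. Qed.

Definition capN (A B : open_normal H) : open_normal H :=
  @OpenNormal H (capnormal A B)
    (openI (open_normal_open A) (open_normal_open B)).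

Lemma capN_subl (A B : open_normal H) : (capN A B : set H) `<=` A.
Proof. by move=> x []. Qed.
Lemma capN_subr (A B : open_normal H) : (capN A B : set H) `<=` B.
Proof. by move=> x []. Qed.

Lemma capN_family (T : eqType) (s : seq T) (A : T -> open_normal H) :
  exists N : open_normal H, forall x, x \in s -> (N : set H) `<=` A x.
Proof.
elim: s => [|x s [N IH]]; first by exists (whole_open_normal H).
exists (capN (A x) N) => y; rewrite inE => /predU1P [->|/IH h]; first exact: capN_subl.
exact: subset_trans (@capN_subr _ _) h.
Qed.

(** Closedness for the topology defined by the open normal subgroups. *)
Definition closed_sub (D : set H) : Prop :=
  [/\ D 1%g, forall x y, D x -> D y -> D (x * y)%g, forall x, D x -> D x^-1%g
    & forall x, (forall N : open_normal H, exists2 h, D h & (N : set H) (h^-1 * x)%g) -> D x].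

(** The complement of D is covered by finitely many translates of D by elements
    that are at a positive distance from D. *)
Lemma closed_finite_index_open (D : set H) (s : seq H) : closed_sub D ->
  (forall x, exists2 y, y \in s & D (y^-1 * x)%g) ->
  exists N : open_normal H, (N : set H) `<=` D.
Proof.
move=> [D1 DM DV Dcl] cover.
have /choice [A AP] : forall y, exists N : open_normal H, ~ D y ->
    forall h, D h -> ~ (N : set H) (h^-1 * y)%g.
  move=> y; have [Dy|nDy] := pselect (D y); first by exists (whole_open_normal H).
  apply: contrapT => /forallNP h; apply: nDy; apply: Dcl => N.
  apply: contrapT => nex; apply: (h N) => _ z Dz Nz; apply: nex; by exists z.
have [N NA] := capN_family s A; exists N => x Nx.
have [y ys Dyx] := cover x.
have [Dy|nDy] := pselect (D y); first by rewrite -(mulVKg y x); apply: DM.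
have := AP y nDy (x^-1 * y)%g; rewrite invgM invgK -mulgA => /(_ _)[].
  by rewrite -(invgK (_ * _)%g) invgM invgK; exact: DV.
by apply: (NA y ys); rewrite mulgA; exact: normalJ.
Qed.

End OpenNormal.

(** * The topology of the completed group ring *)

Definition divides (k : comNzRingType) (a x : k) : Prop := exists y, x = a * y.

(** The properties of the coefficients on which the proof rests: the maximal ideal
    is generated by p, possibly zero, and k is separated and complete for the
    p-adic topology. *)
Record padic_coef (k : comNzRingType) (p : nat) : Prop := PadicCoef {
  coef_local : forall c : k, (exists c', c' * c = 1) \/ divides p%:R c;
  coef_separated : forall c : k, (forall m, divides (p%:R ^+ m) c) -> c = 0;
  coef_complete : forall u : nat -> k,
    (forall m, exists n, forall i j, (n <= i)%N -> (n <= j)%N ->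
      divides (p%:R ^+ m) (u i - u j)) ->
    exists l, forall m, exists n, forall i, (n <= i)%N -> divides (p%:R ^+ m) (u i - l)
}.

Definition finite_quotients (H : topGroupType) : Prop :=
  forall N : open_normal H, exists s : seq H,
    forall x, exists2 y, y \in s & (N : set H) (y^-1 * x)%g.

Section CompletedRing.
Variables (k : comNzRingType) (p : nat) (H : topGroupType).
Notation R := (completed_group_ring k H).
Implicit Types (N : open_normal H) (x y z : R) (g h : H).

Definition single g : R := gr_completion (gr_single k g).

Lemma cgr_valD x y N : val (x + y) N = val x N + val y N. Proof. by []. Qed.
Lemma cgr_valN x N : val (- x) N = - val x N. Proof. by []. Qed.
Lemma cgr_valM x y N : val (x * y) N = val x N * val y N. Proof. by []. Qed.
Lemma cgr_valZ c x N : val (c *: x) N = c *: val x N. Proof. by []. Qed.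
Lemma cgr_val0 N : val (0 : R) N = 0. Proof. by []. Qed.
Lemma cgr_val_sum N (I : Type) (s : seq I) (F : I -> R) :
  val (\sum_(i <- s) F i) N = \sum_(i <- s) val (F i) N.
Proof. exact: (big_morph (fun x : R => val x N) (fun x y => cgr_valD x y N) (cgr_val0 N)). Qed.
Lemma cgr_val_nat n N : val (n%:R : R) N = n%:R.
Proof. by elim: n => [//|n IH]; rewrite -addn1 !natrD cgr_valD IH. Qed.

Lemma gr_map_single (G1 G2 : groupType) (phi : G1 -> G2) (x : G1) :
  gr_map phi (gr_single k x) = gr_single k (phi x).
Proof. by apply: gr_eval_inj => w; rewrite gr_eval_map !gr_eval_single. Qed.

Lemma gr_singleM (G : groupType) (x y : G) :
  gr_single k (x * y)%g = gr_single k x * gr_single k y.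
Proof. by apply: gr_eval_inj => w; rewrite gr_evalM !gr_eval_single. Qed.

Lemma cgr_val_single g N : val (single g) N = gr_single k (quo_proj N g).
Proof. exact: gr_map_single. Qed.

Lemma singleM g h : single (g * h)%g = single g * single h.
Proof. by apply: cgr_eq => N; rewrite cgr_valM !cgr_val_single quo_projMg gr_singleM. Qed.
Lemma single1 : single 1%g = 1.
Proof. by apply: cgr_eq => N; rewrite cgr_val_single quo_proj1. Qed.
Lemma singleV g : single g^-1%g * single g = 1.
Proof. by rewrite -singleM mulVg single1. Qed.

Lemma singleX g n : single (g ^+ n)%g = single g ^+ n.
Proof. by elim: n => [|n IH]; rewrite ?expg0 ?single1 // expgS exprS singleM IH. Qed.

Lemma cgr_val_mono x N N' : (N : set H) `<=` N' -> gr_map (quo_map N N') (val x N) = val x N'.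
Proof. by move=> NN'; have /asboolP := valP x; apply. Qed.

(** A basis of neighbourhoods of 0, made of two-sided ideals. *)
Definition nbhd N m : set R :=
  [set x : R | exists y : group_ring k (quotient_group N), val x N = p%:R ^+ m *: y].

Lemma nbhd0 N m : nbhd N m 0. Proof. by exists 0; rewrite scaler0. Qed.
Lemma nbhdB N m x y : nbhd N m x -> nbhd N m y -> nbhd N m (x - y).
Proof.
by move=> [x' xE] [y' yE]; exists (x' - y'); rewrite cgr_valD cgr_valN xE yE -scalerBr.
Qed.
Lemma nbhdMl N m a x : nbhd N m x -> nbhd N m (a * x).
Proof. by move=> [x' xE]; exists (val a N * x'); rewrite cgr_valM xE scalerAr. Qed.
Lemma nbhdMr N m a x : nbhd N m x -> nbhd N m (x * a).
Proof. by move=> [x' xE]; exists (x' * val a N); rewrite cgr_valM xE scalerAl. Qed.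
Lemma nbhdZ N m c x : nbhd N m x -> nbhd N m (c *: x).
Proof. by move=> [x' xE]; exists (c *: x'); rewrite cgr_valZ xE !scalerA mulrC. Qed.
Lemma nbhdN N m x : nbhd N m x -> nbhd N m (- x).
Proof. by move=> Vx; rewrite -sub0r; apply: nbhdB => //; exact: nbhd0. Qed.
Lemma nbhdD N m x y : nbhd N m x -> nbhd N m y -> nbhd N m (x + y).
Proof. by move=> Vx Vy; rewrite -(opprK y); apply: nbhdB => //; exact: nbhdN. Qed.

Lemma nbhd_eq N m x y : val x N = val y N -> nbhd N m (x - y).
Proof. by move=> xy; exists 0; rewrite scaler0 cgr_valD cgr_valN xy subrr. Qed.

(** The image of k[H] is dense. *)
Lemma approx x N : exists s : seq (k * H),
  val x N = val (\sum_(ch <- s) ch.1 *: single ch.2) N.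
Proof.
exists [seq (gr_coef (val x N) A, quo_repr A) | A <- gr_supp (val x N)].
rewrite big_map cgr_val_sum [LHS]gr_decomp; apply: eq_bigr => A _.
by rewrite cgr_valZ cgr_val_single quo_reprK.
Qed.

(** A linear section, through representatives of the cosets. *)
Definition lift_level N (f : group_ring k (quotient_group N)) : R :=
  geval (fun A => single (quo_repr A)) f.

Lemma nbhd_div N m x A : nbhd N m x -> divides (p%:R ^+ m) (gr_coef (val x N) A).
Proof. by move=> [y ->]; exists (gr_coef y A); rewrite gr_coefZ. Qed.

Hypothesis k_coef : padic_coef k p.
Hypothesis H_fin : finite_quotients H.

Lemma nbhd_separated x : (forall N m, nbhd N m x) -> x = 0.
Proof.
move=> Vx; apply: cgr_eq => N; apply: gr_coefP => A; rewrite gr_coef0.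
by apply: (coef_separated k_coef) => m; exact: nbhd_div.
Qed.

Lemma divD a (c d : k) : divides a c -> divides a d -> divides a (c + d).
Proof. by move=> [c' ->] [d' ->]; exists (c' + d'); rewrite mulrDr. Qed.
Lemma divN a (c : k) : divides a c -> divides a (- c).
Proof. by move=> [c' ->]; exists (- c'); rewrite mulrN. Qed.

(** Coefficients converge one by one; a level has finitely many of them. *)
Lemma nbhd_complete (y : nat -> R) :
  (forall N m, exists n0, forall n, (n0 <= n)%N -> nbhd N m (y n)) ->
  exists z, forall N m, exists n0, forall n, (n0 <= n)%N ->
    nbhd N m (z - \sum_(i < n) y i).
Proof.
move=> y0; pose s n := \sum_(i < n) y i.
have cauchy N m : exists n0, forall i j, (n0 <= i)%N -> (n0 <= j)%N ->
    nbhd N m (s i - s j).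
  have [n0 n0P] := y0 N m; exists n0.
  have base i : (n0 <= i)%N -> nbhd N m (s i - s n0).
    move=> /subnK <-; elim: (i - n0)%N => [|d IH]; first by rewrite subrr; exact: nbhd0.
    rewrite /s addSn big_ord_recr /= addrAC; apply: nbhdD => //.
    by apply: n0P; exact: leq_addl.
  move=> i j n0i n0j; rewrite -(subrK (s n0) (s i)) -addrA.
  by apply: nbhdD; [exact: base | rewrite -opprB; apply: nbhdN; exact: base].
have lim : forall NA : {N : open_normal H & quotient_group N},
    exists l : k, forall m, exists n0, forall i, (n0 <= i)%N ->
      divides (p%:R ^+ m) (gr_coef (val (s i) (projT1 NA)) (projT2 NA) - l).
  move=> [N A] /=; apply: (coef_complete k_coef) => m.
  have [n0 n0P] := cauchy N m; exists n0 => i j n0i n0j.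
  by rewrite -gr_coefN -gr_coefD -cgr_valN -cgr_valD; apply: nbhd_div; exact: n0P.
have [l lP] := choice lim.
have level : forall N, exists u : group_ring k (quotient_group N),
    forall A, gr_coef u A = l (existT _ N A).
  move=> N; have [t tP] := H_fin N.
  exists [fsfun A in [fset quo_proj N x | x in t]%fset => l (existT _ N A)] => A.
  rewrite /gr_coef fsfunE; case: ifP => // /negP; case.
  have [x xt Nx] := tP (quo_repr A).
  by apply/imfsetP; exists x => //=; rewrite -[LHS]quo_reprK; apply/esym/quo_proj_eqP.
pose u N := projT1 (cid (level N)); have uP N A : gr_coef (u N) A = l (existT _ N A).
  exact: (projT2 (cid (level N))).
have close N m : exists n0, forall i, (n0 <= i)%N -> exists f, u N - val (s i) N = p%:R ^+ m *: f.
  have [n0 n0P] := cauchy N m; exists n0 => i n0i.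
  have /choice [d dE] : forall A, divides (p%:R ^+ m) (gr_coef (u N - val (s i) N) A).
    move=> A; rewrite gr_coefD gr_coefN uP.
    have [n1 n1P] := lP (existT _ N A) m.
    pose j := maxn n0 n1.
    rewrite -(subrK (gr_coef (val (s j) N) A) (l _)) -addrA; apply: divD.
      by rewrite -opprB; apply: divN; apply: n1P; exact: leq_maxr.
    rewrite -gr_coefN -gr_coefD -cgr_valN -cgr_valD; apply: nbhd_div; apply: n0P => //.
    exact: leq_maxl.
  exists (\sum_(A <- gr_supp (u N - val (s i) N)) d A *: gr_single k A).
  by rewrite [LHS]gr_decomp scaler_sumr; apply: eq_bigr => A _; rewrite scalerA dE.
have uc : cgr_compat u.
  apply/asboolP => N N' NN'; apply/eqP; rewrite -subr_eq0; apply/eqP.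
  apply: gr_coefP => A; rewrite gr_coef0; apply: (coef_separated k_coef) => m.
  have [n0 n0P] := close N m; have [n1 n1P] := close N' m.
  have [f fE] := n0P _ (leq_maxl n0 n1); have [f' f'E] := n1P _ (leq_maxr n0 n1).
  set i := maxn n0 n1 in fE f'E.
  exists (gr_coef (gr_map (quo_map N N') f - f') A).
  rewrite -gr_coefZ; congr (gr_coef _ A); rewrite scalerBr -gr_mapZ -fE -f'E.
  by rewrite gr_mapD gr_mapN cgr_val_mono // opprB addrA subrK.
exists (exist _ u uc) => N m; have [n0 n0P] := close N m; exists n0 => i n0i.
exact: n0P.
Qed.

End CompletedRing.

(** * Central chains of generators *)

(** Each generator is central modulo the closed subgroup generated by the later
    ones. Quantifying over closed subgroups D avoids forming the latter. *)
Record central_chain (H : topGroupType) (r : nat) (g : nat -> H) : Prop := CentralChain {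
  chain_comm : forall l h (D : set H), (l < r)%N -> closed_sub D ->
    (forall j, (l < j)%N -> (j < r)%N -> D (g j)) -> D ((g l)^-1 * h^-1 * g l * h)%g;
  chain_gen : forall D : set H, closed_sub D ->
    (forall j, (j < r)%N -> D (g j)) -> forall h, D h
}.

Definition pro_p (H : topGroupType) (p : nat) : Prop :=
  forall (N : open_normal H) x, exists m, (N : set H) (x ^+ (p ^ m))%g.

Section FiniteIndex.
Variables (H : topGroupType) (r : nat) (g : nat -> H).
Hypothesis g_chain : central_chain r g.

Let normal_in (D : set H) := forall h x, D x -> D (h^-1 * x * h)%g.

(* Adjoins to D an element y that is central of finite order modulo D. *)
Let step (D : set H) (y : H) (P : nat) : closed_sub D -> normal_in D -> (0 < P)%N ->
  D (y ^+ P)%g -> (forall h, D (y^-1 * h^-1 * y * h)%g) ->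
  let C := [set x | exists b, D ((y ^+ b)^-1 * x)%g] in
  [/\ closed_sub C, normal_in C & forall x, C x -> exists2 b, (b < P)%N & D ((y ^+ b)^-1 * x)%g].
Proof.
move=> [D1 DM DV Dcl] Dn P0 DP Dc C.
have DPb b : D (y ^+ (P * b))%g.
  by elim: b => [|b IH]; rewrite ?muln0 ?expg0 // mulnS expgnDr; exact: DM.
have red x : C x -> exists2 b, (b < P)%N & D ((y ^+ b)^-1 * x)%g.
  move=> [b Db]; exists (b %% P)%N; first exact: ltn_pmod.
  have -> : ((y ^+ (b %% P))^-1 * x = y ^+ (P * (b %/ P)) * ((y ^+ b)^-1 * x))%g.
    by rewrite {3}(divn_eq b P) mulnC addnC expgnDr invgM !mulgA mulgV mul1g.
  exact: DM.
have yJ b h : D ((y ^+ b)^-1 * h * y ^+ b * h^-1)%g.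
  elim: b => [|b IH]; first by rewrite expg0 invg1 mul1g mulg1 mulgV.
  have -> : ((y ^+ b.+1)^-1 * h * y ^+ b.+1 * h^-1 =
     (y ^+ b)^-1 * (y^-1 * (h^-1)^-1 * y * h^-1) * y ^+ b *
     ((y ^+ b)^-1 * h * y ^+ b * h^-1))%g.
    by rewrite expgS invgM invgK !mulgA mulgK mulgVK.
  by apply: DM => //; apply: Dn; exact: Dc.
split => //; last first.
  move=> h x [b Db]; exists b.
  have -> : ((y ^+ b)^-1 * (h^-1 * x * h) =
     ((y ^+ b)^-1 * h^-1 * y ^+ b * (h^-1)^-1) * (h^-1 * ((y ^+ b)^-1 * x) * h))%g.
    by rewrite invgK !mulgA mulgK mulgK.
  by apply: DM => //; exact: Dn.
split.
- by exists 0%N; rewrite expg0 invg1 mul1g.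
- move=> x x' [b Db] [b' Db']; exists (b + b')%N.
  have -> : ((y ^+ (b + b'))^-1 * (x * x') =
     ((y ^+ b')^-1 * ((y ^+ b)^-1 * x) * y ^+ b') * ((y ^+ b')^-1 * x'))%g.
    by rewrite expgnDr invgM !mulgA mulgK.
  by apply: DM => //; exact: Dn.
- move=> x /red [b bP Db]; exists (P - b)%N.
  have -> : ((y ^+ (P - b))^-1 * x^-1 =
     (y ^+ P)^-1 * (((y ^+ b)^-1)^-1 * ((y ^+ b)^-1 * x)^-1 * (y ^+ b)^-1))%g.
    have -> : (y ^+ P = y ^+ b * y ^+ (P - b))%g by rewrite -expgnDr subnKC // ltnW.
    by rewrite !invgM !invgK !mulgA mulgVK mulgK.
  by apply: DM; [exact: DV | apply: Dn; exact: DV].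
- move=> x Cx; apply: contrapT => nCx.
  have /choice [A AP] : forall b, exists N : open_normal H,
      forall h, D h -> ~ (N : set H) (h^-1 * ((y ^+ b)^-1 * x))%g.
    move=> b; apply: contrapT => /forallNP nA; apply: nCx; exists b.
    apply: Dcl => N; apply: contrapT => nex; apply: (nA N) => h Dh Nh.
    by apply: nex; exists h.
  have [N NA] := capN_family (iota 0 P) A.
  have [z /red [b bP Db] Nz] := Cx N.
  apply: (AP b _ Db); apply: NA; first by rewrite mem_iota.
  by rewrite invgM invgK !mulgA mulgK.
Qed.

(** A closed normal subgroup containing powers of all the generators has finite
    index, since the quotient is an iterated central extension of finite cyclic groups. *)
Lemma chain_open (D : set H) : closed_sub D -> normal_in D ->
  (forall j, (j < r)%N -> exists2 P, (0 < P)%N & D (g j ^+ P)%g) ->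
  exists N : open_normal H, (N : set H) `<=` D.
Proof.
move=> Dcl Dn Dpow.
have key d : (d <= r)%N -> exists (E : set H) (s : seq H), [/\ closed_sub E, normal_in E,
    D `<=` E, (forall j, (r - d <= j)%N -> (j < r)%N -> E (g j))
    & forall x, E x -> exists2 y, y \in s & D (y^-1 * x)%g].
  elim: d => [|d IH] dr.
    exists D, [:: 1%g]; split => //.
      by move=> j; rewrite subn0 => rj; rewrite ltnNge rj.
    by move=> x Dx; exists 1%g; rewrite ?mem_head // invg1 mul1g.
  have [E [s [Ecl En DE Eg Es]]] := IH (ltnW dr).
  pose l := (r - d.+1)%N; have lr : (l < r)%N by rewrite ltn_subrL (leq_trans _ dr).
  have lS : (r - d)%N = l.+1 by rewrite subnSK.
  have [P P0 DP] := Dpow l lr.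
  have Ec h : E ((g l)^-1 * h^-1 * g l * h)%g.
    by apply: (chain_comm g_chain) => // j lj jr; apply: Eg; rewrite // lS.
  have [Ccl Cn Cred] := step Ecl En P0 (DE _ DP) Ec.
  exists [set x | exists b, E ((g l ^+ b)^-1 * x)%g],
    [seq (g l ^+ b * y)%g | b <- iota 0 P, y <- s]; split => //.
  - by move=> x Dx; exists 0%N; rewrite expg0 invg1 mul1g; exact: DE.
  - move=> j; rewrite -/l leq_eqVlt => /predU1P [<- _|lj jr]; last first.
      by exists 0%N; rewrite expg0 invg1 mul1g; apply: Eg; rewrite // lS.
    by exists 1%N; rewrite expg1 mulVg; case: Ecl.
  - move=> x /Cred [b bP /Es [y ys Dy]]; exists (g l ^+ b * y)%g.
      by apply/allpairsP; exists (b, y); rewrite mem_iota.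
    by rewrite invgM -mulgA.
have [E [s [Ecl _ _ Eg Es]]] := key r (leqnn r).
have Eall : forall h, E h.
  by apply: (chain_gen g_chain) => // j jr; apply: Eg; rewrite // subnn.
by apply: (closed_finite_index_open (s := s)) => // x; exact: Es.
Qed.

End FiniteIndex.

(** * The weight filtration *)

(** Primes, so that a weight determines its monomial; each beyond the square of
    the previous one, so that a commutator of two letters, which involves only
    later letters, weighs more than their product. *)
Fixpoint sparse_prime (l : nat) : nat :=
  if l is l'.+1 then s2val (prime_above (sparse_prime l' ^ 2)) else 2.

Lemma sparse_prime_prime l : prime (sparse_prime l).
Proof. by case: l => [|l] //=; case: prime_above. Qed.

Lemma sparse_prime_sqr l : (sparse_prime l ^ 2 < sparse_prime l.+1)%N.
Proof. by rewrite /=; case: prime_above. Qed.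

Lemma sparse_prime_gt0 l : (0 < sparse_prime l)%N.
Proof. exact: prime_gt0 (sparse_prime_prime l). Qed.

Lemma sparse_prime_mono i j : (i <= j)%N -> (sparse_prime i <= sparse_prime j)%N.
Proof.
move=> /subnK <-; elim: (j - i)%N => [//|d IH]; apply: leq_trans IH _.
rewrite addSn; apply: leq_trans (ltnW (sparse_prime_sqr _)).
by rewrite -{1}(expn1 (sparse_prime _)) leq_pexp2l // sparse_prime_gt0.
Qed.

Lemma sparse_prime_inj : injective sparse_prime.
Proof.
have lt i j : (i < j)%N -> (sparse_prime i < sparse_prime j)%N.
  move=> /sparse_prime_mono; apply: leq_trans; apply: leq_trans (sparse_prime_sqr i).
  by rewrite ltnS -{1}(expn1 (sparse_prime _)) leq_pexp2l // sparse_prime_gt0.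
by move=> i j e; case: (ltngtP i j) => // /lt; rewrite e ltnn.
Qed.

Section Filtration.
Variables (k : comNzRingType) (p : nat) (H : topGroupType) (r : nat) (g : nat -> H).
Hypothesis p_pr : prime p.
Hypothesis k_coef : padic_coef k p.
Hypothesis H_fin : finite_quotients H.
Hypothesis H_prop : pro_p H p.
Hypothesis g_chain : central_chain r g.
Notation R := (completed_group_ring k H).
Notation single := (single k).
Notation nbhd := (@nbhd k p H).
Let L := 'I_r.+1.
Implicit Types (N : open_normal H) (x y : R) (h : H) (w : seq L).

(** p is one more variable, of least weight. *)
Definition letter (i : L) : R :=
  if (i : nat) is j.+1 then single (g j) - 1 else p%:R.
Definition wt w : nat := \prod_(i <- w) sparse_prime i.
Definition word w : R := \prod_(i <- w) letter i.

Lemma wt_cat w w' : wt (w ++ w') = (wt w * wt w')%N.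
Proof. by rewrite /wt big_cat. Qed.
Lemma word_cat w w' : word (w ++ w') = word w * word w'.
Proof. by rewrite /word big_cat. Qed.
Lemma wt_gt0 w : (0 < wt w)%N.
Proof. by rewrite /wt; elim/big_ind: _ => [//|a b a0 b0|i _]; rewrite ?muln_gt0 ?a0 ?sparse_prime_gt0. Qed.

Inductive words (n : nat) : R -> Prop :=
| words0 : words n 0
| words_add c w x : (n <= wt w)%N -> words n x -> words n (c *: word w + x).

Lemma words_word n w : (n <= wt w)%N -> words n (word w).
Proof.
move=> nw; have := words_add 1 nw (words0 n).
by rewrite scale1r addr0.
Qed.
Lemma wordsD n x y : words n x -> words n y -> words n (x + y).
Proof.
move=> wx wy; elim: wx => [|c w x' nw _ IH]; first by rewrite add0r.
by rewrite -addrA; exact: words_add.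
Qed.
Lemma wordsZ n c x : words n x -> words n (c *: x).
Proof.
elim=> [|c' w x' nw _ IH]; first by rewrite scaler0; exact: words0.
by rewrite scalerDr scalerA; exact: words_add.
Qed.
Lemma wordsM a b x y : words a x -> words b y -> words (a * b) (x * y).
Proof.
move=> wx wy; elim: wx => [|c w x' aw _ IH]; first by rewrite mul0r; exact: words0.
rewrite mulrDl; apply: wordsD => //.
elim: wy => [|c' w' y' bw' _ IH']; first by rewrite mulr0; exact: words0.
rewrite mulrDr -scalerAr -scalerAl scalerA -word_cat.
by apply: words_add => //; rewrite wt_cat leq_mul.
Qed.

(** The closure of words n. *)
Definition filt (n : nat) : set R :=
  [set x | forall N m, exists2 y, words n y & nbhd N m (x - y)].

Lemma filt_words n x : words n x -> filt n x.
Proof. by move=> wx N m; exists x => //; rewrite subrr; exact: nbhd0. Qed.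
Lemma filt0 n : filt n 0. Proof. by apply: filt_words; exact: words0. Qed.
Lemma filtD n x y : filt n x -> filt n y -> filt n (x + y).
Proof.
move=> Fx Fy N m; have [x' wx Vx] := Fx N m; have [y' wy Vy] := Fy N m.
by exists (x' + y'); [exact: wordsD | rewrite opprD addrACA; exact: nbhdD].
Qed.
Lemma filtZ n c x : filt n x -> filt n (c *: x).
Proof.
move=> Fx N m; have [x' wx Vx] := Fx N m.
by exists (c *: x'); [exact: wordsZ | rewrite -scalerBr; exact: nbhdZ].
Qed.
Lemma filtN n x : filt n x -> filt n (- x).
Proof. by rewrite -scaleN1r; exact: filtZ. Qed.
Lemma filtB n x y : filt n x -> filt n y -> filt n (x - y).
Proof. by move=> Fx Fy; apply: filtD => //; exact: filtN. Qed.
Lemma filt_anti m n x : (m <= n)%N -> filt n x -> filt m x.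
Proof.
move=> mn Fx N l; have [y wy Vy] := Fx N l; exists y => //.
elim: wy => [|c w z nw _ IH]; first exact: words0.
by apply: words_add => //; exact: leq_trans nw.
Qed.
Lemma filt_closed n x : (forall N m, exists2 y, filt n y & nbhd N m (x - y)) -> filt n x.
Proof.
move=> h N m; have [y Fy Vy] := h N m; have [z wz Vz] := Fy N m.
by exists z => //; rewrite -(subrK y x) -addrA; exact: nbhdD.
Qed.
Lemma filtM a b x y : filt a x -> filt b y -> filt (a * b) (x * y).
Proof.
move=> Fx Fy N m; have [x' wx Vx] := Fx N m; have [y' wy Vy] := Fy N m.
exists (x' * y'); first exact: wordsM.
rewrite -(subrK (x' * y) (x * y)) -addrA -mulrBl -mulrBr; apply: nbhdD.
  exact: nbhdMr.
exact: nbhdMl.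
Qed.

Lemma filt_letter (i : L) : filt (sparse_prime i) (letter i).
Proof.
apply: filt_words; have := @words_word (sparse_prime i) [:: i].
by rewrite /wt /word !big_seq1; apply.
Qed.

Lemma filt_word w : filt (wt w) (word w).
Proof. exact/filt_words/words_word. Qed.

Lemma single_val_eq h h' N : (N : set H) (h^-1 * h')%g -> val (single h) N = val (single h') N.
Proof. by move=> Nh; rewrite !cgr_val_single; congr gr_single; apply/quo_proj_eqP. Qed.

Lemma letterS j (jr : (j < r)%N) : letter (Ordinal (jr : (j.+1 < r.+1)%N)) = single (g j) - 1.
Proof. by []. Qed.

Lemma filt1_one : filt 1 1.
Proof. by have := filt_word [::]; rewrite /wt /word !big_nil. Qed.

(** filt 1 is a closed subring that contains the generators of H, and their
    inverses, which are limits of powers because H is pro-p. *)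
Lemma filt1 x : filt 1 x.
Proof.
have single_gen j : (j < r)%N -> filt 1 (single (g j)).
  move=> jr; rewrite -(subrK 1 (single (g j))); apply: filtD; last exact: filt1_one.
  by rewrite -(letterS jr); apply: filt_anti (filt_letter _); rewrite sparse_prime_gt0.
have filt1X y n : filt 1 y -> filt 1 (y ^+ n).
  move=> Fy; elim: n => [|n IH]; first by rewrite expr0; exact: filt1_one.
  by rewrite exprS -[1%N]muln1; exact: filtM.
have all_single h : filt 1 (single h) /\ filt 1 (single h^-1%g).
  move: h; apply: (chain_gen g_chain).
    split=> [|h h' [F F'] [G G']|h [F F']|h hcl].
    - by rewrite invg1 single1; split; exact: filt1_one.
    - by rewrite invgM !singleM; split; rewrite -[1%N]muln1; exact: filtM.
    - by rewrite invgK.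
    - split; apply: filt_closed => N m.
        have [h' [F _] Nh] := hcl N; exists (single h') => //.
        by apply: nbhd_eq; apply/esym/single_val_eq.
      have [h' [_ F] Nh] := hcl N; exists (single h'^-1%g) => //.
      apply: nbhd_eq; apply/esym/single_val_eq.
      have -> : ((h'^-1)^-1 * h^-1 = h * (h'^-1 * h)^-1 * h^-1)%g.
        by rewrite invgM !invgK mulgA mulgV mul1g.
      by apply: Defs.normalP; exact: subgroupV.
  move=> j jr; split; first exact: single_gen.
  apply: filt_closed => N m; have [e Ne] := H_prop N (g j).
  exists (single (g j) ^+ (p ^ e).-1); first exact/filt1X/single_gen.
  apply: nbhd_eq; apply/esym; rewrite -singleX; apply: single_val_eq.
  rewrite -invgM; apply: subgroupV; rewrite -expgS prednK //.
  by rewrite expn_gt0 prime_gt0.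
apply: filt_closed => N m; have [s sE] := approx x N.
exists (\sum_(ch <- s) ch.1 *: single ch.2); last exact: nbhd_eq.
elim/big_ind: _ => [|y z|ch _]; [exact: filt0 | exact: filtD|].
by apply: filtZ; have [] := all_single ch.2.
Qed.

Lemma filtMl n a x : filt n x -> filt n (a * x).
Proof. by move=> Fx; rewrite -[n]mul1n; apply: filtM => //; exact: filt1. Qed.
Lemma filtMr n a x : filt n x -> filt n (x * a).
Proof. by move=> Fx; rewrite -[n]muln1; apply: filtM => //; exact: filt1. Qed.

(** The dimension subgroups of the filtration. *)
Definition dim_sub n : set H := [set h | filt n (single h - 1)].

Lemma dim_sub_closed n : closed_sub (dim_sub n).
Proof.
split.
- by rewrite /dim_sub /= single1 subrr; exact: filt0.
- move=> h h' Fh Fh'; rewrite /dim_sub /= singleM.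
  rewrite -(subrK (single h) (_ * _)) -addrA; apply: filtD => //.
  by rewrite -{2}(mulr1 (single h)) -mulrBr; exact: filtMl.
- move=> h Fh; rewrite /dim_sub /=.
  have -> : single h^-1%g - 1 = - (single h^-1%g * (single h - 1)).
    by rewrite mulrBr singleV mulr1 opprB.
  by apply: filtN; exact: filtMl.
- move=> h hcl; apply: filt_closed => N m; have [h' Fh' Nh] := hcl N.
  exists (single h' - 1) => //; rewrite opprB addrA subrK; apply: nbhd_eq.
  exact/esym/single_val_eq.
Qed.

Lemma dim_sub_normal n h (x : H) : dim_sub n x -> dim_sub n (h^-1 * x * h)%g.
Proof.
rewrite /dim_sub /= => Fx.
have -> : single (h^-1 * x * h)%g - 1 = single h^-1%g * (single x - 1) * single h.
  by rewrite !singleM mulrBr mulrBl mulr1 singleV.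
by apply: filtMr; exact: filtMl.
Qed.

Lemma filt_p n x : filt n x -> filt (2 * n) (p%:R * x).
Proof.
have -> : p%:R = letter ord0 :> R by [].
by move=> Fx; apply: filtM => //; exact: (filt_letter ord0).
Qed.

Lemma exprD1_prime (A : nzRingType) (y : A) : exists z, (y + 1) ^+ p = y ^+ p + 1 + p%:R * (z * y).
Proof.
exists (\sum_(i < p.-1) ('C(p, i.+1) %/ p)%:R * y ^+ i).
have p0 := prime_gt0 p_pr.
have pE : \sum_(i < p.-1) y ^+ i.+1 *+ 'C(p, i.+1) =
    p%:R * ((\sum_(i < p.-1) ('C(p, i.+1) %/ p)%:R * y ^+ i) * y).
  rewrite mulr_suml mulr_sumr; apply: eq_bigr => i _.
  have dv : (p %| 'C(p, i.+1))%N.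
    by apply: prime_dvd_bin => //=; rewrite -[X in (_ < X)%N](prednK p0) ltnS.
  rewrite -mulrA -exprSr mulrA -natrM mulnC divnK //.
  by rewrite mulr_natl.
rewrite exprD1n -pE; move: (p0) => /prednK <-; rewrite /= big_ord_recr big_ord_recl /=.
rewrite expr0 bin0 mulr1n (prednK p0) binn mulr1n addrC addrA; congr (_ + _).
Qed.

(** With y = h - 1, the difference of (y + 1)^p - 1 and y^p is a multiple of p y;
    both y^p and p y weigh more than y. *)
Lemma dim_sub_pow n h : (2 <= n)%N -> dim_sub n h -> dim_sub n.+1 (h ^+ p)%g.
Proof.
rewrite /dim_sub /= => n2 Fh; have n0 : (0 < n)%N by exact: ltnW.
have [z zE] := exprD1_prime (single h - 1); rewrite singleX.
rewrite -{1}(subrK 1 (single h)) zE addrAC addrK; apply: filtD; last first.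
  apply: filt_anti (filt_p (filtMl z Fh)).
  by rewrite mul2n -addnn -addn1 leq_add2l.
have powF e : filt (n ^ e) ((single h - 1) ^+ e).
  elim: e => [|e IH]; first by rewrite expr0; exact: filt1_one.
  by rewrite exprS expnS; exact: filtM.
apply: filt_anti (powF p); apply: (@leq_trans (n ^ 2)).
  rewrite expnS expn1 (leq_trans _ (leq_mul n2 (leqnn n))) //.
  by rewrite mul2n -addnn -addn1 leq_add2l.
by rewrite leq_pexp2l // prime_gt1.
Qed.

Lemma dim_sub_pows n h : dim_sub 2 h -> exists2 P, (0 < P)%N & dim_sub n (h ^+ P)%g.
Proof.
move=> h2; exists (p ^ n)%N; first by rewrite expn_gt0 prime_gt0.
suff: dim_sub n.+2 (h ^+ (p ^ n))%g by apply: filt_anti; rewrite ltnW.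
elim: n => [|n IH]; first by rewrite expg1.
by rewrite expnSr expgnA; exact: dim_sub_pow.
Qed.

Lemma sparse_prime_ge2 i : (2 <= sparse_prime i)%N.
Proof. exact: prime_gt1 (sparse_prime_prime i). Qed.

Lemma dim_sub_gen n j : (j < r)%N -> (n <= sparse_prime j.+1)%N -> dim_sub n (g j).
Proof. by move=> jr nj; apply: filt_anti nj _; exact: (filt_letter (Ordinal (jr : j.+1 < r.+1)%N)). Qed.

(** Powers of all the generators lie in dim_sub n. *)
Lemma dim_sub_open n : exists N, (N : set H) `<=` dim_sub n.
Proof.
apply: (chain_open g_chain (dim_sub_closed n)).
  by move=> h x; exact: dim_sub_normal.
by move=> j jr; apply: dim_sub_pows; apply: dim_sub_gen => //; exact: sparse_prime_ge2.
Qed.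

Lemma filt_single_coset n N h : (N : set H) `<=` dim_sub n ->
  filt n (single h - single (quo_repr (quo_proj N h))).
Proof.
move=> Nn; set h' := quo_repr _.
have -> : single h - single h' = single h' * (single (h'^-1 * h)%g - 1).
  by rewrite mulrBr mulr1 -singleM mulVKg.
by apply: filtMl; apply: Nn; exact: quo_repr_proj.
Qed.

(** An approximation of x at a finer level than N differs from the image of x at
    level N, lifted back, by multiples of h - 1 with h in N. *)
Lemma lift_level_sum N (s : seq (k * H)) :
  lift_level (val (\sum_(ch <- s) ch.1 *: single ch.2 : R) N) =
  \sum_(ch <- s) ch.1 *: single (quo_repr (quo_proj N ch.2)).
Proof.
rewrite cgr_val_sum /lift_level linear_sum; apply: eq_bigr => ch _.
by rewrite cgr_valZ cgr_val_single linearZ /= geval_single.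
Qed.

(** For N inside dim_sub n, the kernel of the projection to k[H/N] is the closure
    of the span of the multiples of nu - 1 with nu in N, which lies in filt n. *)
Lemma filt_open n : exists N m, forall x, nbhd N m x -> filt n x.
Proof.
have [N Nn] := dim_sub_open n; exists N, n => x [f fE].
have pn m y : filt (2 ^ m) (p%:R ^+ m * y).
  elim: m => [|m IH]; first exact: filt1.
  by rewrite exprS -mulrA expnS; exact: filt_p.
apply: filt_closed => N' m; have [s sE] := approx x (capN N N').
set y := \sum_(_ <- _) _ in sE; exists y; last first.
  by apply: nbhd_eq; rewrite -!(cgr_val_mono _ (@capN_subr _ N N')) sE.
have yN : val y N = p%:R ^+ n *: f.
  by rewrite -fE -!(cgr_val_mono _ (@capN_subl _ N N')) sE.
rewrite -(subrK (lift_level (val y N)) y); apply: filtD.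
  rewrite lift_level_sum -sumrB.
  elim/big_ind: _ => [|u v|ch _]; [exact: filt0 | exact: filtD|].
  by rewrite -scalerBr; apply: filtZ; exact: filt_single_coset.
rewrite yN /lift_level linearZ /= -natrX scaler_nat -mulr_natl natrX.
by apply: filt_anti (pn n _); rewrite ltnW // ltn_expl.
Qed.

(** For i < j the commutator of the two generators is generated by the ones after
    g_j, whose weights exceed the square of the weight of the letter j. *)
Lemma letter_comm (i j : L) :
  filt (sparse_prime i * sparse_prime j).+1 (letter i * letter j - letter j * letter i).
Proof.
wlog lij : i j / (i < j)%N.
  move=> wl; case: (ltngtP i j) => [|ji|/val_inj ->]; first exact: wl.
    by rewrite -opprB mulnC; apply: filtN; exact: wl.
  by rewrite subrr; exact: filt0.
case: i lij => [[|i] ir] lij.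
  by rewrite {1 4}/letter /= mulr_natl mulr_natr subrr; exact: filt0.
case: j lij => [[//|j] jr] lij; rewrite /letter /=.
have brE (u v : R) : (u - 1) * (v - 1) - (v - 1) * (u - 1) = u * v - v * u.
  have h (a b : R) : (a - 1) * (b - 1) = a * b + (1 - (a + b)).
    by rewrite mulrBl mulrBr mulr1 mul1r opprB opprD -!addrA [1 + _]addrCA.
  by rewrite !h [v + u]addrC; set X := 1 - _; rewrite opprD addrACA subrr addr0.
rewrite brE; set z := ((g j)^-1 * (g i)^-1 * g j * g i)%g.
have -> : single (g i) * single (g j) - single (g j) * single (g i) =
    - (single (g i) * single (g j) * (single z - 1)).
  rewrite mulrBr mulr1 opprB -!singleM; congr (_ - single _).
  by rewrite /z !mulgA mulgK mulgV mul1g.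
apply/filtN/filtMl; apply: filt_anti (_ : filt (sparse_prime j.+2) _).
  apply: leq_trans (sparse_prime_sqr _); rewrite ltnS expnS expn1.
  by apply: leq_mul => //; exact: (@sparse_prime_mono i.+1 j.+1 (ltnW lij)).
apply: (@chain_comm _ _ _ g_chain j (g i) (dim_sub (sparse_prime j.+2))) => //.
  exact: dim_sub_closed.
by move=> l jl lr; apply: dim_sub_gen => //; exact: (@sparse_prime_mono j.+2 l.+1).
Qed.

Lemma word_letter_comm (i : L) w :
  filt (sparse_prime i * wt w).+1 (letter i * word w - word w * letter i).
Proof.
elim: w => [|j w IH]; first by rewrite /word big_nil mulr1 mul1r subrr; exact: filt0.
rewrite /word /wt !big_cons -/(word w) -/(wt w).
rewrite -(subrK (letter j * letter i * word w) (letter i * _)) -addrA; apply: filtD.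
  rewrite !mulrA -mulrBl; apply: filt_anti (filtM (letter_comm i j) (filt_word w)).
  by rewrite mulSn mulnA -addn1 addnC leq_add2r wt_gt0.
rewrite -!mulrA -mulrBr; apply: filt_anti (filtM (filt_letter j) IH).
by rewrite mulnS mulnCA -addn1 addnC leq_add2r sparse_prime_gt0.
Qed.

(** Modulo filt (n + 1), a word of weight n only depends on the number of
    occurrences of each letter. *)
Lemma word_perm w w' : perm_eq w w' -> filt (wt w).+1 (word w - word w').
Proof.
elim: w w' => [|i w IH] w' ww'.
  by rewrite perm_sym in ww'; rewrite (perm_nilP ww') subrr; exact: filt0.
have iw' : i \in w' by rewrite -(perm_mem ww') mem_head.
case/splitPr: iw' ww' => u v; rewrite perm_sym -cat1s perm_catCA perm_cons perm_sym => wuv.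
have wtE : wt w = wt (u ++ v) by apply: perm_big.
rewrite /word /wt !big_cons -/(word w) -/(wt w) -/(word _) !word_cat.
have -> : word [:: i] = letter i by rewrite /word big_seq1.
rewrite -(subrK (letter i * word (u ++ v)) (letter i * _)) -addrA; apply: filtD.
  rewrite -mulrBr; apply: filt_anti (filtM (filt_letter i) (IH _ wuv)).
  by rewrite mulnS -addn1 addnC leq_add2r sparse_prime_gt0.
rewrite word_cat !mulrA -mulrBl wtE wt_cat mulnA.
apply: filt_anti (filtM (word_letter_comm i u) (filt_word v)).
by rewrite mulSn -addn1 addnC leq_add2r wt_gt0.
Qed.

Definition weights : seq nat := [seq sparse_prime i | i <- iota 0 r.+1].

Let smooth_word_in (l : seq L) m : smooth [seq sparse_prime i | i <- map val l] m <->
  exists2 w, {subset w <= l} & wt w = m.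
Proof.
elim: l m => [|i l IH] m /=.
  split; first by move=> ->; exists [::] => //; rewrite /wt big_nil.
  move=> [[|j w] sub <-]; first by rewrite /wt big_nil.
  by have := sub j (mem_head _ _).
split.
  move=> [e [m' [/IH [w sub <-] ->]]]; exists (nseq e i ++ w).
    by move=> j; rewrite mem_cat mem_nseq inE => /orP [/andP [_ ->] //|/sub ->]; rewrite orbT.
  by rewrite wt_cat; congr (_ * _)%N; rewrite /wt big_nseq iter_muln muln1.
move=> [w sub <-]; exists (count_mem i w), (wt [seq j <- w | j != i]); split.
  apply/IH; exists [seq j <- w | j != i] => // j; rewrite mem_filter => /andP [ji /sub].
  by rewrite inE (negPf ji).
rewrite /wt big_filter (bigID (pred1 i)) /=; congr (_ * _)%N.
rewrite -big_filter (eq_big_seq (fun=> sparse_prime i)); last first.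
  by move=> j; rewrite mem_filter => /andP [/eqP ->].
by rewrite big_const_seq count_predT size_filter iter_muln muln1.
Qed.

Lemma smooth_word m : smooth weights m <-> exists w, wt w = m.
Proof.
rewrite /weights -val_enum_ord smooth_word_in.
by split=> [[w _ wm]|[w wm]]; exists w => // i _; rewrite mem_enum.
Qed.

Lemma wt_count w (i : L) : logn (sparse_prime i) (wt w) = count_mem i w.
Proof.
elim: w => [|j w IH]; first by rewrite /wt big_nil logn1.
rewrite /wt big_cons -/(wt w) lognM ?sparse_prime_gt0 ?wt_gt0 // IH.
rewrite logn_prime ?sparse_prime_prime //= (inj_eq sparse_prime_inj) val_eqE eq_sym.
by rewrite eq_sym.
Qed.

Lemma wt_perm w w' : wt w = wt w' -> perm_eq w w'.
Proof. by move=> e; apply/allP => i _ /=; rewrite -!wt_count e. Qed.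

(** Which word of weight m is chosen is immaterial modulo filt (m + 1). *)
Definition std_word (m : nat) : R :=
  if pselect (exists w, wt w = m) is left h then word (projT1 (cid h)) else 0.

Lemma std_wordE w : filt (wt w).+1 (word w - std_word (wt w)).
Proof.
rewrite /std_word; case: pselect => [h|]; last by case; exists w.
by case: cid => w' /= w'w; apply/word_perm/wt_perm.
Qed.

Lemma filt_std_word m : filt m (std_word m).
Proof.
rewrite /std_word; case: pselect => [h|_]; last exact: filt0.
by case: cid => w /= <-; exact: filt_word.
Qed.

Lemma std_wordM a b : smooth weights a -> smooth weights b ->
  filt (a * b).+1 (std_word a * std_word b - std_word (a * b)).
Proof.
move=> /smooth_word [u <-] /smooth_word [v <-].
have Fu := std_wordE u; have Fv := std_wordE v; have := std_wordE (u ++ v).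
rewrite wt_cat word_cat => Fuv.
rewrite -(subrK (word u * word v) (std_word (wt u) * _)) -addrA; apply: filtD => //.
rewrite -(subrK (std_word (wt u) * word v) (std_word (wt u) * _)) -addrA.
rewrite -mulrBr -mulrBl; apply: filtD.
  apply: filt_anti (filtM (filt_std_word _) (_ : filt (wt v).+1 _)).
    by rewrite mulnS -addn1 addnC leq_add2r wt_gt0.
  by rewrite -opprB; exact: filtN.
apply: filt_anti (filtM (_ : filt (wt u).+1 _) (filt_word v)).
  by rewrite mulSn -addn1 addnC leq_add2r wt_gt0.
by rewrite -opprB; exact: filtN.
Qed.

Let words_lead m x : words m x -> exists c, filt m.+1 (x - c *: std_word m).
Proof.
elim=> [|c w y mw _ [d Fd]]; first by exists 0; rewrite scale0r subrr; exact: filt0.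
move: mw; rewrite leq_eqVlt => /predU1P [mw|mw].
  exists (c + d); rewrite scalerDl opprD addrACA -scalerBr; apply: filtD => //.
  by apply: filtZ; rewrite mw; exact: std_wordE.
exists d; rewrite -addrA; apply: filtD => //; apply: filtZ.
exact: filt_anti (filt_word w).
Qed.

(** Multiples of p gain weight, so filt m / filt (m + 1) is a space over k / p,
    spanned by the standard word. The factors v and v' are scalars, and hence serve
    for left ideals and for right ideals. *)
Lemma filt_lead m x : (0 < m)%N -> filt m x ->
  filt m.+1 x \/ smooth weights m /\ exists v v' : R,
    (forall y : R, v * y = y * v /\ v' * y = y * v') /\
    filt m.+1 (v * x - std_word m) /\ filt m.+1 (x - v' * std_word m).
Proof.
move=> m0 Fx; have [N [l NF]] := filt_open m.+1.
have [y wy Vxy] := Fx N l; have [c Fc] := words_lead wy.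
have {y wy Vxy} Fc : filt m.+1 (x - c *: std_word m).
  by rewrite -(subrK y x) -addrA; apply: filtD => //; exact: NF.
have [sm|nsm] := pselect (smooth weights m); last first.
  left; have E : std_word m = 0.
    rewrite /std_word; case: pselect => // h; case: nsm; exact/smooth_word.
  by rewrite E scaler0 subr0 in Fc.
have [[c' c'c]|[d cE]] := coef_local k_coef c.
  right; split => //; exists c'%:A, c%:A; split.
    by move=> y; rewrite -!scalerAl -!scalerAr !mul1r !mulr1.
  rewrite -!scalerAl !mul1r; split => //.
  rewrite -[X in _ - X]scale1r -c'c -scalerA -scalerBr; exact: filtZ.
left; rewrite -(subrK (c *: std_word m) x); apply: filtD => //.
rewrite cE mulrC -scalerA; apply: filtZ; rewrite scaler_nat -mulr_natl.
by apply: filt_anti (filt_p (filt_std_word m)); rewrite mul2n -addnn -addn1 leq_add2l.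
Qed.

End Filtration.

(** * The completed group ring is Noetherian *)

Section TwoSidedIdeals.
Variable A : nzRingType.
Implicit Types (I J V : set A) (x y : A) (s : seq A).

Definition two_sided J : Prop :=
  [/\ J 0, forall x y, J x -> J y -> J (x - y), forall a x, J x -> J (a * x)
    & forall a x, J x -> J (x * a)].

Definition nilpotent_mod V J : Prop := exists n, forall s,
  (forall x, x \in s -> J x) -> (n <= size s)%N -> V (\prod_(x <- s) x).

Definition adjoin J y : set A := [set x | exists a, J (x - a * y)].

Lemma two_sidedD J x y : two_sided J -> J x -> J y -> J (x + y).
Proof. by move=> [J0 JB _ _] Jx Jy; rewrite -(opprK y); apply: (JB) => //; rewrite -sub0r; exact: JB. Qed.

Lemma two_sidedN J x : two_sided J -> J x -> J (- x).
Proof. by move=> [J0 JB _ _] Jx; rewrite -sub0r; apply: JB. Qed.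

Lemma sub_adjoin J y : J `<=` adjoin J y.
Proof. by move=> x Jx; exists 0; rewrite mul0r subr0. Qed.

Lemma mem_adjoin J y : two_sided J -> adjoin J y y.
Proof. by move=> [J0 _ _ _]; exists 1; rewrite mul1r subrr. Qed.

Lemma adjoin_two_sided J y : two_sided J -> (forall a, J (y * a - a * y)) ->
  two_sided (adjoin J y).
Proof.
move=> Jid yc; have [J0 JB Jl Jr] := Jid; split.
- exact: sub_adjoin.
- move=> u v [a Ju] [b Jv]; exists (a - b).
  have -> : u - v - (a - b) * y = (u - a * y) - (v - b * y).
    by rewrite mulrBl !opprD !opprK addrACA.
  exact: JB.
- by move=> a u [b Ju]; exists (a * b); rewrite -mulrA -mulrBr; exact: Jl.
- move=> a u [b Ju]; exists (b * a).
  have -> : u * a - b * a * y = (u - b * y) * a + b * (y * a - a * y).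
    by rewrite mulrBl mulrBr !mulrA addrA subrK.
  by apply: two_sidedD => //; [exact: Jr | exact: Jl].
Qed.

Lemma adjoin_prod J y s : two_sided J -> (forall a, J (y * a - a * y)) ->
  (forall x, x \in s -> adjoin J y x) ->
  exists b, J (\prod_(x <- s) x - b * y ^+ size s).
Proof.
move=> Jid yc; have [J0 JB Jl Jr] := Jid.
elim: s => [|x s IH] sJ; first by exists 1; rewrite big_nil mulr1 subrr.
have [|b Jb] := IH; first by move=> z zs; apply: sJ; rewrite inE zs orbT.
have [a Ja] := sJ x (mem_head _ _).
have yXc n c : J (y ^+ n * c - c * y ^+ n).
  elim: n => [|n IHn]; first by rewrite mul1r mulr1 subrr.
  have -> : y ^+ n.+1 * c - c * y ^+ n.+1 =
      y * (y ^+ n * c - c * y ^+ n) + (y * c - c * y) * y ^+ n.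
    by rewrite mulrBr mulrBl exprS !mulrA addrA subrK.
  by apply: two_sidedD => //; [exact: Jl | exact: Jr].
exists (a * b); rewrite big_cons /= exprS.
set P := \prod_(_ <- _) _ in Jb *.
have -> : x * P - a * b * (y * y ^+ size s) =
    (x - a * y) * P + (a * y * (P - b * y ^+ size s) + a * (y * b - b * y) * y ^+ size s).
  by rewrite mulrBl !mulrBr mulrBl !mulrA !addrA subrK subrK.
apply: two_sidedD => //; first exact: Jr.
by apply: two_sidedD => //; [exact: Jl | apply/Jr/Jl].
Qed.

(** Modulo J, a product of e elements of J + A y is a multiple of y^e, which
    vanishes; so a product of n e elements is a product of n elements of J. *)
Lemma adjoin_nilpotent V J y e : two_sided V -> two_sided J ->
  (forall a, J (y * a - a * y)) -> J (y ^+ e) -> nilpotent_mod V J ->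
  nilpotent_mod V (adjoin J y).
Proof.
move=> [_ _ Vl Vr] Jid yc Je [n nP]; have [J0 JB Jl Jr] := Jid.
exists (n * e)%N => s sJ sn.
suff [t [z [tJ tn ->]]] : exists t z, [/\ forall x, x \in t -> J x, size t = n &
    \prod_(x <- s) x = (\prod_(x <- t) x) * z].
  by apply: Vr; apply: nP; rewrite ?tn.
elim: (n) s sJ sn => [|m IH] s sJ sn.
  by exists [::], (\prod_(x <- s) x); split => //; rewrite big_nil mul1r.
have es : (e <= size s)%N by apply: leq_trans sn; rewrite mulSn leq_addr.
have [||t [z [tJ tm tE]]] := IH (drop e s).
- by move=> x /mem_drop /sJ.
- by rewrite size_drop leq_subRL // -mulSn.
have [|b Jb] := @adjoin_prod J y (take e s) Jid yc; first by move=> x /mem_take /sJ.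
exists (\prod_(x <- take e s) x :: t), z; split => /=; last first.
- by rewrite -{1}(cat_take_drop e s) big_cat big_cons -mulrA -tE.
- by rewrite tm.
move=> x; rewrite inE => /predU1P [->|/tJ //].
rewrite -(subrK (b * y ^+ size (take e s)) (\prod_(_ <- _) _)).
by apply: two_sidedD => //; apply: Jl; rewrite size_takel.
Qed.

Lemma two_sidedX J a b n : two_sided J -> J (a - b) -> J (a ^+ n - b ^+ n).
Proof.
move=> Jid Jab; have [J0 _ Jl Jr] := Jid; elim: n => [|n IH]; first by rewrite subrr.
rewrite !exprS -(subrK (a * b ^+ n) (a * _)) -addrA -mulrBr -mulrBl.
by apply: two_sidedD => //; [exact: Jl | exact: Jr].
Qed.

End TwoSidedIdeals.

Section Noetherian.
Variables (k : comNzRingType) (p : nat) (H : topGroupType) (r : nat) (g : nat -> H).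
Hypothesis p_pr : prime p.
Hypothesis k_coef : padic_coef k p.
Hypothesis H_fin : finite_quotients H.
Hypothesis H_prop : pro_p H p.
Hypothesis g_chain : central_chain r g.
Notation R := (completed_group_ring k H).
Notation single := (single k).
Notation nbhd := (@nbhd k p H).
Notation filt := (@filt k p H r g).
Notation letter := (@letter k p H r g).
Implicit Types (N : open_normal H) (x y : R) (h : H).

Lemma nbhd_two_sided N m : two_sided (nbhd N m).
Proof.
split; [exact: nbhd0 | exact: nbhdB | by move=> a x; exact: nbhdMl|].
by move=> a x; exact: nbhdMr.
Qed.

Section Level.
Variables (N : open_normal H) (m : nat).
Let V := nbhd N m.

(* J d is generated by V, p and the last d generators, taken as g - 1. *)
Let J := fix J d : set R := if d is d'.+1 then adjoin (J d') (single (g (r - d)) - 1)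
                            else adjoin V p%:R.

Let pV_two_sided : two_sided (adjoin V p%:R).
Proof.
apply: adjoin_two_sided => [|a]; first exact: nbhd_two_sided.
by rewrite mulr_natl mulr_natr subrr; exact: nbhd0.
Qed.

Let pV_p : adjoin V p%:R p%:R.
Proof. exact/mem_adjoin/nbhd_two_sided. Qed.

Let pV_nilpotent : nilpotent_mod V (adjoin V p%:R).
Proof.
apply: (@adjoin_nilpotent _ _ _ _ m); [exact: nbhd_two_sided | exact: nbhd_two_sided|..].
- by move=> a; rewrite mulr_natl mulr_natr subrr; exact: nbhd0.
- by exists 1; rewrite -natrX cgr_val_nat -natrX scaler_nat.
- exists 1%N => -[//|x s] sV _; rewrite big_cons; apply: nbhdMr.
  by apply: sV; exact: mem_head.
Qed.

Let J_pV d : adjoin V p%:R `<=` J d.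
Proof. by elim: d => [//|d IH] x /IH; exact: sub_adjoin. Qed.

Let single_V h h' : (N : set H) (h^-1 * h')%g -> V (single h - single h').
Proof. by move=> Nh; apply: nbhd_eq; exact: single_val_eq. Qed.

Let ideal_closed (I : set R) : two_sided I -> V `<=` I ->
  closed_sub [set h | I (single h - 1)].
Proof.
move=> Iid VI; have [I0 IB Il Ir] := Iid; split.
- by rewrite /= single1 subrr.
- move=> h h' /= Fh Fh'; rewrite singleM -(subrK (single h) (_ * _)) -addrA.
  apply: two_sidedD => //.
  by rewrite -{2}(mulr1 (single h)) -mulrBr; exact: Il.
- move=> h /= Fh; have -> : single h^-1%g - 1 = - (single h^-1%g * (single h - 1)).
    by rewrite mulrBr singleV mulr1 opprB.
  by apply: two_sidedN => //; exact: Il.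
- move=> h hcl /=; have [h' Fh' Nh] := hcl N.
  rewrite -(subrK (single h') (single h)) -addrA; apply: two_sidedD => //.
  by rewrite -opprB; apply: two_sidedN => //; apply: VI; exact: single_V.
Qed.

Let JP d : (d <= r)%N ->
  [/\ two_sided (J d), forall j, (r - d <= j)%N -> (j < r)%N -> J d (single (g j) - 1)
    & nilpotent_mod V (J d)].
Proof.
elim: d => [|d IH] dr.
  split => // j; rewrite subn0 => rj; by rewrite ltnNge rj.
have [Jid Jg Jnil] := IH (ltnW dr).
set l := (r - d.+1)%N; have lr : (l < r)%N by rewrite ltn_subrL (leq_trans _ dr).
have lS : (r - d)%N = l.+1 by rewrite subnSK.
set y := single (g l) - 1.
have VJ : V `<=` J d by apply: subset_trans (J_pV d); exact: sub_adjoin.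
have [J0 JB Jl Jr] := Jid.
have yc a : J d (y * a - a * y).
  have ys h : J d (y * single h - single h * y).
    have -> : y * single h - single h * y =
        single h * single (g l) * (single ((g l)^-1 * h^-1 * g l * h)%g - 1).
      rewrite /y mulrBl mulrBr mul1r mulr1 opprB addrA subrK mulrBr mulr1 -!singleM.
      by congr (single _ - _); rewrite !mulgA mulgK mulgV mul1g.
    apply: Jl; apply: (@chain_comm _ _ _ g_chain l h [set h | J d (single h - 1)]) => //.
      exact: ideal_closed.
    by move=> j lj jr; apply: Jg; rewrite // lS.
  have [s sE] := approx a N.
  set b := \sum_(_ <- _) _ in sE.
  have -> : y * a - a * y = (y * (a - b) - (a - b) * y) + (y * b - b * y).
    have sp (c u v : R) : c * (u + v) - (u + v) * c = (c * u - u * c) + (c * v - v * c).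
      by rewrite mulrDr mulrDl opprD addrACA.
    by rewrite -sp subrK.
  apply: two_sidedD => //.
    have Jab : J d (a - b) by apply: VJ; exact: nbhd_eq.
    by apply: (JB); [exact: Jl | exact: Jr].
  rewrite /b mulr_sumr mulr_suml -sumrB.
  elim/big_ind: _ => [//|u v Ju Jv|ch _]; first exact: two_sidedD.
  rewrite -scalerAr -scalerAl -scalerBr -[_ *: _]mul1r -scalerAr scalerAl.
  exact: Jl.
have ye : exists e, J d (y ^+ e).
  have [e Ne] := H_prop N (g l); exists (p ^ e)%N.
  suff: J d (single (g l ^+ (p ^ e))%g - 1 - y ^+ (p ^ e)).
    move=> Je; rewrite -(subKr (single (g l ^+ (p ^ e))%g - 1) (y ^+ _)); apply: (JB) => //.
    by apply: VJ; rewrite -(single1 k H); apply: nbhd_eq; apply/esym/single_val_eq;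
      rewrite invg1 mul1g.
  elim: (e) => [|e' IHe]; first by rewrite expg1 expr1 subrr.
  set x := single (g l ^+ (p ^ e'))%g - 1 in IHe.
  rewrite expnSr expgnA exprM singleX.
  have [z zE] := exprD1_prime p_pr x.
  have -> : single (g l ^+ (p ^ e'))%g ^+ p - 1 = x ^+ p + p%:R * (z * x).
    by rewrite -[single _](subrK 1) -/x zE addrAC addrK.
  rewrite addrAC.
  apply: two_sidedD; [exact: Jid | exact: two_sidedX|].
  by apply: (Jr); apply: J_pV; exact: pV_p.
split.
- exact: adjoin_two_sided.
- move=> j; rewrite leq_eqVlt => /predU1P [<- _|lj jr]; first exact: mem_adjoin.
  by apply: sub_adjoin; apply: Jg; rewrite // lS.
- by have [e Je] := ye; apply: (@adjoin_nilpotent _ _ _ _ e) => //; exact: nbhd_two_sided.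
Qed.

(** Modulo nbhd N m the letters are nilpotent, and each is central modulo the later
    ones; so all words with sufficiently many letters vanish, and a word with few
    letters has bounded weight. *)
Lemma filt_nbhd : exists n, forall x, filt n x -> nbhd N m x.
Proof.
have [Jid Jg [n Jn]] := JP (leqnn r).
have word_V (w : seq 'I_r.+1) : (n <= size w)%N -> V (word k p g w).
  move=> nw; have -> : word k p g w = \prod_(x <- map letter w) x by rewrite big_map.
  apply: Jn; last by rewrite size_map.
  move=> x /mapP [[[|j] jr] _ ->]; first exact/J_pV/pV_p.
  by apply: Jg => //; rewrite subnn.
exists (sparse_prime r ^ n)%N => x /(_ N m) [y wy Vxy].
rewrite -(subrK y x); apply: nbhdD => //.
elim: wy => [|c w z nw _ IH]; first exact: nbhd0.
apply: nbhdD => //; apply: nbhdZ; apply: word_V.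
rewrite -(leq_exp2l _ _ (sparse_prime_ge2 r)); apply: leq_trans nw _.
rewrite /wt; elim: w => [|i w IHw]; first by rewrite big_nil.
rewrite big_cons expnS leq_mul //; apply: sparse_prime_mono.
by rewrite -ltnS.
Qed.

End Level.

Lemma filt_separated x : (forall n, filt n x) -> x = 0.
Proof.
move=> Fx; apply: (nbhd_separated k_coef) => N m.
by have [n] := filt_nbhd N m; apply.
Qed.

Lemma filt_complete (y : nat -> R) :
  (forall m, exists n0, forall n, (n0 <= n)%N -> filt m (y n)) ->
  exists z, forall m, exists n0, forall n, (n0 <= n)%N -> filt m (z - \sum_(i < n) y i).
Proof.
move=> y0; have [|z zP] := @nbhd_complete k p H k_coef H_fin y.
  move=> N m; have [n nV] := filt_nbhd N m; have [n0 n0P] := y0 n.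
  by exists n0 => i /n0P /nV.
exists z => m; have [N [l NF]] := filt_open k p_pr H_prop g_chain m.
by have [n0 n0P] := zP N l; exists n0 => n /n0P /NF.
Qed.

Lemma weights_gt0 q : q \in weights r -> (0 < q)%N.
Proof. by move=> /mapP [i _ ->]; exact: sparse_prime_gt0. Qed.

(** Left ideals are generated by elements whose leading monomials generate; in
    particular they are closed. *)
Lemma left_ideal_fg_closed (I : set R) : left_ideal I ->
  exists n (a : 'I_n -> R), (forall i, I (a i)) /\
  forall x, (forall m, exists2 y, I y & filt m (x - y)) -> exists c, x = lcomb c a.
Proof.
move=> Iid; apply: (@filtered_fg R filt (std_word k p r g) (weights r)) => //.
- exact: weights_gt0.
- exact: filt1.
- exact: filt0.
- exact: filtB.
- exact: filt_anti.
- exact: filtM.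
- exact: filt_std_word.
- exact: std_wordM.
- move=> m x m0 /(filt_lead p_pr k_coef H_prop g_chain m0) [|[sm [v [v' [_ h]]]]]; first by left.
  by right; split => //; exists v, v'.
- exact: filt_separated.
- exact: filt_complete.
Qed.

(** The hypotheses of filtered_fg are symmetric, as weights commute and the factors
    of filt_lead are central. *)
Lemma right_ideal_fg_closed (I : set R^c) : left_ideal I ->
  exists n (a : 'I_n -> R^c), (forall i, I (a i)) /\
  forall x : R^c, (forall m, exists2 y, I y & filt m (x - y : R)) -> exists c, x = lcomb c a.
Proof.
move=> Iid; apply: (@filtered_fg R^c filt (std_word k p r g) (weights r)) => //.
- exact: weights_gt0.
- exact: filt1.
- exact: filt0.
- exact: filtB.
- exact: filt_anti.
- by move=> a b x y Fx Fy; rewrite mulnC; exact: filtM.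
- exact: filt_std_word.
- by move=> a b sa sb; rewrite mulnC; exact: std_wordM.
- move=> m x m0 /(filt_lead p_pr k_coef H_prop g_chain m0) [|[sm [v [v' [vc h]]]]]; first by left.
  right; split => //; exists v, v'.
  have [e _] := vc x; have [_ e'] := vc (std_word k p r g m).
  by rewrite e e' in h; exact: h.
- exact: filt_separated.
- exact: filt_complete.
Qed.

Let noetherian_of (S : nzRingType) :
  (forall I : set S, left_ideal I -> exists n (a : 'I_n -> S), (forall i, I (a i)) /\
     forall x : S, I x -> exists c, x = lcomb c a) -> left_noetherian S.
Proof.
move=> fg I Iid; have [n [a [aI aspan]]] := fg I Iid.
exists [seq (a i : S^o) | i <- enum 'I_n]; split; first by move=> x /mapP [i _ ->].
by move=> x /aspan [c ->]; exact: (@lspan_family S S^o).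
Qed.

Theorem completed_left_noetherian : left_noetherian R.
Proof.
apply: noetherian_of => I Iid; have [n [a [aI aspan]]] := left_ideal_fg_closed Iid.
exists n, a; split => // x Ix; apply: aspan => m; exists x => //.
by rewrite subrr; exact: filt0.
Qed.

Theorem completed_right_noetherian : left_noetherian R^c.
Proof.
apply: noetherian_of => I Iid; have [n [a [aI aspan]]] := right_ideal_fg_closed Iid.
exists n, a; split => // x Ix; apply: aspan => m; exists x => //.
by rewrite subrr; exact: filt0.
Qed.

(** The left ideal generated by the h - 1 with h in N is closed, hence contains
    the kernel of the projection to k[H/N]. *)
Theorem completed_generation N x : exists (s : seq (k * H)) (t : seq (R * H)),
  (forall yh, yh \in t -> (N : set H) yh.2) /\
  x = \sum_(ch <- s) ch.1 *: single ch.2 + \sum_(yh <- t) yh.1 * (single yh.2 - 1).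
Proof.
pose I := [set x : R | exists t : seq (R * H),
  (forall yh, yh \in t -> (N : set H) yh.2) /\ x = \sum_(yh <- t) yh.1 * (single yh.2 - 1)].
have Iid : left_ideal I.
  split; first by exists [::]; split => //; rewrite big_nil.
  - move=> _ _ [t [tN ->]] [t' [t'N ->]]; exists (t ++ t'); rewrite big_cat; split => //.
    by move=> yh; rewrite mem_cat => /orP [/tN|/t'N].
  - move=> a _ [t [tN ->]]; exists [seq (a * yh.1, yh.2) | yh <- t]; split.
      by move=> _ /mapP [yh /tN ? ->].
    by rewrite big_map mulr_sumr; apply: eq_bigr => yh _; rewrite mulrA.
have [n [a [aI aspan]]] := left_ideal_fg_closed Iid.
have [s sE] := approx x N; set y := \sum_(_ <- _) _ in sE.
have [I0 ID IM] := Iid.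
suff [t [tN tE]] : I (x - y) by exists s, t; split => //; rewrite -tE addrC subrK.
have [|c ->] := aspan (x - y); last by rewrite /lcomb; elim/big_ind: _ => // i _; exact: IM.
move=> m; have [N' [l NF]] := filt_open k p_pr H_prop g_chain m.
have [s' s'E] := approx (x - y) (capN N N'); set z := \sum_(_ <- _) _ in s'E.
exists z; last first.
  by apply: NF; apply: nbhd_eq; rewrite -!(cgr_val_mono _ (@capN_subr _ N N')) s'E.
have zN : lift_level (val z N) = 0.
  have -> : val z N = 0.
    by rewrite -(cgr_val_mono _ (@capN_subl _ N N')) -s'E (cgr_val_mono _ (@capN_subl _ N N'))
      cgr_valD cgr_valN sE subrr.
  by rewrite /lift_level linear0.
rewrite -(subr0 z) -zN lift_level_sum -sumrB.
elim/big_ind: _ => // ch _; rewrite -scalerBr.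
set h := quo_repr _; exists [:: (ch.1 *: single h, (h^-1 * ch.2)%g)]; split.
  by move=> yh; rewrite inE => /eqP -> /=; exact: quo_repr_proj.
by rewrite big_seq1 /= -scalerAl mulrBr mulr1 -singleM mulVKg.
Qed.

End Noetherian.

(** * Coherence of the augmented algebra *)

Section TensorInduction.
Variables (M N T : nzRingType) (t : M -> N -> T) (P : set T).
Hypothesis P0 : P 0.
Hypothesis PB : forall x y, P x -> P y -> P (x - y).

Definition zmod_pred : {pred T} := fun x => `[< P x >].
Let zmod_predP : zmod_closed zmod_pred.
Proof.
split; first exact/asboolP.
by move=> x y /asboolP Px /asboolP Py; apply/asboolP; exact: PB.
Qed.
HB.instance Definition _ := GRing.isZmodClosed.Build T zmod_pred zmod_predP.
Definition zmod_sub : Type := {x : T | zmod_pred x}.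
HB.instance Definition _ := SubType.copy zmod_sub {x : T | zmod_pred x}.
HB.instance Definition _ := Choice.copy zmod_sub {x : T | zmod_pred x}.
HB.instance Definition _ := [SubChoice_isSubZmodule of zmod_sub by <:].

Variables (R : nzRingType) (f : R -> M) (g : R -> N).

(** The map T -> P given by the universal property, followed by the inclusion of P,
    fixes the pure tensors, hence is the identity. *)
Lemma tensor_ind : is_tensor_product f g t ->
  (forall x y, P (t x y)) -> forall z, P z.
Proof.
move=> [[tDl tDr tM] univ] Pt z.
pose u x y : zmod_sub := @exist _ (fun x => zmod_pred x) (t x y) (asboolT (Pt x y)).
have [|phi [phiE _]] := univ zmod_sub u.
  by split=> *; apply: val_inj => /=; rewrite ?tDl ?tDr ?tM.
have [|psi [_ psi_uniq]] := univ T t; first by [].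
pose proj : {additive T -> T} := val \o phi.
have projE : proj =1 idfun.
  move=> w; rewrite (psi_uniq proj) ?(psi_uniq idfun) // => x y.
  by rewrite /= phiE.
have := valP (phi z) => /asboolP; rewrite -[val _]/(proj z) projE.
by [].
Qed.
End TensorInduction.

Section GroupRingEval.
Variable (k : comNzRingType).

Lemma gr_eval_exchange (G1 G2 : groupType) (w : G1 -> G2 -> k)
    (f : group_ring k G1) (f' : group_ring k G2) :
  gr_eval (fun x => gr_eval (fun y => w x y) f') f =
  gr_eval (fun y => gr_eval (fun x => w x y) f) f'.
Proof.
rewrite /gr_eval; under eq_bigr => x _ do rewrite mulr_sumr.
rewrite exchange_big; apply: eq_bigr => y _; rewrite mulr_sumr.
by apply: eq_bigr => x _; rewrite mulrCA.
Qed.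

Lemma geval_map (G1 G2 : groupType) (V : lmodType k) (phi : G1 -> G2) (w : G2 -> V) f :
  geval w (gr_map phi f) = geval (w \o phi) f.
Proof.
rewrite [in LHS](gr_decomp f) [in RHS](gr_decomp f).
rewrite (big_morph (gr_map phi) (@gr_mapD k _ _ phi) (@gr_map0 k _ _ phi)) !linear_sum.
apply: eq_bigr => x _.
by rewrite gr_mapZ gr_map_single !linearZ /= !geval_single.
Qed.

End GroupRingEval.

Section Augmented.
Variables (k : comNzRingType) (G : topGroupType) (K : subgroup G) (A : algType k).
Let KK : topGroupType := subgroup_type K.
Notation S := (completed_group_ring k (subgroup_type K)).
Variables (a : {lrmorphism S -> A}) (b : {lrmorphism group_ring k G -> A}).
Hypothesis tens : is_tensor_product
  (@gr_completion k (subgroup_type K)) (gr_map (@subgroup_incl G K))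
  (fun x y => a x * b y).
Notation incl := (@subgroup_incl G K).

Hypothesis S_left : left_noetherian S.
Hypothesis S_right : left_noetherian S^c.
Hypothesis S_gen : forall (N : open_normal KK) (x : S),
  exists (s : seq (k * KK)) (t : seq (S * KK)),
  (forall yh, yh \in t -> (N : set KK) yh.2) /\
  x = \sum_(ch <- s) ch.1 *: single k ch.2 + \sum_(yh <- t) yh.1 * (single k yh.2 - 1).
Hypothesis K_fin : finite_quotients KK.
Hypothesis K_conj : forall (h : G) (N : open_normal KK), exists N' : open_normal KK,
  forall nu, (N' : set KK) nu -> exists2 nu', (N : set KK) nu' & incl nu' = (h * incl nu * h^-1)%g.
Hypothesis G_union : forall s : seq G, exists K' : subgroup G,
  [/\ (K : set G) `<=` K', forall x, x \in s -> (K' : set G) x &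
    exists2 l : seq G, forall x, x \in l -> (K' : set G) x &
      forall x, (K' : set G) x -> exists2 y, y \in l & (K : set G) (x * y^-1)%g].

Implicit Types (N : open_normal KK) (x y : S) (z : A) (u v h : G) (phi psi : G -> k) (nu : KK).

Definition bg (u : G) : A := b (gr_single k u).

Lemma inclM nu nu' : incl (nu * nu')%g = (incl nu * incl nu')%g. Proof. by []. Qed.
Lemma incl1 : incl 1%g = 1%g. Proof. by []. Qed.
Lemma inclV nu : incl nu^-1%g = (incl nu)^-1%g. Proof. by []. Qed.
Lemma incl_in nu : (K : set G) (incl nu). Proof. exact: set_valP. Qed.
Lemma incl_onto u : (K : set G) u -> exists nu : KK, incl nu = u.
Proof. by move=> Ku; exists (exist _ u (mem_set Ku)). Qed.

Lemma bgM u v : bg (u * v)%g = bg u * bg v.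
Proof. by rewrite /bg gr_singleM rmorphM. Qed.
Lemma bg1 : bg 1%g = 1. Proof. exact: (rmorph1 b). Qed.
Lemma bgV u : bg u^-1%g * bg u = 1. Proof. by rewrite -bgM mulVg bg1. Qed.
Lemma bgVr u : bg u * bg u^-1%g = 1. Proof. by rewrite -bgM mulgV bg1. Qed.

Lemma a_single nu : a (single k nu) = bg (incl nu).
Proof.
have [[_ _ tM] _] := tens; have := tM 1 (gr_single k nu) 1.
by rewrite !rmorph1 !mul1r !mulr1 gr_map_single.
Qed.

Definition tsum (s : seq (S * G)) : A := \sum_(xg <- s) a xg.1 * bg xg.2.

Lemma tsum_all z : exists s, z = tsum s.
Proof.
apply: (tensor_ind (P := [set z | exists s, z = tsum s]) _ _ tens).
- by exists [::]; rewrite /tsum big_nil.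
- move=> _ _ [s ->] [s' ->]; exists (s ++ [seq (- xg.1, xg.2) | xg <- s']).
  rewrite /tsum big_cat big_map -sumrN; congr (_ + _).
  by apply: eq_bigr => xg _; rewrite rmorphN mulNr.
move=> x f; exists [seq (gr_coef f u *: x, u) | u <- gr_supp f].
rewrite /tsum big_map [in LHS](gr_decomp f) linear_sum mulr_sumr.
by apply: eq_bigr => u _; rewrite !linearZ /= -scalerAl -scalerAr.
Qed.

(** Functions on G invariant under N on the left define functionals on A, as kK is
    on the left of the tensor product. Invariance on the right is what makes these
    functionals stable under left multiplication by G. *)
Definition linv N phi := forall nu, (N : set KK) nu -> forall u, phi (incl nu * u)%g = phi u.
Definition rinv N phi := forall nu, (N : set KK) nu -> forall u, phi (u * incl nu)%g = phi u.
Definition uniform phi := exists N, linv N phi /\ rinv N phi.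

Lemma linv_eq N phi nu nu' : linv N phi -> (N : set KK) (nu^-1 * nu')%g ->
  phi (incl nu) = phi (incl nu').
Proof.
move=> inv Nn; have -> : nu' = (nu * (nu^-1 * nu') * nu^-1 * nu)%g by rewrite mulgVK mulVKg.
by rewrite inclM inv //; exact: Defs.normalP.
Qed.

Lemma linv_translate N phi u : linv N phi -> linv N (fun v => phi (v * u)%g).
Proof. by move=> inv nu Nn v; rewrite -mulgA inv. Qed.

Lemma linv_mono N N' phi : (N' : set KK) `<=` N -> linv N phi -> linv N' phi.
Proof. by move=> NN' inv nu /NN'; exact: inv. Qed.

Definition pair N x phi : k :=
  gr_eval (fun C : quotient_group N => phi (incl (quo_repr C))) (val x N).

Lemma pair_mono N N' x phi : (N' : set KK) `<=` N -> linv N phi -> pair N' x phi = pair N x phi.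
Proof.
move=> NN' inv; rewrite /pair -(cgr_val_mono x NN') gr_eval_map; apply: eq_gr_eval => C /=.
apply: (linv_eq inv); apply/quo_proj_eqP.
by rewrite quo_reprK -{2}(quo_reprK C) quo_mapE.
Qed.

Lemma pair_indep N N' x phi : linv N phi -> linv N' phi -> pair N x phi = pair N' x phi.
Proof.
by move=> h h'; rewrite -(pair_mono x (@capN_subl _ N N') h) (pair_mono x (@capN_subr _ N N') h').
Qed.

Lemma pair_mul N x f phi : linv N phi ->
  pair N (x * gr_completion f) phi = gr_eval (fun nu => pair N x (fun u => phi (u * incl nu)%g)) f.
Proof.
move=> inv; rewrite /pair cgr_valM gr_evalM gr_eval_exchange gr_eval_map.
rewrite gr_eval_exchange [RHS]gr_eval_exchange; apply: eq_gr_eval => C /=.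
apply: eq_gr_eval => nu /=; rewrite -inclM; apply: (linv_eq inv).
by apply/quo_proj_eqP; rewrite quo_reprK quo_projMg quo_reprK.
Qed.

(** An element x of kK is a measure on K, and the functional integrates
    v |-> phi (v u) against it. *)
Lemma ev_exists N phi : linv N phi -> exists E : {additive A -> k},
  forall x u, E (a x * bg u) = pair N x (fun v => phi (v * u)%g).
Proof.
move=> inv; have [_ univ] := tens.
have [|E [EE _]] := univ k (fun x f => gr_eval (fun u => pair N x (fun v => phi (v * u)%g)) f).
  split.
  - move=> x x' f; rewrite -gr_eval_add; apply: eq_gr_eval => u.
    exact: gr_evalD.
  - by move=> x f f'; rewrite gr_evalD.
  - move=> x f f'; rewrite gr_evalM gr_eval_map.
    rewrite -(gr_eval_exchange (fun u nu => pair N x (fun v => phi (v * (incl nu * u))%g))).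
    apply: eq_gr_eval => u; rewrite pair_mul; last exact: linv_translate.
    apply: eq_gr_eval => nu /=; congr pair; apply/funext => v.
    by rewrite mulgA.
by exists E => x u; rewrite EE gr_eval_single.
Qed.

Definition ev phi : A -> k :=
  if pselect (exists N, linv N phi) is left h then
    projT1 (cid (ev_exists (projT2 (cid h)))) else fun=> 0.

Lemma ev_pure N phi x u : linv N phi -> ev phi (a x * bg u) = pair N x (fun v => phi (v * u)%g).
Proof.
move=> inv; rewrite /ev; case: pselect => [h|]; last by case; exists N.
rewrite (projT2 (cid (ev_exists _))); apply: pair_indep; apply: linv_translate => //.
exact: projT2 (cid h).
Qed.

Lemma evD phi z z' : ev phi (z + z') = ev phi z + ev phi z'.
Proof. by rewrite /ev; case: pselect => [h|_]; rewrite ?addr0 // raddfD. Qed.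
Lemma ev0 phi : ev phi 0 = 0.
Proof. by rewrite /ev; case: pselect => [h|_]; rewrite ?raddf0. Qed.
Lemma ev_sum phi (I : Type) (s : seq I) (F : I -> A) :
  ev phi (\sum_(i <- s) F i) = \sum_(i <- s) ev phi (F i).
Proof. exact: (big_morph (ev phi) (evD phi) (ev0 phi)). Qed.
Lemma evN phi z : ev phi (- z) = - ev phi z.
Proof. by apply/eqP; rewrite -addr_eq0 -evD addNr ev0. Qed.
Lemma evB phi z z' : ev phi (z - z') = ev phi z - ev phi z'.
Proof. by rewrite evD evN. Qed.

Lemma pair_single N nu phi : linv N phi -> pair N (single k nu) phi = phi (incl nu).
Proof.
by move=> inv; rewrite /pair cgr_val_single gr_eval_single; apply: (linv_eq inv); exact: quo_repr_proj.
Qed.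

Lemma ev_bg N phi u : linv N phi -> ev phi (bg u) = phi u.
Proof.
move=> inv; rewrite -[bg u]mul1r -(rmorph1 a) -(single1 k KK) (ev_pure _ _ inv).
by rewrite pair_single ?incl1 ?mul1g //; exact: linv_translate.
Qed.

Lemma uniform_linv phi : uniform phi -> exists N, linv N phi.
Proof. by move=> [N []]; exists N. Qed.

Lemma uniform_rtrans phi h : uniform phi -> uniform (fun u => phi (u * h)%g).
Proof.
move=> [N [l r]]; have [N' N'P] := K_conj h^-1%g N; exists (capN N N'); split.
  by move=> nu [Nn _] u; rewrite -mulgA l.
move=> nu [_ /N'P [nu' Nn' nuE]] u.
have -> : (u * incl nu * h = u * h * incl nu')%g by rewrite nuE invgK !mulgA mulgK.
exact: r.
Qed.

Lemma uniform_ltrans phi h : uniform phi -> uniform (fun u => phi (h * u)%g).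
Proof.
move=> [N [l r]]; have [N' N'P] := K_conj h N; exists (capN N N'); split.
  move=> nu [_ /N'P [nu' Nn' nuE]] u.
  have -> : (h * (incl nu * u) = incl nu' * (h * u))%g by rewrite nuE !mulgA mulgVK.
  exact: l.
by move=> nu [Nn _] u; rewrite mulgA r.
Qed.

Lemma uniformM phi psi : uniform phi -> uniform psi -> uniform (fun u => phi u * psi u).
Proof.
move=> [N [l r]] [N' [l' r']]; exists (capN N N').
by split=> nu [Nn N'n] u; rewrite ?l ?l' ?r ?r'.
Qed.

Lemma ev_rmul phi z h : uniform phi -> ev phi (z * bg h) = ev (fun u => phi (u * h)%g) z.
Proof.
move=> /uniform_linv [N inv]; have [s ->] := tsum_all z.
rewrite /tsum mulr_suml !ev_sum; apply: eq_bigr => xg _.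
rewrite -mulrA -bgM (ev_pure _ _ inv) (ev_pure _ _ (linv_translate h inv)).
by congr pair; apply/funext => v; rewrite mulgA.
Qed.

(** Left multiplication by h is continuous on kK although only additivity is known
    of it: kK is the sum of k[K], where both sides can be computed, and of the
    multiples of nu - 1 with nu so small that both sides vanish. *)
Lemma ev_lmul phi z h : uniform phi -> ev phi (bg h * z) = ev (fun u => phi (h * u)%g) z.
Proof.
have base psi x : uniform psi -> ev psi (bg h * a x) = ev (fun u => psi (h * u)%g) (a x).
  move=> psiU; have psiU' := uniform_ltrans h psiU.
  have [N [l r]] := psiU; have [N' [l' r']] := psiU'.
  have [s [t [tN ->]]] := S_gen (capN N N') x.
  rewrite !rmorphD /= !rmorph_sum /= mulrDr !evD !mulr_sumr !ev_sum; congr (_ + _).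
    apply: eq_bigr => ch _; rewrite !linearZ /= -scalerAr.
    have evZ (c : k) (f : G -> k) u : uniform f -> ev f (c *: bg u) = c * ev f (bg u).
      move=> /uniform_linv [N0 inv]; rewrite (ev_bg _ inv).
      rewrite -[bg u]mul1r -(rmorph1 a) -(single1 k KK) scalerAl -linearZ.
      rewrite (ev_pure _ _ inv) /pair cgr_valZ gr_evalZ; congr (_ * _).
      by have := pair_single 1%g (linv_translate u inv); rewrite incl1 mul1g.
    by rewrite a_single -bgM !evZ // (ev_bg _ l) (ev_bg _ l').
  apply: eq_big_seq => yh /tN [Nn N'n]; rewrite !rmorphM rmorphB rmorph1 /= a_single.
  rewrite !mulrBr !mulr1 !evB mulrA !ev_rmul //.
  have -> : (fun u => psi (u * incl yh.2)%g) = psi by apply/funext => u; exact: r.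
  have -> : (fun u => psi (h * (u * incl yh.2))%g) = fun u => psi (h * u)%g.
    by apply/funext => u; exact: r'.
  by rewrite !subrr.
move=> phiU; have [s ->] := tsum_all z.
rewrite /tsum mulr_sumr !ev_sum; apply: eq_bigr => xg _.
rewrite mulrA !ev_rmul //; last exact: uniform_ltrans.
rewrite base; last exact: uniform_rtrans.
by congr (ev _ _); apply/funext => u; rewrite mulgA.
Qed.

Definition rep (u : G) : G := xget 1%g [set v | (K : set G) (v * u^-1)%g].

Lemma rep_in u : (K : set G) (rep u * u^-1)%g.
Proof.
apply: (@xgetPex _ 1%g [set v | (K : set G) (v * u^-1)%g]); exists u => /=.
by rewrite mulgV; exact: subgroup1.
Qed.

Lemma rep_mul nu u : rep (incl nu * u)%g = rep u.
Proof.
congr xget; apply/seteqP; split=> v /=; rewrite invgM mulgA => Kv.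
  by rewrite -(mulgVK (incl nu) (v * u^-1)%g); apply: subgroupM => //; exact: incl_in.
by apply: subgroupM => //; apply: subgroupV; exact: incl_in.
Qed.

Lemma rep_factor u : exists nu, u = (incl nu * rep u)%g.
Proof.
have [nu nuE] := incl_onto (rep_in u); exists nu^-1%g.
by rewrite inclV nuE invgM invgK mulgVK.
Qed.

Lemma rep_rep u : rep (rep u) = rep u.
Proof. by have [nu {2}->] := rep_factor u; rewrite rep_mul. Qed.

Lemma normal_form z : exists (s : seq G) (X : G -> S),
  [/\ uniq s, forall u, u \in s -> rep u = u & z = \sum_(u <- s) a (X u) * bg u].
Proof.
have [t ->] := tsum_all z; elim: t => [|[x u] t [s [X [us srep sE]]]].
  by exists [::], (fun=> 0); rewrite /tsum !big_nil.
pose X' v := (if v \in s then X v else 0) +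
  (if v == rep u then x * single k (projT1 (cid (rep_factor u))) else 0).
have t0_uniq := undup_uniq (rep u :: s); have t0_mem := mem_undup (rep u :: s).
move: (undup _) t0_uniq t0_mem => t0 t0_uniq t0_mem.
exists t0, X'; split => //.
  by move=> v; rewrite t0_mem inE => /predU1P [->|/srep //]; exact: rep_rep.
rewrite /tsum big_cons -/(tsum t) sE /X'.
under [RHS]eq_bigr => v _ do rewrite rmorphD mulrDl.
rewrite big_split /= [LHS]addrC; congr (_ + _).
  rewrite [RHS](bigID (mem s)) /= [X in _ = _ + X]big1 ?addr0; last first.
    by move=> v /negPf ->; rewrite rmorph0 mul0r.
  rewrite -[RHS]big_filter [RHS](eq_big_seq (fun v => a (X v) * bg v)); last first.
    by move=> v; rewrite mem_filter => /andP [/= -> _].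
  apply: perm_big; apply: uniq_perm => //; first by rewrite filter_uniq.
  by move=> v; rewrite mem_filter t0_mem inE; case: (v \in s); rewrite ?orbT.
rewrite (bigD1_seq (rep u)) ?t0_mem ?mem_head //= eqxx.
rewrite big1 ?addr0; last by move=> v /negPf ->; rewrite rmorph0 mul0r.
case: cid => nu /= uE; rewrite rmorphM /= a_single -mulrA -bgM; congr (_ * bg _).
exact: uE.
Qed.

Lemma pair_coef N x nu :
  pair N x (fun u => `[< exists2 nu', (N : set KK) nu' & u = incl (nu' * nu)%g >]%:R) =
  gr_coef (val x N) (quo_proj N nu).
Proof.
rewrite -gr_evalE; apply: eq_gr_eval => C; congr (_%:R); congr nat_of_bool.
apply/asboolP/eqP => [[nu' Nn' /val_inj e]|->].
  rewrite -[LHS]quo_reprK e quo_projMg -[RHS]mul1g; congr (_ * _)%g.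
  by rewrite -quo_proj1; apply/quo_proj_eqP; rewrite mulg1; exact: subgroupV.
exists (quo_repr (quo_proj N nu) * nu^-1)%g; last by rewrite mulgVK.
have := subgroupV (quo_repr_proj N nu); rewrite invgM invgK => /(Defs.normalP nu).
by rewrite mulVKg.
Qed.

(** The indicator of N nu u, which extracts one coefficient of the component of an
    element at the coset K u. *)
Definition slice N nu u : G -> k :=
  fun v => `[< exists2 nu', (N : set KK) nu' & v = (incl (nu' * nu) * u)%g >]%:R.

Lemma slice_uniform N nu u : uniform (slice N nu u).
Proof.
have [N' N'P] := K_conj (incl nu * u)%g N.
exists (capN N N'); split=> mu.
  move=> [Nm _] v; congr (_%:R); congr nat_of_bool; apply/asboolP/asboolP => -[nu' Nn' e].
    exists (mu^-1 * nu')%g; first by apply: subgroupM => //; exact: subgroupV.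
    by rewrite -(mulKg (incl mu) v) e !inclM !mulgA.
  by exists (mu * nu')%g; [exact: subgroupM | rewrite e !inclM !mulgA].
move=> [_ /N'P [mu' Nm' muE]] v; set c := (incl nu * u)%g in muE.
congr (_%:R); congr nat_of_bool; apply/asboolP/asboolP => -[nu' Nn' e].
  exists (nu' * mu'^-1)%g; first by apply: subgroupM => //; exact: subgroupV.
  have vE : v = (incl nu' * (c * (incl mu)^-1))%g.
    by rewrite mulgA [(incl nu' * c)%g]mulgA -inclM -e mulgK.
  have cE (x m : G) : (x * m^-1 = (x * m * x^-1)^-1 * x)%g.
    by rewrite !invgM invgK !mulgA mulgVK.
  by rewrite vE cE -muE /c !inclM inclV !mulgA.
exists (nu' * mu')%g; first exact: subgroupM.
by rewrite e !inclM muE /c !invgM !mulgA !mulgVK.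
Qed.

Lemma slice_coef N nu u (s : seq G) (X : G -> S) : uniq s -> u \in s ->
  (forall v, v \in s -> rep v = v) ->
  ev (slice N nu u) (\sum_(v <- s) a (X v) * bg v) = gr_coef (val (X u) N) (quo_proj N nu).
Proof.
move=> us u_s srep.
have inv : linv N (slice N nu u).
  move=> mu Nm v; congr (_%:R); congr nat_of_bool; apply/asboolP/asboolP => -[nu' Nn' e].
    exists (mu^-1 * nu')%g; first by apply: subgroupM => //; exact: subgroupV.
    by rewrite -(mulKg (incl mu) v) e !inclM !mulgA.
  by exists (mu * nu')%g; [exact: subgroupM | rewrite e !inclM !mulgA].
rewrite ev_sum (bigD1_seq u) //= (ev_pure _ _ inv) [X in _ + X]big_seq_cond big1.
  rewrite addr0 -pair_coef; congr pair; apply/funext => v.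
  congr (_%:R); congr nat_of_bool; apply/asboolP/asboolP => -[nu' Nn' e]; exists nu' => //.
    by rewrite -(mulgK u v) e mulgK.
  by rewrite e.
move=> v /andP [vs vu]; rewrite (ev_pure _ _ inv) /pair.
transitivity (gr_eval (fun=> 0) (val (X v) N)); last first.
  by rewrite /gr_eval big1 // => C _; rewrite mulr0.
apply: eq_gr_eval => C; rewrite /slice; case: asboolP => // -[nu' _ e]; case/eqP: vu.
by rewrite -(srep v vs) -(rep_mul (quo_repr C)) e rep_mul srep.
Qed.

Lemma coef_eq0 x : (forall N nu, gr_coef (val x N) (quo_proj N nu) = 0) -> x = 0.
Proof.
move=> x0; apply: cgr_eq => N; apply: gr_coefP => C; rewrite gr_coef0.
by rewrite -(quo_reprK C).
Qed.

(** Support defined by duality, so that translations on both sides, and products by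
    functions, act on it. *)
Definition supported (D : set G) z : Prop :=
  forall phi, uniform phi -> (forall u, D u -> phi u = 0) -> ev phi z = 0.

(** Outside D, all coefficients are values of slices, and these vanish. *)
Lemma supported_normal_form (D : set G) z : supported D z ->
  (forall nu u, D (incl nu * u)%g -> D u) ->
  exists (s : seq G) (X : G -> S), (forall u, u \in s -> D u) /\
    z = \sum_(u <- s) a (X u) * bg u.
Proof.
move=> zD KD; have [s [X [us srep zE]]] := normal_form z.
exists [seq u <- s | `[< D u >]], X; split.
  by move=> u; rewrite mem_filter => /andP [/asboolP].
rewrite zE big_filter [RHS]big_mkcond; apply: eq_big_seq => u u_s.
case: asboolP => // nDu; rewrite [X u](@coef_eq0 (X u)) ?rmorph0 ?mul0r // => N nu.
rewrite -(slice_coef N nu X us u_s srep) -zE; apply: zD; first exact: slice_uniform.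
move=> v Dv; rewrite /slice; case: asboolP => // -[nu' _ e]; case: nDu.
by apply: (KD (nu' * nu)%g); rewrite -e.
Qed.

(** An element killed by all uniform functions has empty support. *)
Lemma ev_separates z : (forall phi, uniform phi -> ev phi z = 0) -> z = 0.
Proof.
move=> z0; have [||s [X [sD ->]]] := @supported_normal_form set0 z.
- by move=> phi phiU _; exact: z0.
- by [].
- by rewrite big_seq big1 // => u /sD.
Qed.

Lemma supported_sum (D : set G) (s : seq (S * G)) :
  (forall xu, xu \in s -> forall nu, D (incl nu * xu.2)%g) -> supported D (tsum s).
Proof.
move=> sD phi /uniform_linv [N inv] phi0; rewrite /tsum ev_sum big_seq big1 // => xu xus.
rewrite (ev_pure _ _ inv) /pair; transitivity (gr_eval (fun=> 0) (val xu.1 N)).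
  by apply: eq_gr_eval => C; apply: phi0; exact: sD.
by rewrite /gr_eval big1 // => C _; rewrite mulr0.
Qed.

Lemma supportedD (D : set G) z z' : supported D z -> supported D z' -> supported D (z + z').
Proof. by move=> h h' phi phiU phi0; rewrite evD h // h' // addr0. Qed.

Lemma evFB phi psi z : uniform phi -> uniform psi ->
  ev (fun u => phi u - psi u) z = ev phi z - ev psi z.
Proof.
move=> [N [l _]] [N' [l' _]]; have [s ->] := tsum_all z.
have inv : linv (capN N N') phi by apply: linv_mono l; exact: capN_subl.
have inv' : linv (capN N N') psi by apply: linv_mono l'; exact: capN_subr.
have inv'' : linv (capN N N') (fun u => phi u - psi u).
  by move=> nu Nn u; rewrite inv ?inv'.
rewrite /tsum !ev_sum -sumrB; apply: eq_bigr => xu _.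
rewrite (ev_pure _ _ inv) (ev_pure _ _ inv') (ev_pure _ _ inv'') /pair.
apply/eqP; rewrite eq_sym subr_eq -gr_eval_add; apply/eqP.
by apply: eq_gr_eval => C; rewrite subrK.
Qed.

Lemma uniformB phi psi : uniform phi -> uniform psi -> uniform (fun u => phi u - psi u).
Proof.
move=> [N [l r]] [N' [l' r']]; exists (capN N N').
by split=> nu [Nn N'n] u; rewrite ?l ?l' ?r ?r'.
Qed.

Lemma ev_supported (D : set G) phi psi z : uniform phi -> uniform psi -> supported D z ->
  (forall u, D u -> phi u = psi u) -> ev phi z = ev psi z.
Proof.
move=> phiU psiU zD e; apply/eqP; rewrite -subr_eq0 -evFB //; apply/eqP.
by apply: zD; [exact: uniformB | move=> u Du; rewrite e ?subrr].
Qed.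

Lemma ev_fun0 phi z : (forall u, phi u = 0) -> ev phi z = 0.
Proof.
move=> phi0; have [s ->] := tsum_all z.
have inv : linv (whole_open_normal KK) phi by move=> nu _ u; rewrite !phi0.
rewrite /tsum ev_sum big1 // => xu _; rewrite (ev_pure _ _ inv) /pair /gr_eval big1 // => C _.
by rewrite phi0 mulr0.
Qed.

Section Restriction.
Variables (N : open_normal KK) (psi : G -> k).
Hypothesis psi_inv : linv N psi.
Variable x : S.

Let level (M : open_normal KK) : group_ring k (quotient_group M) :=
  geval (fun C : quotient_group (capN M N) =>
    psi (incl (quo_repr C)) *: gr_single k (quo_proj M (quo_repr C))) (val x (capN M N)).

Let gr_map_geval (G1 G2 G3 : groupType) (th : G2 -> G3) (w : G1 -> group_ring k G2)
  (f : group_ring k G1) : gr_map th (geval w f) = geval (gr_map th \o w) f.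
Proof.
rewrite /geval (big_morph (gr_map th) (@gr_mapD k _ _ th) (@gr_map0 k _ _ th)).
by apply: eq_bigr => C _; rewrite gr_mapZ.
Qed.

Let level_compat : cgr_compat level.
Proof.
apply/asboolP => M M' MM'; rewrite /level gr_map_geval.
have sub : (capN M N : set KK) `<=` capN M' N by move=> nu [/MM' ? ?].
rewrite -(cgr_val_mono x sub) geval_map; apply: geval_eq => C /=.
rewrite gr_mapZ gr_map_single quo_mapE //.
have Cn : (capN M' N : set KK) ((quo_repr C)^-1 * quo_repr (quo_map (capN M N) (capN M' N) C))%g.
  by apply/quo_proj_eqP; rewrite quo_reprK -[in RHS](quo_reprK C) quo_mapE.
case: Cn => M'n Nn; rewrite (linv_eq psi_inv Nn); congr (_ *: gr_single k _).
exact/quo_proj_eqP.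
Qed.

(** The product of a measure on K by a locally constant function, level by level. *)
Lemma restriction : exists x' : S, forall (M : open_normal KK) phi, linv M phi ->
  pair M x' phi = pair (capN M N) x (fun u => phi u * psi u).
Proof.
exists (exist _ level level_compat) => M phi inv; rewrite /pair /= /level /geval.
rewrite (big_morph (gr_eval _) (gr_evalD _) (gr_eval0 _)); apply: eq_bigr => C _.
rewrite !gr_evalZ gr_eval_single [phi _ * _]mulrC; congr (_ * (_ * _)).
by apply: (linv_eq inv); exact: quo_repr_proj.
Qed.
End Restriction.

Lemma restrict psi z : uniform psi ->
  exists z', forall phi, uniform phi -> ev phi z' = ev (fun u => phi u * psi u) z.
Proof.
move=> /uniform_linv [N inv]; have [s ->] := tsum_all z.
elim: s => [|[x u] s [z' z'E]]; first by exists 0 => phi _; rewrite /tsum big_nil !ev0.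
have [x' x'E] := restriction (linv_translate u inv) x.
exists (a x' * bg u + z') => phi phiU; have [M inv'] := uniform_linv phiU.
rewrite /tsum big_cons !evD z'E //; congr (_ + _).
rewrite (ev_pure _ _ inv') (x'E M); last exact: linv_translate.
rewrite (@ev_pure (capN M N)) // => nu [Mn Nn] v; by rewrite inv' ?inv.
Qed.

(** The indicators of v D and of D v. *)
Definition lind (D : set G) v : G -> k := fun u => `[< D (v^-1 * u)%g >]%:R.
Definition rind (D : set G) v : G -> k := fun u => `[< D (u * v^-1)%g >]%:R.

Section Cosets.
Variable D : subgroup G.
Hypothesis KD : (K : set G) `<=` D.

Lemma sub_lmul u v : (D : set G) u -> (D : set G) (u * v)%g <-> (D : set G) v.
Proof.
move=> Du; split=> Dv; last exact: subgroupM.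
by rewrite -(mulKg u v); apply: subgroupM => //; exact: subgroupV.
Qed.
Lemma sub_rmul u v : (D : set G) u -> (D : set G) (v * u)%g <-> (D : set G) v.
Proof.
move=> Du; split=> Dv; last exact: subgroupM.
by rewrite -(mulgK u v); apply: subgroupM => //; exact: subgroupV.
Qed.

Lemma incl_sub nu : (D : set G) (incl nu). Proof. by apply: KD; exact: incl_in. Qed.

Lemma lind_uniform v : uniform (lind D v).
Proof.
have [N NP] := K_conj v^-1%g (whole_open_normal KK); exists N; split=> nu Nn u; rewrite /lind;
  congr (_%:R); congr nat_of_bool; apply/asboolP/asboolP.
- have [nu' _ e] := NP nu Nn; have -> : (v^-1 * (incl nu * u) = incl nu' * (v^-1 * u))%g.
    by rewrite e invgK !mulgA mulgK.
  by move/(sub_lmul _ (incl_sub nu')).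
- have [nu' _ e] := NP nu Nn; have -> : (v^-1 * (incl nu * u) = incl nu' * (v^-1 * u))%g.
    by rewrite e invgK !mulgA mulgK.
  by move/(sub_lmul _ (incl_sub nu')).
- by rewrite mulgA => /(sub_rmul _ (incl_sub nu)).
- by rewrite mulgA => /(sub_rmul _ (incl_sub nu)).
Qed.

Lemma rind_uniform v : uniform (rind D v).
Proof.
have [N NP] := K_conj v (whole_open_normal KK); exists N; split=> nu Nn u; rewrite /rind;
  congr (_%:R); congr nat_of_bool; apply/asboolP/asboolP.
- by rewrite -mulgA => /(sub_lmul _ (incl_sub nu)).
- by rewrite -mulgA => /(sub_lmul _ (incl_sub nu)).
- have [nu' _ e] := NP nu Nn; have -> : (u * incl nu * v^-1 = u * v^-1 * incl nu')%g.
    by rewrite e !mulgA mulgVK.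
  by move/(sub_rmul _ (incl_sub nu')).
- have [nu' _ e] := NP nu Nn; have -> : (u * incl nu * v^-1 = u * v^-1 * incl nu')%g.
    by rewrite e !mulgA mulgVK.
  by move/(sub_rmul _ (incl_sub nu')).
Qed.

Lemma left_piece v z : exists2 y, supported D y &
  forall phi, uniform phi -> ev phi (bg v * y) = ev (fun u => phi u * lind D v u) z.
Proof.
have [z' z'E] := restrict z (lind_uniform v); exists (bg v^-1%g * z').
  move=> phi phiU phi0; rewrite ev_lmul // z'E; last exact: uniform_ltrans.
  apply: ev_fun0 => u; rewrite /lind; case: asboolP => [/phi0 ->|_]; first by rewrite mul0r.
  by rewrite mulr0.
by move=> phi phiU; rewrite mulrA bgVr mul1r z'E.
Qed.

Lemma right_piece v z : exists2 y, supported D y &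
  forall phi, uniform phi -> ev phi (y * bg v) = ev (fun u => phi u * rind D v u) z.
Proof.
have [z' z'E] := restrict z (rind_uniform v); exists (z' * bg v^-1%g).
  move=> phi phiU phi0; rewrite ev_rmul // z'E; last exact: uniform_rtrans.
  apply: ev_fun0 => u; rewrite /rind; case: asboolP => [/phi0 ->|_]; first by rewrite mul0r.
  by rewrite mulr0.
by move=> phi phiU; rewrite -mulrA bgV mulr1 z'E.
Qed.

Definition lcover (vs : seq G) : set G := [set u | exists2 v, v \in vs & (D : set G) (v^-1 * u)%g].
Definition rcover (vs : seq G) : set G := [set u | exists2 v, v \in vs & (D : set G) (u * v^-1)%g].

(** Together with left_independent: A is free over its part supported on D, with
    coset representatives as a basis. The components are products by indicators of
    cosets. *)
Lemma left_decomposition (vs : seq G) z : supported (lcover vs) z ->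
  exists y : nat -> A, (forall i, supported D (y i)) /\
    z = \sum_(i < size vs) bg (nth 1%g vs i) * y i.
Proof.
elim: vs z => [|v vs IH] z zD.
  exists (fun=> 0); split; first by move=> _ phi _ _; rewrite ev0.
  by rewrite big_ord0; apply: ev_separates => phi phiU; apply: zD => // u [].
have [y0 y0D y0E] := left_piece v z.
have [|y [yD yE]] := IH (z - bg v * y0).
  move=> phi phiU phi0; have phiU' := uniformM phiU (lind_uniform v).
  rewrite evB y0E // -evFB //; apply: zD => [|u [w]]; first exact: uniformB.
  rewrite inE => /predU1P [->|wvs] Dwu; rewrite /lind.
    by rewrite asboolT // mulr1 subrr.
  by rewrite phi0 ?mul0r ?subrr //; exists w.
exists (fun i => if i is j.+1 then y j else y0); split; first by case.
by rewrite /= big_ord_recl /= -yE addrC subrK.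
Qed.

Lemma right_decomposition (vs : seq G) z : supported (rcover vs) z ->
  exists y : nat -> A, (forall i, supported D (y i)) /\
    z = \sum_(i < size vs) y i * bg (nth 1%g vs i).
Proof.
elim: vs z => [|v vs IH] z zD.
  exists (fun=> 0); split; first by move=> _ phi _ _; rewrite ev0.
  by rewrite big_ord0; apply: ev_separates => phi phiU; apply: zD => // u [].
have [y0 y0D y0E] := right_piece v z.
have [|y [yD yE]] := IH (z - y0 * bg v).
  move=> phi phiU phi0; have phiU' := uniformM phiU (rind_uniform v).
  rewrite evB y0E // -evFB //; apply: zD => [|u [w]]; first exact: uniformB.
  rewrite inE => /predU1P [->|wvs] Dwu; rewrite /rind.
    by rewrite asboolT // mulr1 subrr.
  by rewrite phi0 ?mul0r ?subrr //; exists w.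
exists (fun i => if i is j.+1 then y j else y0); split; first by case.
by rewrite /= big_ord_recl /= -yE addrC subrK.
Qed.

Lemma left_independent (vs : seq G) (y : 'I_(size vs) -> A) :
  (forall i j : 'I_(size vs), (D : set G) ((nth 1 vs i)^-1 * nth 1 vs j)%g -> i = j) ->
  (forall i, supported D (y i)) ->
  \sum_(i < size vs) bg (nth 1%g vs i) * y i = 0 -> forall i, y i = 0.
Proof.
move=> vs_dist yD y0 j; apply: ev_separates => phi phiU.
set vj := nth 1%g vs j.
pose phi' u := phi (vj^-1 * u)%g * lind D vj u.
have phi'U : uniform phi'.
  by apply: uniformM; [exact: uniform_ltrans | exact: lind_uniform].
have := ev0 phi'; rewrite -y0 ev_sum (bigD1 j) //= big1 ?addr0 => [<-|i ij].
  rewrite ev_lmul //; apply: (ev_supported _ _ (yD j)) => //; first exact: uniform_ltrans.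
  by move=> u Du; rewrite /phi' /lind mulKg asboolT ?mulr1.
rewrite ev_lmul //; apply: (yD i) => [|u Du]; first exact: uniform_ltrans.
rewrite /phi' /lind; case: asboolP; rewrite ?mulr0 // mulgA => /(sub_rmul _ Du) h.
by case/eqP: ij; apply/esym/vs_dist.
Qed.

Lemma right_independent (vs : seq G) (y : 'I_(size vs) -> A) :
  (forall i j : 'I_(size vs), (D : set G) (nth 1 vs i * (nth 1 vs j)^-1)%g -> i = j) ->
  (forall i, supported D (y i)) ->
  \sum_(i < size vs) y i * bg (nth 1%g vs i) = 0 -> forall i, y i = 0.
Proof.
move=> vs_dist yD y0 j; apply: ev_separates => phi phiU.
set vj := nth 1%g vs j.
pose phi' u := phi (u * vj^-1)%g * rind D vj u.
have phi'U : uniform phi'.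
  by apply: uniformM; [exact: uniform_rtrans | exact: rind_uniform].
have := ev0 phi'; rewrite -y0 ev_sum (bigD1 j) //= big1 ?addr0 => [<-|i ij].
  rewrite ev_rmul //; apply: (ev_supported _ _ (yD j)) => //; first exact: uniform_rtrans.
  by move=> u Du; rewrite /phi' /rind mulgK asboolT ?mulr1.
rewrite ev_rmul //; apply: (yD i) => [|u Du]; first exact: uniform_rtrans.
rewrite /phi' /rind; case: asboolP; rewrite ?mulr0 // -mulgA => /(sub_lmul _ Du) h.
by case/eqP: ij; apply/vs_dist.
Qed.

Lemma left_distinct (us : seq G) : exists vs : seq G, [/\ {subset vs <= us},
    forall u, u \in us -> lcover vs u &
    forall i j, (i < size vs)%N -> (j < size vs)%N ->
      (D : set G) ((nth 1 vs i)^-1 * nth 1 vs j)%g -> i = j].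
Proof.
elim: us => [|u us [vs [vs_us cov dist]]]; first by exists [::].
have [uc|nuc] := pselect (lcover vs u).
  exists vs; split => //; first by move=> v /vs_us; rewrite inE orbC => ->.
  by move=> v; rewrite inE => /predU1P [->|/cov].
exists (u :: vs); split.
- by move=> v; rewrite !inE => /predU1P [->|/vs_us ->]; rewrite ?eqxx ?orbT.
- move=> v; rewrite inE => /predU1P [->|/cov [w wvs Dw]].
    by exists u; rewrite ?mem_head // mulVg; exact: subgroup1.
  by exists w; rewrite // inE wvs orbT.
- case=> [|i] [|j] //=; rewrite ?ltnS => ivs jvs Dij.
  + case: nuc; exists (nth 1%g vs j); first exact: mem_nth.
    by rewrite -(invgK u) -invgM; exact: subgroupV.
  + by case: nuc; exists (nth 1%g vs i); first exact: mem_nth.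
  + by congr _.+1; exact: dist.
Qed.

Lemma right_distinct (us : seq G) : exists vs : seq G, [/\ {subset vs <= us},
    forall u, u \in us -> rcover vs u &
    forall i j, (i < size vs)%N -> (j < size vs)%N ->
      (D : set G) (nth 1 vs i * (nth 1 vs j)^-1)%g -> i = j].
Proof.
elim: us => [|u us [vs [vs_us cov dist]]]; first by exists [::].
have [uc|nuc] := pselect (rcover vs u).
  exists vs; split => //; first by move=> v /vs_us; rewrite inE orbC => ->.
  by move=> v; rewrite inE => /predU1P [->|/cov].
exists (u :: vs); split.
- by move=> v; rewrite !inE => /predU1P [->|/vs_us ->]; rewrite ?eqxx ?orbT.
- move=> v; rewrite inE => /predU1P [->|/cov [w wvs Dw]].
    by exists u; rewrite ?mem_head // mulgV; exact: subgroup1.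
  by exists w; rewrite // inE wvs orbT.
- case=> [|i] [|j] //=; rewrite ?ltnS => ivs jvs Dij.
  + by case: nuc; exists (nth 1%g vs j); first exact: mem_nth.
  + case: nuc; exists (nth 1%g vs i); first exact: mem_nth.
    by rewrite -(invgK u) -invgM; exact: subgroupV.
  + by congr _.+1; exact: dist.
Qed.

Lemma left_cover_tsum (s : seq (S * G)) : exists us : seq G,
  forall vs, (forall u, u \in us -> lcover vs u) -> supported (lcover vs) (tsum s).
Proof.
have one u : exists us : seq G, forall nu, exists2 w, w \in us & (D : set G) (w^-1 * (incl nu * u))%g.
  have [N NP] := K_conj u^-1%g (whole_open_normal KK); have [t tP] := K_fin N.
  exists [seq (incl nu * u)%g | nu <- t] => nu; have [mu mut Nmu] := tP nu.
  exists (incl mu * u)%g; first exact: map_f.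
  have [nu' _ e] := NP _ Nmu; rewrite inclM inclV invgK !mulgA in e.
  by rewrite invgM !mulgA -e; exact: incl_sub.
have [us usP] : exists us : seq G, forall xu, xu \in s -> forall nu,
    exists2 w, w \in us & (D : set G) (w^-1 * (incl nu * xu.2))%g.
  elim: s => [|xu s [us usP]]; first by exists [::].
  have [us' us'P] := one xu.2; exists (us' ++ us) => yv; rewrite inE => /predU1P [->|/usP h] nu.
    by have [w wus Dw] := us'P nu; exists w; rewrite // mem_cat wus.
  by have [w wus Dw] := h nu; exists w; rewrite // mem_cat wus orbT.
exists us => vs cov; apply: supported_sum => xu xus nu.
have [w /cov [v vvs Dvw] Dw] := usP xu xus nu; exists v => //.
by rewrite -(mulgK w v^-1%g) -mulgA; exact: subgroupM.
Qed.

Lemma right_cover_tsum (s : seq (S * G)) : exists us : seq G,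
  forall vs, (forall u, u \in us -> rcover vs u) -> supported (rcover vs) (tsum s).
Proof.
exists [seq xu.2 | xu <- s] => vs cov; apply: supported_sum => xu xus nu.
have [v vvs Dv] := cov xu.2 (map_f _ xus); exists v => //.
by rewrite -mulgA; apply: subgroupM => //; exact: incl_sub.
Qed.

End Cosets.
Lemma supported_K z : supported K z -> exists x, z = a x.
Proof.
move=> /supported_normal_form []; first by move=> nu u /(sub_lmul _ (incl_in nu)).
move=> s [X [sK ->]]; elim: s sK => [|u s IH] sK; first by exists 0; rewrite big_nil rmorph0.
have [|x xE] := IH; first by move=> v vs; apply: sK; rewrite inE vs orbT.
have [nu nuE] := incl_onto (sK u (mem_head _ _)).
by exists (X u * single k nu + x); rewrite big_cons xE rmorphD rmorphM /= a_single nuE.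
Qed.

Section Piece.
Variable K' : subgroup G.
Hypothesis KK' : (K : set G) `<=` K'.

Lemma supported0 (E : set G) : supported E 0.
Proof. by move=> phi _ _; rewrite ev0. Qed.

Lemma supported_pure x u : (K' : set G) u -> supported K' (a x * bg u).
Proof.
move=> K'u; have -> : a x * bg u = tsum [:: (x, u)] by rewrite /tsum big_seq1.
apply: supported_sum => _ /predU1P [->|//] nu; apply: subgroupM => //.
exact: incl_sub.
Qed.

Lemma supported_sub_normal_form z : supported K' z -> exists (s : seq G) (X : G -> S),
  (forall u, u \in s -> (K' : set G) u) /\ z = \sum_(u <- s) a (X u) * bg u.
Proof.
move=> zK'; apply: supported_normal_form => // nu u.
by move/(sub_lmul _ (incl_sub KK' nu)).
Qed.

Lemma supported_a x : supported K' (a x).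
Proof. by rewrite -[a x]mulr1 -bg1; apply: supported_pure; exact: subgroup1. Qed.

Lemma supported_bg u : (K' : set G) u -> supported K' (bg u).
Proof. by move=> K'u; rewrite -[bg u]mul1r -(rmorph1 a); exact: supported_pure. Qed.

Lemma supported_mul z z' : supported K' z -> supported K' z' -> supported K' (z * z').
Proof.
move=> /supported_sub_normal_form [s [X [sK' ->]]] z'K'; rewrite mulr_suml big_seq.
elim/big_ind: _ => [||u us]; [exact: supported0 | exact: supportedD|]; rewrite -mulrA.
have : supported K' (bg u * z').
  move=> phi phiU phi0; rewrite ev_lmul //; apply: z'K'; first exact: uniform_ltrans.
  by move=> v K'v; apply: phi0; apply: subgroupM => //; exact: sK'.
move=> /supported_sub_normal_form [t [Y [tK' ->]]]; rewrite mulr_sumr big_seq.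
elim/big_ind: _ => [||v vt]; [exact: supported0 | exact: supportedD|].
by rewrite mulrA -rmorphM; apply: supported_pure; exact: tK'.
Qed.

Variable l : seq G.
Hypothesis lK' : forall u, u \in l -> (K' : set G) u.
Hypothesis l_cover : forall u, (K' : set G) u -> exists2 v, v \in l & (K : set G) (u * v^-1)%g.

Lemma piece_left_fg : exists2 e : seq A, forall z, z \in e -> supported K' z &
  forall z, supported K' z -> exists c : 'I_(size e) -> S, z = \sum_(i < size e) a (c i) * e`_i.
Proof.
exists (map bg l); first by move=> _ /mapP [u ul ->]; apply: supported_bg; exact: lK'.
move=> z /supported_sub_normal_form [s [X [sK' ->]]]; rewrite big_seq.
elim/big_ind: _ => [|_ _ [c ->] [c' ->]|u us].
- by exists (fun=> 0); rewrite big1 // => i _; rewrite rmorph0 mul0r.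
- exists (fun i => c i + c' i); rewrite -big_split; apply: eq_bigr => i _.
  by rewrite rmorphD mulrDl.
have [y yl /incl_onto [nu nuE]] := l_cover (sK' u us).
have il : (index y l < size (map bg l))%N by rewrite size_map index_mem.
exists (fun i => if i == Ordinal il then X u * single k nu else 0).
rewrite (bigD1 (Ordinal il)) //= eqxx big1 ?addr0 => [|i /negPf ->]; last by rewrite rmorph0 mul0r.
rewrite (nth_map 1%g) ?index_mem // nth_index // rmorphM /= a_single nuE -mulrA -bgM.
by rewrite mulgVK.
Qed.

(** The covering of K' by cosets K v gives one by cosets v K after inversion, and
    the decomposition along D = K applies. *)
Lemma piece_right_fg : exists2 e : seq A, forall z, z \in e -> supported K' z &
  forall z, supported K' z -> exists c : 'I_(size e) -> S, z = \sum_(i < size e) e`_i * a (c i).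
Proof.
have [vs [vs_l cov _]] := left_distinct K [seq u^-1%g | u <- l].
have vsK' v : v \in vs -> (K' : set G) v.
  by move=> /vs_l /mapP [y yl ->]; apply: subgroupV; exact: lK'.
exists (map bg vs); first by move=> _ /mapP [u ul ->]; apply: supported_bg; exact: vsK'.
move=> z zK'; have [|y [yK zE]] := @left_decomposition K (@subset_refl _ _) vs z.
  move=> phi phiU phi0; apply: zK' => // u K'u; apply: phi0.
  have [w wl Kw] := l_cover (subgroupV K'u).
  have /cov [v vvs Kv] : w^-1%g \in [seq u^-1%g | u <- l] by exact: map_f.
  exists v => //; have -> : (v^-1 * u = (v^-1 * w^-1) * (u^-1 * w^-1)^-1)%g.
    by rewrite invgM !invgK !mulgA mulgVK.
  by apply: subgroupM => //; exact: subgroupV.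
have /choice [x xE] := fun i => supported_K (yK i).
exists (fun i => x i); rewrite zE.
transitivity (\sum_(0 <= i < size (map bg vs)) (map bg vs)`_i * a (x i)).
  rewrite size_map big_mkord; apply: eq_bigr => i _.
  by rewrite xE (nth_map 1%g).
by rewrite big_mkord.
Qed.

End Piece.

Lemma finite_cover n (c : 'I_n -> A) (cover : seq G -> set G) :
  (forall s : seq (S * G), exists us : seq G, forall vs, (forall u, u \in us -> cover vs u) ->
     supported (cover vs) (tsum s)) ->
  exists us : seq G, forall vs, (forall u, u \in us -> cover vs u) ->
    forall i, supported (cover vs) (c i).
Proof.
move=> h; have /choice [t tE] := fun i => tsum_all (c i).
have /choice [us usP] := fun i => h (t i).
exists (flatten [seq us i | i <- enum 'I_n]) => vs cov i; rewrite tE; apply: usP => u ui.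
by apply: cov; apply/flattenP; exists (us i) => //; apply: map_f; rewrite mem_enum.
Qed.

Lemma family_piece n (c : 'I_n -> A) : exists K' : subgroup G,
  [/\ (K : set G) `<=` K', forall i, supported K' (c i) &
    exists2 l : seq G, forall u, u \in l -> (K' : set G) u &
      forall u, (K' : set G) u -> exists2 v, v \in l & (K : set G) (u * v^-1)%g].
Proof.
have /choice [t tE] := fun i => tsum_all (c i).
have [K' [KK' sK' lP]] := G_union (flatten [seq [seq xu.2 | xu <- t i] | i <- enum 'I_n]).
exists K'; split => // i; rewrite tE; apply: supported_sum => xu xui nu.
apply: subgroupM; first exact: incl_sub.
apply: sK'; apply/flattenP; exists [seq xu.2 | xu <- t i]; last exact: map_f.
by apply/mapP; exists i => //; rewrite mem_enum.
Qed.

Theorem augmented_left_coherent : left_coherent A.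
Proof.
apply: (coherent_of_noetherian_pieces (f := a) S_left) => n c.
have [K' [KK' cK' [l lK' l_cov]]] := family_piece c.
exists (supported K'); split.
- exact: cK'.
- split; [exact: supported0 | exact: supportedD | exact: supported_mul | exact: supported_a].
- exact: piece_left_fg l_cov.
move=> d; have [us usP] := finite_cover d (left_cover_tsum KK').
have [vs [_ cov dist]] := left_distinct K' us.
have /choice [y yP] := fun i => left_decomposition KK' (usP vs cov i).
exists (size vs), (fun j => bg (nth 1%g vs j)), (fun j i => y i j); split.
- by move=> j i; have [] := yP i.
- by move=> i; have [_] := yP i.
- move=> z zK' z0; apply: (left_independent KK' _ zK' z0) => i j Dij.
  by apply: val_inj; apply: (dist _ _ (ltn_ord i) (ltn_ord j) Dij).
Qed.

Theorem augmented_right_coherent : left_coherent A^c.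
Proof.
have [ac acE] : exists ac : {rmorphism S^c -> A^c}, forall x : S, ac x = a x.
  pose f : S^c -> A^c := a.
  have fB : zmod_morphism f by move=> x y; exact: (rmorphB a x y).
  have fM : monoid_morphism f by split; [exact: (rmorph1 a) | move=> x y; exact: (rmorphM a y x)].
  pose fA := GRing.isZmodMorphism.Build S^c A^c f fB.
  pose fR := GRing.isMonoidMorphism.Build S^c A^c f fM.
  pose g : {rmorphism S^c -> A^c} := HB.pack f fA fR.
  by exists g.
apply: (coherent_of_noetherian_pieces (f := ac) S_right) => n c.
have [K' [KK' cK' [l lK' l_cov]]] := family_piece c.
exists (supported K'); split.
- exact: cK'.
- split; [exact: supported0 | exact: supportedD | |].
    by move=> x y xK' yK'; exact: (supported_mul KK' yK' xK').
  by move=> s; rewrite acE; exact: supported_a.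
- have [e eK' espan] := piece_right_fg KK' lK' l_cov; exists e => // z /espan [d zE].
  by exists d; rewrite [LHS]zE; apply: eq_bigr => i _; rewrite acE.
move=> d; have [us usP] := finite_cover d (right_cover_tsum KK').
have [vs [_ cov dist]] := right_distinct K' us.
have /choice [y yP] := fun i => right_decomposition KK' (usP vs cov i).
exists (size vs), (fun j => bg (nth 1%g vs j)), (fun j i => y i j); split.
- by move=> j i; have [] := yP i.
- by move=> i; have [_] := yP i.
- move=> z zK' z0; apply: (right_independent KK' _ zK' z0) => i j Dij.
  by apply: val_inj; apply: (dist _ _ (ltn_ord i) (ltn_ord j) Dij).
Qed.

End Augmented.

(** * Integers and divisibility in a p-adic field *)

Section PadicIntegerArithmetic.
Variables (p : nat) (p_pr : prime p).
Notation ZP := (Defs.Zp p_pr).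
Implicit Types x y u : ZP.

Let pn_gt1 m : (1 < p ^ m.+1)%N.
Proof. by rewrite -(exp1n m.+1) ltn_exp2r // prime_gt1. Qed.

Definition digit x m : nat := (val x m : 'Z_(p ^ m.+1)).

Lemma digit_compat x m : (digit x m.+1 = digit x m %[mod p ^ m.+1])%N.
Proof.
have /asboolP/(_ m)/(congr1 (@nat_of_ord _)) := valP x.
by rewrite val_Zp_nat // => e; rewrite /digit -e modn_mod.
Qed.

Lemma digit_natr x m : (digit x m)%:R = val x m.
Proof. exact: natr_Zp. Qed.

Lemma natr_eq m a b : (a%:R == b%:R :> 'Z_(p ^ m.+1)) = (a == b %[mod p ^ m.+1])%N.
Proof. by rewrite -val_eqE /= !val_Zp_nat. Qed.

Lemma Zp_ext x y : (forall m, val x m = val y m) -> x = y.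
Proof. by move=> xy; apply: val_inj; apply: functional_extensionality_dep. Qed.

Lemma Zp_build (a : nat -> nat) : (forall m, a m.+1 = a m %[mod p ^ m.+1])%N ->
  exists x : ZP, forall m, val x m = (a m)%:R.
Proof.
move=> ac; have P : padic_compat (fun m => (a m)%:R : 'Z_(p ^ m.+1)).
  apply/asboolP => m; apply/eqP; rewrite natr_eq val_Zp_nat //.
  by rewrite modn_dvdm ?dvdn_exp2l // -ac.
by exists (@exist _ (fun x : forall m, 'Z_(p ^ m.+1) => padic_compat x) _ P).
Qed.

Lemma Zp_valM x y m : val (x * y) m = val x m * val y m. Proof. by []. Qed.
Lemma Zp_valB x y m : val (x - y) m = val x m - val y m. Proof. by []. Qed.

Lemma val_Zp_natr (c m : nat) : val (c%:R : ZP) m = c%:R.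
Proof. by elim: c => [//|c IH]; rewrite !mulrS -IH. Qed.

Lemma Zp_div_p x : val x 0%N = 0 -> exists y, x = p%:R * y.
Proof.
move=> x0; have p0 := prime_gt0 p_pr.
have dvd m : (p %| digit x m)%N.
  elim: m => [|m IH]; first by rewrite /digit x0 dvdn0.
  rewrite /dvdn -(modn_dvdm (digit x m.+1) (dvdn_exp2l p (ltn0Sn m))).
  by rewrite digit_compat modn_dvdm ?dvdn_exp2l.
have [|y yE] := @Zp_build (fun m => digit x m.+1 %/ p)%N.
  move=> m; apply/eqP; have /eqP := digit_compat x m.+1.
  by rewrite -{1}(divnK (dvd m.+2)) -{1}(divnK (dvd m.+1)) expnSr -!muln_modl // eqn_pmul2r.
exists y; apply: Zp_ext => m; rewrite Zp_valM val_Zp_natr yE -natrM mulnC divnK // -digit_natr; apply/eqP.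
by rewrite eq_sym natr_eq digit_compat.
Qed.

Lemma Zp_approx x m : exists (b : nat) y, x = b%:R + p%:R ^+ m * y.
Proof.
elim: m => [|m [b [y ->]]]; first by exists 0%N, x; rewrite add0r mul1r.
have [|z zE] := @Zp_div_p (y - (digit y 0)%:R).
  by rewrite Zp_valB val_Zp_natr digit_natr subrr.
exists (b + p ^ m * digit y 0)%N, z.
rewrite exprSr -mulrA -zE natrD natrM natrX -addrA; congr (_ + _).
by rewrite -mulrDr addrC subrK.
Qed.

Lemma p_not_unit y : p%:R * y <> 1.
Proof.
move=> e; have : val (p%:R * y) 0%N = 1 by rewrite e.
rewrite Zp_valM val_Zp_natr -digit_natr -natrM.
move/eqP; rewrite -[1]/(1%:R) natr_eq => /eqP e1.
have : (p * digit y 0 %% p = 1 %% p)%N by rewrite -(modn_dvdm _ (dvdn_exp2l p (ltn0Sn 0))) e1 modn_dvdm.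
by rewrite modnMr modn_small // prime_gt1.
Qed.

(** The inverses of the digits are coherent. *)
Lemma Zp_unit_inv u : (forall y, u <> p%:R * y) -> exists v, v * u = 1.
Proof.
move=> nu; have u0 : val u 0%N != 0 by apply/eqP => /Zp_div_p [y]; exact: nu.
have cop m : coprime (p ^ m.+1) (digit u m).
  rewrite coprimeXl // prime_coprime //; apply: contra u0 => pd.
  rewrite -digit_natr -[0]/(0%:R) natr_eq mod0n expn1.
  elim: m pd => [//|m IH] pd; apply: IH.
  rewrite /dvdn -(modn_dvdm (digit u m) (dvdn_exp2l p (ltn0Sn m))).
  by rewrite -digit_compat modn_dvdm ?dvdn_exp2l.
have unit_m m : val u m \is a GRing.unit by rewrite -digit_natr unitZpE.
have [|v vE] := @Zp_build (fun m => (val u m)^-1 : nat).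
  move=> m; apply/eqP; rewrite -natr_eq natr_Zp.
  apply/eqP/(mulIr (unit_m m)); rewrite (mulVr (unit_m m)) -(digit_natr u m) -natrM.
  apply/eqP; rewrite -[1]/(1%:R) natr_eq.
  have /eqP : (((val u m.+1)^-1 : nat)%:R * (digit u m.+1)%:R : 'Z_(p ^ m.+2)) = 1%:R.
    by rewrite natr_Zp digit_natr (mulVr (unit_m _)).
  rewrite -natrM natr_eq => /eqP e.
  rewrite -(modnMmr _ (digit u m)) -digit_compat modnMmr.
  have dv : (p ^ m.+1 %| p ^ m.+2)%N by rewrite dvdn_exp2l.
  by rewrite -(modn_dvdm _ dv) e modn_dvdm.
exists v; apply: Zp_ext => m; rewrite Zp_valM.
by rewrite vE natr_Zp (mulVr (unit_m m)).
Qed.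

Lemma p_neq0 : (p%:R : ZP) != 0.
Proof.
apply/eqP => p0; have : val (p%:R : ZP) 1%N = 0 by rewrite p0.
rewrite val_Zp_natr => /eqP; rewrite -[0]/(0%:R) natr_eq mod0n modn_small ?expn_eq0.
  by rewrite gtn_eqF // prime_gt0.
by rewrite -{1}(expn1 p) ltn_exp2l // prime_gt1.
Qed.

Lemma Zp_eq0 x : (forall m, exists y, x = p%:R ^+ m * y) -> x = 0.
Proof.
move=> xd; apply: Zp_ext => m; have [y ->] := xd m.+1.
rewrite -natrX Zp_valM val_Zp_natr.
have -> : (p ^ m.+1)%:R = 0 :> 'Z_(p ^ m.+1).
  by apply/eqP; rewrite -[0]/(0%:R) natr_eq modnn mod0n.
by rewrite mul0r.
Qed.

Lemma Zp_factor x : x != 0 -> exists e u v, x = p%:R ^+ e * u /\ v * u = 1.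
Proof.
move=> x0; apply: contrapT => nf.
case/eqP: x0; apply: Zp_eq0; elim=> [|m [y xE]]; first by exists x; rewrite mul1r.
have [[z yE]|ny] := pselect (exists z, y = p%:R * z).
  by exists z; rewrite exprSr -mulrA -yE.
case: nf; have [|v vy] := @Zp_unit_inv y; last by exists m, y, v.
by move=> z yz; apply: ny; exists z.
Qed.

Lemma Zp_primitive (I : finType) (c : I -> ZP) : (exists i, c i != 0) ->
  exists e (d : I -> ZP), (forall i, c i = p%:R ^+ e * d i) /\
    exists i, forall y, d i <> p%:R * y.
Proof.
move=> [i0 ci0]; apply: contrapT => nf; case/eqP: ci0; apply: Zp_eq0 => m.
suff: exists d : I -> ZP, forall i, c i = p%:R ^+ m * d i by move=> [d dE]; exists (d i0).
elim: m => [|m [d dE]]; first by exists c => i; rewrite mul1r.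
have /choice [d' d'E] : forall i, exists y, d i = p%:R * y.
  move=> i; apply: contrapT => ndi; apply: nf; exists m, d; split => //.
  by exists i => y dy; apply: ndi; exists y.
by exists d' => i; rewrite exprSr -mulrA -d'E.
Qed.

End PadicIntegerArithmetic.

Lemma fraction_div (R : idomainType) (x : {fraction R}) :
  exists a b : R, b != 0 /\ x * tofrac b = tofrac a.
Proof.
elim/quotW: x => r; exists (frac r).1, (frac r).2; split; first exact: denom_ratioP.
unlock FracField.tofrac; rewrite -[LHS]FracField.pi_mul; apply/eqmodP => /=.
by rewrite /FracField.equivf /FracField.mulf !numden_Ratio ?mulf_neq0 ?oner_eq0 ?denom_ratioP // ?mulr1 mulrC.
Qed.

Section PadicField.
Variables (p : nat) (p_pr : prime p) (F : fieldExtType (Qp p_pr)).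
Notation ZP := (Defs.Zp p_pr).
Notation iota := (@Zp_to_ext p p_pr F).

Definition toF : ZP -> F := in_alg F \o @tofrac ZP.
HB.instance Definition _ := GRing.RMorphism.on toF.

Definition integer (z : F) : Prop := padic_integer z.

Lemma integerE z : integer z <-> integralOver toF z. Proof. by []. Qed.
Lemma integerD x y : integer x -> integer y -> integer (x + y).
Proof. exact: (integral_add (RtoK := toF)). Qed.
Lemma integerB x y : integer x -> integer y -> integer (x - y).
Proof. exact: (integral_sub (RtoK := toF)). Qed.
Lemma integerM x y : integer x -> integer y -> integer (x * y).
Proof. exact: (integral_mul (RtoK := toF)). Qed.
Lemma integer_nat m : integer m%:R.
Proof. exact: (integral_nat toF). Qed.
Lemma integer0 : integer 0. Proof. exact: (integer_nat 0). Qed.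
Lemma integer1 : integer 1. Proof. exact: (integer_nat 1). Qed.
Lemma integer_toF x : integer (toF x).
Proof. exact: (integral_id toF). Qed.
Lemma integerX x m : integer x -> integer (x ^+ m).
Proof. by move=> xI; elim: m => [|m IH]; rewrite ?expr0 ?exprS; [exact: integer1|exact: integerM]. Qed.
Lemma integer_sum (I : Type) (s : seq I) (P : pred I) (f : I -> F) :
  (forall i, P i -> integer (f i)) -> integer (\sum_(i <- s | P i) f i).
Proof. by move=> h; elim/big_ind: _ => //; [exact: integer0 | exact: integerD]. Qed.

Lemma toF_eq0 x : (toF x == 0) = (x == 0).
Proof. by rewrite /toF /= scaler_eq0 oner_eq0 orbF tofrac_eq0. Qed.

Lemma pF_neq0 : (p%:R : F) != 0.
Proof. by rewrite -(rmorph_nat toF) toF_eq0; exact: p_neq0. Qed.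

Definition pdvd (m : nat) (w : F) : Prop := exists2 z, integer z & w = p%:R ^+ m * z.

(** Denominators are cleared, then the largest common power of p is removed. *)
Lemma Zp_dependency (V : vectType (Qp p_pr)) m (v : 'I_m -> V) :
  (\dim {: V} < m)%N -> exists c : 'I_m -> ZP,
    (exists i, forall y, c i <> p%:R * y) /\ \sum_i tofrac (c i) *: v i = 0.
Proof.
move=> dm; pose X := [tuple v i | i < m].
have : ~~ free X.
  apply/negP; rewrite /free size_tuple => /eqP fX.
  by have := dimvS (subvf <<X>>%VS); rewrite fX leqNgt dm.
move=> /freeP nfree.
have [q [q0 [i0 qi0]]] : exists q : 'I_m -> Qp p_pr,
    \sum_i q i *: v i = 0 /\ exists i, q i != 0.
  apply: contrapT => nex; apply: nfree => q q0 i; apply: contrapT => /eqP qi.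
  apply: nex; exists q; split; last by exists i.
  by rewrite -[RHS]q0; apply: eq_bigr => j _; rewrite -tnth_nth tnth_mktuple.
have /choice [b bP] : forall i, exists b : ZP, b != 0 /\ exists a, q i * tofrac b = tofrac a.
  by move=> i; have [a [b [b0 e]]] := fraction_div (q i); exists b; split => //; exists a.
have /choice [a aE] : forall i, exists a, q i * tofrac (\prod_j b j) = tofrac a.
  move=> i; have [_ [a ae]] := bP i; exists (a * \prod_(j | j != i) b j).
  by rewrite (bigD1 i) //= !rmorphM /= mulrA ae.
have D0 : tofrac (\prod_j b j) != 0.
  by rewrite tofrac_eq0; apply/prodf_neq0 => j _; have [] := bP j.
have [|e [c [ac [i1 ci1]]]] := @Zp_primitive p p_pr _ a.
  exists i0; apply/eqP => ai0; have /eqP := aE i0.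
  by rewrite ai0 rmorph0 mulf_eq0 (negPf qi0) (negPf D0).
exists c; split; first by exists i1.
have pe0 : tofrac (p%:R ^+ e : ZP) != 0 by rewrite tofrac_eq0 expf_neq0 // p_neq0.
apply: (scalerI pe0); rewrite scaler0 scaler_sumr.
transitivity (tofrac (\prod_j b j) *: \sum_i q i *: v i); last by rewrite q0 scaler0.
rewrite scaler_sumr; apply: eq_bigr => i _.
by rewrite !scalerA -tofracM -ac -aE mulrC.
Qed.

Lemma relation_degree (w : F) m (c : nat -> ZP) :
  \sum_(i < m) toF (c i) * w ^+ i = 0 -> (exists2 i, (i < m)%N & c i != 0) ->
  exists2 t, c t != 0 & \sum_(i < t.+1) toF (c i) * w ^+ i = 0.
Proof.
elim: m => [|m IH] s0 [i im ci]; first by [].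
have [cm|cm] := eqVneq (c m) 0; last by exists m.
rewrite big_ord_recr /= cm rmorph0 mul0r addr0 in s0.
apply: IH => //; exists i => //; move: im; rewrite ltnS leq_eqVlt => /predU1P [im|//].
by rewrite im cm eqxx in ci.
Qed.

(** Every element of F is algebraic over Q_p, so a power of p clears its
    denominators. *)
Lemma integer_scale (w : F) : exists c, integer (p%:R ^+ c * w).
Proof.
have [c [[i0 ci0] c0]] := @Zp_dependency F (\dim {: F}).+1 (fun i => w ^+ i) (ltnSn _).
pose d i := if insub i is Some j then c j else 0.
have dE (i : 'I_(\dim {: F}).+1) : d i = c i by rewrite /d valK.
have [||t dt s0] := @relation_degree w (\dim {: F}).+1 d.
- rewrite -[RHS]c0; apply: eq_bigr => i _; rewrite dE /toF /=.
  by rewrite -scalerAl mul1r.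
- exists i0; rewrite ?ltn_ord // dE; apply/eqP => ci; apply: (ci0 0).
  by rewrite mulr0.
have [e [u [v [dtE vu]]]] := Zp_factor dt.
case: t dt s0 dtE => [|t] dt s0 dtE.
  by move: s0 => /eqP; rewrite big_ord_recl big_ord0 addr0 expr0 mulr1 toF_eq0 (negPf dt).
exists e; set g := _ * w.
pose q i := toF (v * d i * p%:R ^+ (e * (t - i))).
(* p^e w is a root of P, a relation of degree t + 1 for w made monic: its leading
   coefficient is p^e times a unit, with inverse v. *)
pose P := 'X^(t.+1) + \poly_(i < t.+1) q i.
have szP : (size (\poly_(i < t.+1) q i) < size ('X^(t.+1) : {poly F}))%N.
  by rewrite size_polyXn ltnS size_poly.
have monP : P \is monic by rewrite monicE lead_coefDl // lead_coefXn.
apply/integerE; apply: (integral_root_monic monP); last first.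
  apply/integral_poly => i; rewrite coefD coefXn coef_poly.
  apply: integerD; first by case: eqP => _; [exact: integer1 | exact: integer0].
  by case: ifP => _; [exact: integer_toF | exact: integer0].
rewrite rootE hornerD hornerXn horner_poly; apply/eqP.
transitivity (toF v * p%:R ^+ (e * t) * \sum_(i < t.+2) toF (d i) * w ^+ i); last first.
  by rewrite s0 mulr0.
rewrite [in RHS]big_ord_recr /= mulrDr addrC; congr (_ + _).
  rewrite mulr_sumr; apply: eq_bigr => i _.
  rewrite /q !rmorphM rmorphXn rmorph_nat /= /g exprMn -exprM.
  have -> : (p%:R : F) ^+ (e * t) = p%:R ^+ (e * (t - i)) * p%:R ^+ (e * i).
    by rewrite -exprD -mulnDr subnK // -ltnS.
  rewrite -!mulrA; congr (_ * _); rewrite mulrCA; congr (_ * _); exact: mulrCA.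
rewrite dtE rmorphM rmorphXn rmorph_nat /= /g exprMn -exprM mulnS exprD.
have vuF : toF v * toF u = 1 by rewrite -rmorphM vu rmorph1.
rewrite mulrA; congr (_ * _); rewrite -[LHS]mul1r -vuF -!mulrA; congr (_ * _).
by rewrite mulrC -mulrA mulrCA.
Qed.

(** An integral equation of degree d for 1 / p, multiplied by p^d, would make 1 a
    multiple of p. *)
Lemma p_inv_not_integer : ~ integer (p%:R^-1).
Proof.
move=> [q qmon]; rewrite rootE; set d := (size q).-1.
have szq : size q = d.+1 by rewrite prednK // size_poly_gt0 monic_neq0.
have szq' : (size (map_poly toF q) <= d.+1)%N by rewrite -szq size_poly.
rewrite (horner_coef_wide _ szq') => /eqP q0.
suff: \sum_(i < d.+1) q`_i * p%:R ^+ (d - i) = 0.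
  rewrite big_ord_recr /= subnn mulr1.
  have -> : q`_d = 1 by have /eqP := qmon; rewrite lead_coefE.
  move=> e; apply: (@p_not_unit p p_pr (- \sum_(i < d) q`_i * p%:R ^+ (d - i.+1))).
  rewrite mulrN mulr_sumr; apply/eqP; rewrite eqr_oppLR -subr_eq0 opprK; apply/eqP.
  rewrite -[RHS]e; congr (_ + _); apply: eq_bigr => i _.
  by rewrite mulrCA -exprS subnSK.
apply/eqP; rewrite -toF_eq0 rmorph_sum /=; apply/eqP.
transitivity ((p%:R : F) ^+ d * \sum_(i < d.+1) (map_poly toF q)`_i * p%:R^-1 ^+ i); last first.
  by rewrite q0 mulr0.
rewrite mulr_sumr; apply: eq_bigr => i _.
rewrite coef_map rmorphM rmorphXn rmorph_nat mulrCA; congr (_ * _).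
have -> : (p%:R : F) ^+ d = p%:R ^+ (d - i) * p%:R ^+ i by rewrite -exprD subnK // -ltnS.
by rewrite -mulrA exprVn mulfV ?mulr1 // expf_neq0 // pF_neq0.
Qed.

(** Otherwise w^-1 has bounded denominators, so that 1 / p is integral. *)
Lemma pdvd_eq0 (w : F) : (forall m, pdvd m w) -> w = 0.
Proof.
move=> wd; apply: contrapT => /eqP w0; have [c cI] := integer_scale w^-1.
have [z zI zE] := wd c.+1; apply: p_inv_not_integer.
have -> : p%:R^-1 = z * (p%:R ^+ c * w^-1) :> F.
  apply: (mulfI pF_neq0); rewrite mulfV ?pF_neq0 //.
  transitivity (p%:R ^+ c.+1 * z * w^-1); first by rewrite -zE mulfV //; apply/eqP.
  by rewrite exprS -!mulrA; congr (_ * _); rewrite mulrCA.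
by apply: integerM.
Qed.

Lemma pdvdB m w w' : pdvd m w -> pdvd m w' -> pdvd m (w - w').
Proof.
by move=> [z zI ->] [z' z'I ->]; exists (z - z'); [exact: integerB | rewrite mulrBr].
Qed.
Lemma pdvd0 m : pdvd m 0. Proof. by exists 0; [exact: integer0 | rewrite mulr0]. Qed.
Lemma pdvdN m w : pdvd m w -> pdvd m (- w).
Proof. by move=> wd; rewrite -sub0r; apply: pdvdB => //; exact: pdvd0. Qed.
Lemma pdvdD m w w' : pdvd m w -> pdvd m w' -> pdvd m (w + w').
Proof. by move=> wd w'd; rewrite -(opprK w'); apply: pdvdB => //; exact: pdvdN. Qed.
Lemma pdvd_sum m (I : Type) (s : seq I) (P : pred I) (f : I -> F) :
  (forall i, P i -> pdvd m (f i)) -> pdvd m (\sum_(i <- s | P i) f i).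
Proof. by move=> h; elim/big_ind: _ => //; [exact: pdvd0 | exact: pdvdD]. Qed.
Lemma pdvdM m m' w w' : pdvd m w -> pdvd m' w' -> pdvd (m + m') (w * w').
Proof.
move=> [z zI ->] [z' z'I ->]; exists (z * z'); first exact: integerM.
by rewrite exprD mulrACA.
Qed.
Lemma pdvd_anti m m' w : (m <= m')%N -> pdvd m' w -> pdvd m w.
Proof.
move=> mm' [z zI ->]; exists (p%:R ^+ (m' - m) * z).
  by apply: integerM => //; apply: integerX; exact: integer_nat.
by rewrite mulrA -exprD subnKC.
Qed.
Lemma pdvd_integer w : pdvd 0 w <-> integer w.
Proof.
split; first by move=> [z zI ->]; rewrite mul1r.
by move=> wI; exists w; rewrite ?mul1r.
Qed.
Lemma pdvd_scale m c w : pdvd (m + c) (p%:R ^+ c * w) -> pdvd m w.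
Proof.
move=> [z zI]; rewrite addnC exprD -mulrA => /(mulfI (expf_neq0 _ pF_neq0)) ->.
by exists z.
Qed.

Section Matrices.
Variable n : nat.
Implicit Types A B : 'M[F]_n.

(** A lies in p^m M_n(O_F). *)
Definition mdvd m A : Prop := forall i j, pdvd m (A i j).

Lemma mdvd0 m : mdvd m 0. Proof. by move=> i j; rewrite mxE; exact: pdvd0. Qed.
Lemma mdvdB m A B : mdvd m A -> mdvd m B -> mdvd m (A - B).
Proof. by move=> Ad Bd i j; rewrite !mxE; apply: pdvdB. Qed.
Lemma mdvdN m A : mdvd m A -> mdvd m (- A).
Proof. by move=> Ad i j; rewrite mxE; exact: pdvdN. Qed.
Lemma mdvdD m A B : mdvd m A -> mdvd m B -> mdvd m (A + B).
Proof. by move=> Ad Bd i j; rewrite !mxE; apply: pdvdD. Qed.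
Lemma mdvdM m m' A B : mdvd m A -> mdvd m' B -> mdvd (m + m') (A *m B).
Proof. by move=> Ad Bd i j; rewrite !mxE; apply: pdvd_sum => l _; exact: pdvdM. Qed.
Lemma mdvd_anti m m' A : (m <= m')%N -> mdvd m' A -> mdvd m A.
Proof. by move=> mm' Ad i j; exact: pdvd_anti (Ad i j). Qed.
Lemma mdvd_sum m (I : Type) (s : seq I) (f : I -> 'M[F]_n) :
  (forall i, mdvd m (f i)) -> mdvd m (\sum_(i <- s) f i).
Proof. by move=> h; elim/big_ind: _ => //; [exact: mdvd0 | exact: mdvdD]. Qed.
Lemma mdvd_mulrn m A b : mdvd m A -> mdvd m (A *+ b).
Proof. by move=> Ad; rewrite -[b]card_ord -sumr_const -big_enum; exact: mdvd_sum. Qed.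
Lemma mdvd_scale m c A : mdvd (m + c) (p%:R ^+ c *: A) -> mdvd m A.
Proof. by move=> Ad i j; apply: (@pdvd_scale m c); have := Ad i j; rewrite mxE. Qed.

Lemma family_scale (I : finType) (f : I -> F) : exists c, forall i, integer (p%:R ^+ c * f i).
Proof.
have /choice [c cP] := fun i => integer_scale (f i).
exists (\max_i c i) => i.
have -> : \max_i c i = (\max_i c i - c i + c i)%N by rewrite subnK // leq_bigmax.
by rewrite exprD -mulrA; apply: integerM => //; apply: integerX; exact: integer_nat.
Qed.

Lemma matrix_scale A : exists c, mdvd 0 (p%:R ^+ c *: A).
Proof.
have [c cP] := family_scale (fun ij : 'I_n * 'I_n => A ij.1 ij.2).
by exists c => i j; rewrite mxE; apply/pdvd_integer; exact: (cP (i, j)).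
Qed.

Let D := \dim {: {ffun 'I_n * 'I_n -> F}}.

(** A primitive relation over Z_p, whose coefficients are truncated modulo a high
    power of p. *)
Lemma matrix_dependency m (v : 'I_m -> 'M[F]_n) M : (D < m)%N ->
  exists b : 'I_m -> nat, (exists i, ~~ (p %| b i)%N) /\ mdvd M (\sum_i v i *+ b i).
Proof.
move=> Dm; have [c [[i0 ci0] c0]] :=
  @Zp_dependency {ffun 'I_n * 'I_n -> F} m (fun i => [ffun ab => v i ab.1 ab.2]) Dm.
have /choice [C CP] := fun i => matrix_scale (v i).
pose C' := \max_i C i.
have C'P i : mdvd 0 (p%:R ^+ C' *: v i).
  have -> : C' = (C' - C i + C i)%N by rewrite subnK // leq_bigmax.
  move=> a b; rewrite mxE exprD -mulrA; apply/pdvd_integer; apply: integerM.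
    by apply: integerX; exact: integer_nat.
  by have := CP i a b; rewrite mxE => /pdvd_integer.
have /choice [by_ byP] : forall i, exists by' : nat * ZP, c i = by'.1%:R + p%:R ^+ (M + C').+1 * by'.2.
  by move=> i; have [b [y cE]] := Zp_approx (c i) (M + C').+1; exists (b, y).
exists (fun i => (by_ i).1); split.
  exists i0; apply/negP => /dvdnP [q bq].
  apply: (ci0 (q%:R + p%:R ^+ (M + C') * (by_ i0).2)).
  by rewrite byP bq mulrDr -natrM mulnC exprS mulrA.
have sE : \sum_i v i *+ (by_ i).1 = - \sum_i (p%:R ^+ (M + C').+1 * toF (by_ i).2) *: v i.
  apply/eqP; rewrite -subr_eq0 opprK -big_split /=; apply/eqP.
  apply/matrixP => a b; rewrite summxE mxE.
  have /(congr1 (fun f : {ffun 'I_n * 'I_n -> F} => f (a, b))) := c0.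
  rewrite sum_ffunE ffunE => e; rewrite -[RHS]e; apply: eq_bigr => i _.
  rewrite !ffunE /= !mxE byP -[LHS]/(_ + _).
  rewrite -mulr_algl -[(tofrac _)%:A]/(toF _) rmorphD rmorph_nat mulrDl mulr_natl.
  by rewrite rmorphM rmorphXn rmorph_nat mulmxnE.
rewrite sE; apply/mdvdN/mdvd_sum => i a b.
exists (p%:R * toF (by_ i).2 * (p%:R ^+ C' * v i a b)).
  apply: integerM; first by apply: integerM; [exact: integer_nat | exact: integer_toF].
  by have := C'P i a b; rewrite mxE => /pdvd_integer.
by rewrite mxE exprS exprD !mulrA; congr (_ * _); rewrite mulrAC (mulrC p%:R) -!mulrA; congr (_ * _);
  rewrite mulrCA.
Qed.

(** A subgroup V of matrices is topologically finitely generated, uniformly for a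
    directed family of subgroups W t that are open in V: a family independent
    modulo p V + W t has at most D elements, and one of maximal length
    generates. *)
Lemma subgroup_fg (V : set 'M[F]_n) (T : Type) (W : T -> set 'M[F]_n) (t0 : T) :
  V 0 -> (forall A B, V A -> V B -> V (A - B)) ->
  (forall t, W t 0) -> (forall t A B, W t A -> W t B -> W t (A - B)) ->
  (forall s t, exists u, W u `<=` W s `&` W t) ->
  (forall t, exists M, forall A, V A -> mdvd M A -> W t A) ->
  exists vs : seq 'M[F]_n, (forall v, v \in vs -> V v) /\
    forall t A, V A -> exists (b : nat -> nat) w, V w /\
      W t (A - \sum_(i < size vs) vs`_i *+ b i - w *+ p).
Proof.
move=> V0 VB W0 WB Wdir WV.
have VN A : V A -> V (- A) by move=> VA; rewrite -sub0r; exact: VB.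
have VD A B : V A -> V B -> V (A + B) by move=> VA VB'; rewrite -(opprK B); apply: (VB) => //; exact: VN.
have VMn A b : V A -> V (A *+ b) by move=> VA; elim: b => [//|b IH]; rewrite mulrS; exact: VD.
have WD t A B : W t A -> W t B -> W t (A + B).
  by move=> WA WB'; rewrite -(opprK B); apply: (WB) => //; rewrite -sub0r; exact: WB.
have WMn t A b : W t A -> W t (A *+ b).
  by move=> WA; elim: b => [|b IH]; rewrite ?mulr0n // mulrS; exact: WD.
have Vsum m (f : 'I_m -> 'M[F]_n) : (forall i, V (f i)) -> V (\sum_i f i).
  by move=> h; elim/big_ind: _.
pose indep t (vs : seq 'M[F]_n) := forall (b : nat -> nat) w, V w ->
  W t (\sum_(i < size vs) vs`_i *+ b i - w *+ p) -> forall i, (i < size vs)%N -> (p %| b i)%N.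
pose P s := `[< exists t vs, [/\ size vs = s, forall v, v \in vs -> V v & indep t vs] >].
have P0 : exists s, P s by exists 0%N; apply/asboolP; exists t0, [::]; split.
have PD s : P s -> (s <= D)%N.
  move=> /asboolP [t [vs [<- vsV ind]]]; rewrite leqNgt; apply/negP => Ds.
  have [M MW] := WV t.
  have [b [[i nb] bM]] := matrix_dependency (fun i : 'I_(size vs) => vs`_i) M Ds.
  case/negP: nb; pose b' j := if insub j is Some j' then b j' else 0%N.
  have b'E (j : 'I_(size vs)) : b' j = b j by rewrite /b' valK.
  rewrite -b'E; apply: (ind b' 0 V0) => //.
  rewrite mul0rn subr0; under eq_bigr => j _ do rewrite b'E.
  by apply: MW => //; apply: Vsum => j; apply: VMn; apply: vsV; exact: mem_nth.
case: (ex_maxnP P0 PD) => m /asboolP [t1 [vs [sz vsV ind]]] max.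
exists vs; split => // t A VA.
have [u uW] := Wdir t t1.
have indu : indep u vs by move=> b w Vw /uW [_ Wt1]; exact: ind Wt1.
have [b [w [Vw Ww nb0]]] : exists b w, [/\ V w,
    W u (A *+ b 0%N + \sum_(i < size vs) vs`_i *+ b i.+1 - w *+ p) & ~~ (p %| b 0%N)%N].
  apply: contrapT => nex.
  have : P m.+1.
    apply/asboolP; exists u, (A :: vs); split; first by rewrite /= sz.
      by move=> v; rewrite inE => /predU1P [->|/vsV].
    move=> b w Vw; rewrite /= big_ord_recl /= => Ww.
    have b0 : (p %| b 0%N)%N by apply: contrapT => /negP nb0; apply: nex; exists b, w; split.
    have := indu (fun i => b i.+1) (w - A *+ (b 0 %/ p)%N).
    have VwA : V (w - A *+ (b 0 %/ p)%N) by apply: (VB) => //; exact: VMn.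
    rewrite mulrnBl -mulrnA (divnK b0) opprB addrCA addrA => /(_ VwA Ww) h [|i] //.
    exact: h.
  by move=> /max; rewrite ltnn.
have [s [q sq]] : exists s q, (s * b 0 = q * p + 1)%N.
  have b00 : (0 < b 0)%N by case: (b 0%N) nb0; rewrite ?dvdn0.
  have [km kn e _] := egcdnP p b00; exists km, kn.
  rewrite e; congr (_ + _)%N; apply/eqP; rewrite -/(coprime _ _) coprime_sym.
  by rewrite prime_coprime.
exists (fun i => b i.+1 * s * p.-1)%N, (w *+ s - A *+ q - \sum_(i < size vs) vs`_i *+ (b i.+1 * s)).
split.
  apply: (VB); first by apply: (VB); exact: VMn.
  by apply: Vsum => j; apply: VMn; apply: vsV; exact: mem_nth.
have /uW [Wt _] : W u ((A *+ b 0%N + \sum_(i < size vs) vs`_i *+ b i.+1 - w *+ p) *+ s) by exact: WMn.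
have -> : A - \sum_(i < size vs) vs`_i *+ (b i.+1 * s * p.-1) -
    (w *+ s - A *+ q - \sum_(i < size vs) vs`_i *+ (b i.+1 * s)) *+ p =
    (A *+ b 0%N + \sum_(i < size vs) vs`_i *+ b i.+1 - w *+ p) *+ s; last by [].
have p0 := prime_gt0 p_pr.
rewrite !mulrnBl mulrnDl -!mulrnA (mulnC (b 0%N)) sq mulrnDr mulr1n.
set X := \sum_(i < size vs) vs`_i *+ (b i.+1 * s).
have -> : \sum_(i < size vs) vs`_i *+ (b i.+1 * s * p.-1) = X *+ p - X.
  transitivity (X *+ p.-1); last by apply/eqP; rewrite eq_sym subr_eq -mulrSr prednK.
  by rewrite -sumrMnl; apply: eq_bigr => i _; rewrite -mulrnA.
have -> : (\sum_(i < size vs) vs`_i *+ b i.+1) *+ s = X.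
  by rewrite -sumrMnl; apply: eq_bigr => i _; rewrite -mulrnA.
by rewrite (mulnC s p) !opprB !addrA subrK; congr (_ - _); rewrite addrAC [A + _]addrC.
Qed.

Lemma mdvd_factor M A : mdvd M A -> exists2 B, mdvd 0 B & A = p%:R ^+ M *: B.
Proof.
move=> Ad; have /choice [z zP] : forall ij : 'I_n * 'I_n,
    exists z, integer z /\ A ij.1 ij.2 = p%:R ^+ M * z.
  by move=> ij; have [z zI zE] := Ad ij.1 ij.2; exists z.
exists (\matrix_(i, j) z (i, j)).
  by move=> i j; rewrite mxE; apply/pdvd_integer; have [] := zP (i, j).
by apply/matrixP => i j; rewrite !mxE; have [] := zP (i, j).
Qed.

Lemma mdvd_shift m M A : mdvd m A -> mdvd (M + m) (p%:R ^+ M *: A).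
Proof.
move=> Ad i j; have [z zI zE] := Ad i j; exists z => //.
by rewrite mxE zE exprD mulrA.
Qed.

(** By subgroup_fg, M_n(O_F) / p is spanned by finitely many elements over Z / p;
    the general case follows by successive approximation. *)
Lemma residue_finite M : exists s : seq 'M[F]_n,
  forall A, mdvd 0 A -> exists2 B, B \in s & mdvd M (A - B).
Proof.
have [s1 s1P] : exists s : seq 'M[F]_n,
    forall A, mdvd 0 A -> exists B, [/\ B \in s, mdvd 0 B & mdvd 1 (A - B)].
  have [vs [vs0 vsP]] := @subgroup_fg (mdvd 0) unit (fun=> mdvd 1) tt (mdvd0 0)
    (@mdvdB 0) (fun=> mdvd0 1) (fun=> @mdvdB 1) (fun _ _ => ex_intro _ tt (fun A h => conj h h))
    (fun=> ex_intro _ 1%N (fun _ _ h => h)).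
  exists [seq \sum_(i < size vs) vs`_i *+ f i | f : {ffun 'I_(size vs) -> 'I_p}] => A Ad.
  have [b [w [wd Wd]]] := vsP tt A Ad.
  have p0 := prime_gt0 p_pr.
  pose f : {ffun 'I_(size vs) -> 'I_p} := [ffun i : 'I_(size vs) => Ordinal (ltn_pmod (b i) p0)].
  exists (\sum_(i < size vs) vs`_i *+ f i); split; first by apply/mapP; exists f; rewrite ?mem_enum.
    by apply: mdvd_sum => i; apply: mdvd_mulrn; apply: vs0; exact: mem_nth.
  have mp B : mdvd 0 B -> mdvd 1 (B *+ p).
    move=> Bd; rewrite -scaler_nat -[p%:R]expr1 -[1%N]addn0; exact: mdvd_shift.
  rewrite -(subrK (w *+ p + \sum_(i < size vs) (vs`_i *+ (b i %/ p)) *+ p) (A - _)).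
  apply: mdvdD; last first.
    apply: mdvdD; first exact: mp.
    by apply: mdvd_sum => i; apply/mp/mdvd_mulrn/vs0/mem_nth.
  have -> : A - \sum_(i < size vs) vs`_i *+ f i -
      (w *+ p + \sum_(i < size vs) vs`_i *+ (b i %/ p) *+ p) =
      A - \sum_(i < size vs) vs`_i *+ b i - w *+ p; last by [].
    rewrite opprD addrA addrAC; congr (_ - _); rewrite -addrA -opprD -big_split /=.
    congr (_ - _); apply: eq_bigr => i _.
    by rewrite ffunE /= -mulrnA -mulrnDr addnC -divn_eq.
elim: M => [|M [s sP]].
  by exists [:: 0] => A Ad; exists 0; rewrite ?mem_head ?subr0.
exists [seq B + p%:R ^+ M *: C | B <- s, C <- s1] => A Ad.
have [B Bs /mdvd_factor [C Cd CE]] := sP A Ad; have [C' [C's _ C'd]] := s1P C Cd.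
exists (B + p%:R ^+ M *: C'); first by apply/allpairsP; exists (B, C').
by rewrite opprD addrA CE -scalerBr -addn1; exact: mdvd_shift.
Qed.

End Matrices.
End PadicField.

(** * Compact open subgroups of unipotent matrices *)

Lemma initial_nbhs (S : choiceType) (T : topologicalType) (f : S -> T)
    (x : initial_topology f) (A : set (initial_topology f)) :
  nbhs x A <-> exists2 B, nbhs (f x) B & f @^-1` B `<=` A.
Proof.
split.
  rewrite nbhsE => -[O [[C Cop <-] Cx] CA]; exists C; last exact: CA.
  by exists C.
move=> [B fB BA]; apply: filterS BA _.
exact: (@initial_continuous S T f x B fB).
Qed.

Section Unipotent.
Variables (p : nat) (p_pr : prime p) (F : fieldExtType (Qp p_pr)) (n : nat).
Variables (U : subgroup (padic_unitriangular F n)).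
Notation G := (subgroup_type U).
Notation mdvd := (@mdvd p p_pr F n).

Definition mat (u : G) : 'M[F]_n := sval (val u).

Lemma nbhs_matrix (M : 'M[padic_field F]_n) (A : set 'M[padic_field F]_n) :
  nbhs M A <-> exists m, forall N : 'M[F]_n, mdvd m (N - M) -> A N.
Proof.
split.
  move=> [P MP PA].
  have /choice [m mP] : forall ij : 'I_n * 'I_n, exists m, forall z : F,
      integer z -> P ij.1 ij.2 ((M ij.1 ij.2 : F) + p%:R ^+ m * z).
    by move=> ij; exact: (MP ij.1 ij.2).
  exists (\max_ij m ij) => N NM; apply: PA => i j.
  have [z zI zE] : pdvd (m (i, j)) ((N - M) i j).
    by apply: pdvd_anti (NM i j); exact: (leq_bigmax (i, j)).
  have := mP (i, j) z zI; rewrite /= -zE !mxE (addrC (M i j : F)) (subrK (M i j : F)).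
  by [].
move=> [m MA]; exists (fun i j => [set w : padic_field F | pdvd m ((w : F) - M i j)]).
  by move=> i j; exists m => z zI; exists z => //; rewrite addrC addKr.
by move=> N NP; apply: MA => i j; rewrite !mxE; exact: NP.
Qed.

Lemma nbhs_mat (u : G) (A : set G) :
  nbhs u A <-> exists m, forall v : G, mdvd m (mat v - mat u) -> A v.
Proof.
split.
  move=> /(initial_nbhs (f := set_val)) [B /(initial_nbhs (f := @padic_unitriangular_val p p_pr F n)) [C]].
  move=> /nbhs_matrix [m mC] CB BA; exists m => v vu; apply: BA; apply: CB; exact: mC.
move=> [m mA]; apply/(initial_nbhs (f := set_val)).
exists [set v : padic_unitriangular F n | mdvd m (sval v - mat u)]; last by move=> v; exact: mA.
apply/(initial_nbhs (f := @padic_unitriangular_val p p_pr F n)).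
exists [set M : 'M[padic_field F]_n | mdvd m ((M : 'M[F]_n) - mat u)]; last by [].
by apply/nbhs_matrix; exists m.
Qed.

Lemma matM (u v : G) : mat (u * v)%g = mat u *m mat v. Proof. by []. Qed.
Lemma mat_inj (u v : G) : mat u = mat v -> u = v.
Proof. by move=> e; apply: val_inj; apply: val_inj. Qed.
Lemma matV (u : G) : mat u^-1%g *m mat u = 1%:M.
Proof. by rewrite -matM mulVg. Qed.

(** The filtration of upper triangular matrices by their superdiagonals. *)
Definition upper (i : nat) (A : 'M[F]_n) : Prop :=
  forall a b : 'I_n, (b < a + i)%N -> A a b = 0.

Lemma upper0 i : upper i 0. Proof. by move=> a b _; rewrite mxE. Qed.
Lemma upperB i A B : upper i A -> upper i B -> upper i (A - B).
Proof. by move=> sA sB a b ab; rewrite !mxE sA ?sB ?subrr. Qed.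
Lemma upperD i A B : upper i A -> upper i B -> upper i (A + B).
Proof. by move=> sA sB a b ab; rewrite !mxE sA ?sB ?addr0. Qed.
Lemma upper_anti i j A : (i <= j)%N -> upper j A -> upper i A.
Proof. by move=> ij sA a b ab; apply: sA; apply: leq_trans ab _; rewrite leq_add2l. Qed.
Lemma upperM i j A B : upper i A -> upper j B -> upper (i + j) (A *m B).
Proof.
move=> sA sB a b ab; rewrite mxE big1 // => l _.
have [la|al] := ltnP l (a + i); first by rewrite sA ?mul0r.
by rewrite sB ?mulr0 //; apply: leq_trans ab _; rewrite addnA leq_add2r.
Qed.
Lemma upper_eq0 A : upper n A -> A = 0.
Proof. by move=> sA; apply/matrixP => a b; rewrite mxE sA // (leq_trans (ltn_ord b)) ?leq_addl. Qed.

Lemma mat_upper (u : G) : upper 0 (mat u).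
Proof.
move=> a b; rewrite addn0 => ba; have /andP [_ /forallP /(_ a) /forall_inP h] := valP (val u).
exact/eqP/h.
Qed.
Lemma mat_upper1 (u : G) : upper 1 (mat u - 1%:M).
Proof.
move=> a b; rewrite addn1 ltnS leq_eqVlt => /predU1P [/val_inj ->|ba].
  have /andP [/forallP /(_ a) /eqP h _] := valP (val u).
  by rewrite !mxE eqxx h subrr.
by rewrite !mxE mat_upper ?addn0 // -val_eqE gtn_eqF // subr0.
Qed.

Definition superdiag (i : nat) (A : 'M[F]_n) : 'M[F]_n :=
  \matrix_(a, b) if b == (a + i)%N :> nat then A a b else 0.

Lemma superdiagD i A B : superdiag i (A + B) = superdiag i A + superdiag i B.
Proof. by apply/matrixP => a b; rewrite !mxE; case: ifP; rewrite ?addr0. Qed.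
Lemma superdiagZ i a A : superdiag i (a *: A) = a *: superdiag i A.
Proof. by apply/matrixP => u v; rewrite !mxE; case: ifP; rewrite ?mulr0. Qed.
Lemma superdiag_upper i A : upper i.+1 A -> superdiag i A = 0.
Proof.
move=> sA; apply/matrixP => a b; rewrite !mxE; case: eqP => // e.
by rewrite sA // e addnS.
Qed.
Lemma superdiag_mdvd i m A : mdvd m A -> mdvd m (superdiag i A).
Proof. by move=> Ad a b; rewrite mxE; case: ifP => _; [exact: Ad | exact: pdvd0]. Qed.

Definition bounded_by (c : nat) (A : 'M[F]_n) : Prop := mdvd 0 (p%:R ^+ c *: A).

Lemma bounded_mono c c' A : (c <= c')%N -> bounded_by c A -> bounded_by c' A.
Proof.
move=> cc' Ab; rewrite /bounded_by -(subnK cc') exprD -scalerA.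
have := mdvd_shift (c' - c) Ab; rewrite addn0; exact: mdvd_anti.
Qed.
Lemma bounded_mull c m A B : bounded_by c A -> mdvd (m + c) B -> mdvd m (A *m B).
Proof.
move=> Ab Bd; apply: (@mdvd_scale _ _ _ _ _ c); rewrite scalemxAl.
exact: (mdvdM Ab Bd).
Qed.
Lemma bounded_mulr c m A B : bounded_by c A -> mdvd (m + c) B -> mdvd m (B *m A).
Proof.
move=> Ab Bd; apply: (@mdvd_scale _ _ _ _ _ c); rewrite scalemxAr -[(m + c)%N]addn0.
exact: (mdvdM Bd Ab).
Qed.

(** A bounded family is approximated by finitely many of its members, because
    the residue ring of the integers of F modulo p^M is finite. *)
Lemma finite_approx (I : eqType) (S : set I) (f : I -> 'M[F]_n) c M :
  (forall x, S x -> bounded_by c (f x)) ->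
  exists s : seq I, (forall y, y \in s -> S y) /\
    forall x, S x -> exists2 y, y \in s & mdvd M (f x - f y).
Proof.
move=> Sb; have [s sP] := @residue_finite p p_pr F n (M + c).
have [t [tS tP]] : exists t : seq I, (forall y, y \in t -> S y) /\
    forall B, B \in s -> (exists2 x, S x & mdvd (M + c) (p%:R ^+ c *: f x - B)) ->
      exists2 y, y \in t & mdvd (M + c) (p%:R ^+ c *: f y - B).
  elim: s {sP} => [|B s [t [tS tP]]]; first by exists [::]; split.
  have [[x Sx xB]|nB] := pselect (exists2 x, S x & mdvd (M + c) (p%:R ^+ c *: f x - B)).
    exists (x :: t); split; first by move=> y; rewrite inE => /predU1P [->|/tS].
    move=> B'; rewrite inE => /predU1P [-> _|B's /(tP _ B's) [y yt yB]].
      by exists x; rewrite ?mem_head.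
    by exists y; rewrite // inE yt orbT.
  exists t; split => // B'; rewrite inE => /predU1P [->|B's]; first by move/nB.
  exact: tP.
exists t; split => // x Sx; have [B Bs xB] := sP _ (Sb x Sx).
have [|y yt yB] := tP B Bs; first by exists x.
exists y => //; apply: (@mdvd_scale _ _ _ _ _ c); rewrite scalerBr.
rewrite -(subrK B (_ *: f x)) -addrA; apply: mdvdD => //.
by rewrite -opprB; exact: mdvdN.
Qed.

Section CompactOpen.
Variable K : subgroup G.
Notation KK := (subgroup_type K).
Notation incl := (@subgroup_incl G K).
Hypothesis K_open : open (K : set G).
Hypothesis K_compact : compact [set: KK].
Implicit Types (x y : KK) (N : open_normal KK).

Definition matK x : 'M[F]_n := mat (incl x).

Lemma nbhs_matK x (A : set KK) :
  nbhs x A <-> exists m, forall y, mdvd m (matK y - matK x) -> A y.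
Proof.
split.
  by move=> /(initial_nbhs (f := set_val)) [B /nbhs_mat [m mB] BA]; exists m => y yx; apply/BA/mB.
move=> [m mA]; apply/(initial_nbhs (f := set_val)).
exists [set v : G | mdvd m (mat v - matK x)]; last by move=> v; exact: mA.
by apply/nbhs_mat; exists m.
Qed.

(** Compactness of K, expressed with matrices. *)
Lemma decreasing_cluster (S : nat -> set KK) :
  (forall i j, (i <= j)%N -> S j `<=` S i) -> (forall i, S i !=set0) ->
  exists x, forall i m, exists2 y, S i y & mdvd m (matK y - matK x).
Proof.
move=> Sdec S0; pose FF := filter_from [set: nat] S.
have FP : ProperFilter FF.
  apply: filter_from_proper; last by move=> i _; exact: S0.
  apply: filter_from_filter; first by exists 0%N.
  move=> i j _ _; exists (maxn i j) => // x Sx; split; apply: Sdec Sx.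
    exact: leq_maxl.
  exact: leq_maxr.
have [|x [_ xcl]] := K_compact FP; first exact: filterT.
exists x => i m.
have [||y [Siy yB]] := xcl (S i) [set y | mdvd m (matK y - matK x)]; last by exists y.
- by exists i.
- by apply/nbhs_matK; exists m.
Qed.

(** Otherwise elements with larger and larger denominators would have a cluster
    point. *)
Lemma K_bounded : exists c, forall x, bounded_by c (matK x).
Proof.
apply: contrapT => nb.
have [||x xP] := @decreasing_cluster (fun c => [set x | ~ bounded_by c (matK x)]).
- by move=> i j ij x /= nbx; apply: contra_not nbx; exact: bounded_mono.
- move=> c; apply: contrapT => ne; apply: nb; exists c => x.
  by apply: contrapT => nbx; apply: ne; exists x.
have [c cP] := matrix_scale (matK x); have [y /= ny yx] := xP c 0%N; apply: ny.
rewrite /bounded_by -(subrK (matK x) (matK y)) scalerDr; apply: mdvdD => //.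
by apply: mdvd_anti (mdvd_shift c yx).
Qed.

Lemma K_boundedV : exists c, forall x, bounded_by c (matK x) /\ bounded_by c (mat (incl x)^-1%g).
Proof. by have [c cP] := K_bounded; exists c => x; split; [exact: cP | exact: (cP x^-1%g)]. Qed.

(** K is open in U, so that u need not be assumed to lie in K. *)
Lemma open_normal_cong N : exists m, forall u : G, mdvd m (mat u - 1%:M) ->
  exists2 x, (N : set KK) x & incl x = u.
Proof.
have /nbhs_matK [m mN] : nbhs (1%g : KK) (N : set KK).
  by apply: open_nbhs_nbhs; split; [exact: open_normal_open | exact: (@subgroup1 _ N)].
have /nbhs_mat [m' m'K] : nbhs (1%g : G) (K : set G).
  by apply: open_nbhs_nbhs; split => //; exact: subgroup1.
exists (maxn m m') => u uc.
have Ku : (K : set G) u by apply: m'K; apply: mdvd_anti uc; exact: leq_maxr.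
exists (exist _ u (mem_set Ku)) => //; apply: mN.
by apply: mdvd_anti uc; exact: leq_maxl.
Qed.

Lemma mat_div (u v : G) c m : bounded_by c (mat u^-1%g) ->
  mdvd (m + c) (mat v - mat u) -> mdvd m (mat (u^-1 * v)%g - 1%:M).
Proof.
move=> ub uv; have -> : mat (u^-1 * v)%g - 1%:M = mat u^-1%g *m (mat v - mat u).
  by rewrite mulmxBr matV.
exact: bounded_mull uv.
Qed.

Lemma mat_divr (u v : G) c m : bounded_by c (mat v^-1%g) ->
  mdvd (m + c) (mat u - mat v) -> mdvd m (mat (u * v^-1)%g - 1%:M).
Proof.
move=> ub uv; have -> : mat (u * v^-1)%g - 1%:M = (mat u - mat v) *m mat v^-1%g.
  by rewrite mulmxBl -!matM mulgV.
exact: bounded_mulr uv.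
Qed.

Lemma K_near N : exists m, forall x y, mdvd m (matK y - matK x) -> (N : set KK) (x^-1 * y)%g.
Proof.
have [m mN] := open_normal_cong N; have [c cP] := K_bounded.
exists (m + c)%N => x y xy.
have [|z Nz zE] := mN (incl (x^-1 * y)%g); first exact: (mat_div (cP x^-1%g) xy).
by have <- : z = (x^-1 * y)%g by exact: val_inj.
Qed.

Lemma K_finite_quotients : finite_quotients KK.
Proof.
move=> N; have [m mN] := K_near N; have [c cP] := K_bounded.
have [s [_ sP]] := @finite_approx KK setT matK c m (fun x _ => cP x).
by exists s => x; have [y ys xy] := sP x I; exists y => //; exact: mN.
Qed.

Section Conjugation.
Variables (h : G) (N : open_normal KK).

(** Running over the K-conjugates makes this subgroup normal; it remains open
    because K is bounded. *)
Definition conj_core : set KK := [set nu | forall x, exists2 nu', (N : set KK) nu' &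
  incl nu' = ((h * incl x) * incl nu * (h * incl x)^-1)%g].

Lemma conj_core1 : conj_core 1%g.
Proof.
move=> x; exists 1%g; first exact: (@subgroup1 _ N).
by rewrite incl1 mulg1 mulgV.
Qed.

Lemma conj_coreM nu mu : conj_core nu -> conj_core mu -> conj_core (nu * mu)%g.
Proof.
move=> An Am x; have [nu' Nn' nE] := An x; have [mu' Nm' mE] := Am x.
exists (nu' * mu')%g; first exact: (@subgroupM _ N).
by rewrite !inclM nE mE; move: (h * incl x)%g (incl nu) (incl mu) => w nu1 mu1; rewrite !mulgA mulgVK.
Qed.

Lemma conj_coreV nu : conj_core nu -> conj_core nu^-1%g.
Proof.
move=> An x; have [nu' Nn' nE] := An x; exists nu'^-1%g; first exact: (@subgroupV _ N).
by rewrite !inclV nE; move: (incl x) (incl nu) => x' nu1; rewrite !invgM !invgK !mulgA.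
Qed.

Lemma conj_coreJ g nu : conj_core nu -> conj_core (g * nu * g^-1)%g.
Proof.
move=> An x; have [nu' Nn' nE] := An (x * g)%g; exists nu' => //.
rewrite nE !inclM !inclV; move: (incl x) (incl nu) (incl g) => x' nu1 g1.
by rewrite !invgM !mulgA.
Qed.

Lemma conj_cong (w z : G) c c' m : bounded_by c (mat w) -> bounded_by c' (mat w^-1%g) ->
  mdvd (m + c + c') (mat z - 1%:M) -> mdvd m (mat (w * z * w^-1)%g - 1%:M).
Proof.
move=> wb wb' zd; have -> : mat (w * z * w^-1)%g - 1%:M = mat w *m ((mat z - 1%:M) *m mat w^-1%g).
  by rewrite mulmxBl mulmxBr mul1mx -!matM mulgV mulgA.
by apply: (bounded_mull wb); exact: (bounded_mulr wb').
Qed.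

Lemma boundedM c c' A B : bounded_by c A -> bounded_by c' B -> bounded_by (c + c') (A *m B).
Proof.
move=> Ab Bb; rewrite /bounded_by exprD -scalerA scalemxAr scalemxAl.
exact: (mdvdM Ab Bb).
Qed.

Lemma conj_core_open : open conj_core.
Proof.
have [m mN] := open_normal_cong N; have [c cP] := K_boundedV.
have [c1 c1P] := matrix_scale (mat h); have [c2 c2P] := matrix_scale (mat h^-1%g).
have near z : mdvd (m + (c1 + c) + (c + c2)) (mat (incl z) - 1%:M) -> conj_core z.
  move=> zd x.
  have hx : bounded_by (c1 + c) (mat (h * incl x)%g) by rewrite matM; apply: boundedM => //; exact: (cP x).1.
  have hx' : bounded_by (c + c2) (mat (h * incl x)^-1%g).
    by rewrite invgM matM; apply: boundedM => //; exact: (cP x).2.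
  by have [nu' Nn' nE] := mN _ (conj_cong hx hx' zd); exists nu'.
rewrite openE => nu Anu; apply/nbhs_matK.
exists (m + (c1 + c) + (c + c2) + c)%N => y yn.
rewrite -(mulVKg nu y); apply: conj_coreM => //; apply: near.
rewrite inclM inclV; apply: mat_div yn.
exact: (cP nu).2.
Qed.

Definition conj_core_normal : open_normal KK :=
  @OpenNormal KK (@NormalSubgroup KK (@Subgroup KK conj_core conj_core1 conj_coreM conj_coreV)
    conj_coreJ) conj_core_open.

Lemma K_conjugate : exists N' : open_normal KK,
  forall nu, (N' : set KK) nu -> exists2 nu', (N : set KK) nu' & incl nu' = (h * incl nu * h^-1)%g.
Proof.
exists conj_core_normal => nu Anu; have [nu' Nn' nE] := Anu 1%g; exists nu' => //.
by rewrite nE incl1 mulg1.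
Qed.

End Conjugation.

(** The subgroup of matrices whose entry (a, b) has denominator at most
    p^(c (b - a)); a diagonal conjugate of the integral unitriangular group. *)
Definition weighted (c : nat) (A : 'M[F]_n) : Prop :=
  forall a b : 'I_n, integer (p%:R ^+ (c * (b - a)) * A a b).

Lemma weightedM c A B : upper 0 A -> upper 0 B -> weighted c A -> weighted c B ->
  weighted c (A *m B).
Proof.
move=> sA sB Aw Bw a b; rewrite mxE mulr_sumr; apply: integer_sum => l _.
have [la|al] := ltnP l a; first by rewrite sA ?addn0 // mul0r mulr0; exact: integer0.
have [bl|lb] := ltnP b l; first by rewrite sB ?addn0 // !mulr0; exact: integer0.
have -> : (b - a = (l - a) + (b - l))%N by rewrite addnC addnBA // subnK.
by rewrite mulnDr exprD mulrACA; apply: integerM.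
Qed.

Lemma weighted_bounded c A : upper 0 A -> weighted c A -> bounded_by (c * n) A.
Proof.
move=> sA Aw a b; rewrite mxE; apply/pdvd_integer.
have -> : (c * n = c * n - c * (b - a) + c * (b - a))%N.
  by rewrite subnK // leq_mul2l (leq_trans (leq_subr _ _)) ?orbT // ltnW.
by rewrite exprD -mulrA; apply: integerM => //; apply: integerX; exact: integer_nat.
Qed.

Lemma bounded_weighted c (u : G) : bounded_by c (mat u) -> weighted c (mat u).
Proof.
move=> ub a b; have [ab|ba|/val_inj ab] := ltngtP a b.
- have := ub a b; rewrite mxE => /pdvd_integer.
  have -> : (c * (b - a) = c * (b - a).-1 + c)%N by rewrite -mulnSr prednK ?subn_gt0.
  by rewrite exprD -mulrA => h; apply: integerM => //; apply: integerX; exact: integer_nat.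
- by rewrite mat_upper ?addn0 // mulr0; exact: integer0.
- have := @mat_upper1 u a a; rewrite !mxE eqxx addn1 ltnSn => /(_ isT) /eqP.
  by rewrite subr_eq0 -ab subnn muln0 expr0 mul1r => /eqP ->; exact: integer1.
Qed.

Lemma weighted_mono c c' A : (c <= c')%N -> weighted c A -> weighted c' A.
Proof.
move=> cc' Aw a b; rewrite -(subnK cc') mulnDl exprD -mulrA.
by apply: integerM => //; apply: integerX; exact: integer_nat.
Qed.

Lemma weighted1 c : weighted c 1%:M.
Proof.
move=> a b; rewrite mxE; apply: integerM; last exact: integer_nat.
by apply: integerX; exact: integer_nat.
Qed.

Definition weighted_subgroup (c : nat) : subgroup G.
Proof.
apply: (@Subgroup G [set u | weighted c (mat u) /\ weighted c (mat u^-1%g)]).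
- by split; rewrite ?invg1; exact: weighted1.
- move=> u v [uw u'w] [vw v'w]; split; rewrite ?invgM matM;
    by apply: weightedM => //; exact: mat_upper.
- by move=> u [uw u'w]; split => //; rewrite invgK.
Defined.

(** The whole group is the directed union of the groups above, in which K has
    finite index as soon as it is contained in them. *)
Lemma K_union (s : seq G) : exists K' : subgroup G,
  [/\ (K : set G) `<=` K', forall u, u \in s -> (K' : set G) u &
    exists2 l : seq G, forall u, u \in l -> (K' : set G) u &
      forall u, (K' : set G) u -> exists2 v, v \in l & (K : set G) (u * v^-1)%g].
Proof.
have [c0 c0P] := K_boundedV.
have [c1 c1P] : exists c, forall u, u \in s -> bounded_by c (mat u) /\ bounded_by c (mat u^-1%g).
  elim: s => [|u s [c cP]]; first by exists 0%N.
  have [d dP] := matrix_scale (mat u); have [d' d'P] := matrix_scale (mat u^-1%g).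
  exists (maxn c (maxn d d')) => v; rewrite inE => /predU1P [->|/cP [h h']]; last first.
    by split; [apply: bounded_mono h | apply: bounded_mono h']; exact: leq_maxl.
  split; [apply: bounded_mono dP | apply: bounded_mono d'P];
    by rewrite (leq_trans _ (leq_maxr _ _)) ?leq_maxl ?leq_maxr.
pose c := maxn c0 c1.
exists (weighted_subgroup c); split.
- move=> u Ku; pose x : KK := exist _ u (mem_set Ku).
  split; apply: (weighted_mono (leq_maxl c0 c1)); apply: bounded_weighted.
    exact: (c0P x).1.
  exact: (c0P x).2.
- move=> u /c1P [h h'].
  by split; apply: (weighted_mono (leq_maxr c0 c1)); apply: bounded_weighted.
have [m mK] := open_normal_cong (whole_open_normal KK).
have [|l [lK' lP]] := @finite_approx G (weighted_subgroup c) mat (c * n) (m + c * n).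
  by move=> u [uw _]; apply: weighted_bounded => //; exact: mat_upper.
exists l => // u K'u; have [v vl uv] := lP u K'u; exists v => //.
have [_ v'w] := lK' v vl.
have [|x _ <-] := mK (u * v^-1)%g; last exact: set_valP.
apply: mat_divr uv; apply: weighted_bounded => //; exact: mat_upper.
Qed.

End CompactOpen.
End Unipotent.

(** * The central chain of a compact unipotent group *)

(** H is a compact group of unipotent matrices, through an injective representation
    rho that defines its topology. *)
Section Chain.
Variables (p : nat) (p_pr : prime p) (F : fieldExtType (Qp p_pr)) (n : nat).
Notation mdvd := (@mdvd p p_pr F n).
Notation upper := (@upper p p_pr F n).
Notation superdiag := (@superdiag p p_pr F n).
Variables (H : topGroupType) (rho : H -> 'M[F]_n).
Hypothesis rho1 : rho 1%g = 1%:M.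
Hypothesis rhoM : forall x y, rho (x * y)%g = rho x *m rho y.
Hypothesis rho_inj : injective rho.
Hypothesis rho_upper : forall x, upper 0 (rho x).
Hypothesis rho_upper1 : forall x, upper 1 (rho x - 1%:M).
Hypothesis rho_bounded : exists c, forall x, mdvd 0 (p%:R ^+ c *: rho x).
Hypothesis rho_near : forall N : open_normal H, exists m, forall x y,
  mdvd m (rho y - rho x) -> (N : set H) (x^-1 * y)%g.
Hypothesis rho_cluster : forall S : nat -> set H,
  (forall i j, (i <= j)%N -> S j `<=` S i) -> (forall i, S i !=set0) ->
  exists x, forall i m, exists2 y, S i y & mdvd m (rho y - rho x).
Implicit Types (x y : H) (N : open_normal H).

Definition unip x : 'M[F]_n := rho x - 1%:M.

Lemma unip1 : unip 1%g = 0. Proof. by rewrite /unip rho1 subrr. Qed.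
Lemma rhoE x : rho x = 1%:M + unip x. Proof. by rewrite /unip addrC subrK. Qed.
Lemma unipM x y : unip (x * y)%g = unip x + unip y + unip x *m unip y.
Proof.
have addE (V : zmodType) (e a b c : V) : e + b + (a + c) - e = a + b + c.
  by rewrite addrAC [e + b]addrC addrK addrA [b + a]addrC.
by rewrite {1}/unip rhoM (rhoE x) (rhoE y) mulmxDl mul1mx mulmxDr mulmx1 addE.
Qed.
Lemma unip_inj x y : unip x = unip y -> x = y.
Proof. by move=> /addIr; exact: rho_inj. Qed.
Lemma unip_eq0 x : unip x = 0 -> x = 1%g.
Proof. by move=> x0; apply: unip_inj; rewrite unip1. Qed.

Definition level (i : nat) : set H := [set x | upper i (unip x)].
(** The image of x in the i-th graded piece, which is an additive group. *)
Definition symbol (i : nat) x : 'M[F]_n := superdiag i (unip x).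

Lemma level_anti i j x : (i <= j)%N -> level j x -> level i x.
Proof. exact: upper_anti. Qed.
Lemma level1 i : level i 1%g.
Proof. by rewrite /level /= unip1; exact: upper0. Qed.
Lemma level_all x : level 1 x. Proof. exact: rho_upper1. Qed.
Lemma level_top x : level n x -> x = 1%g.
Proof. by move=> /upper_eq0; exact: unip_eq0. Qed.

Lemma level_prod i x y : level i x -> level i y -> upper (i + i) (unip x *m unip y).
Proof. exact: upperM. Qed.

Lemma levelM i x y : level i x -> level i y -> level i (x * y)%g.
Proof.
move=> lx ly; rewrite /level /= unipM; apply: upperD; first exact: upperD.
by apply: upper_anti (level_prod lx ly); exact: leq_addr.
Qed.

Lemma symbolM i x y : (0 < i)%N -> level i x -> level i y ->
  symbol i (x * y)%g = symbol i x + symbol i y.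
Proof.
move=> i0 lx ly; rewrite /symbol unipM !superdiagD [X in _ + X]superdiag_upper ?addr0 //.
by apply: upper_anti (level_prod lx ly); rewrite -addn1 leq_add2l.
Qed.

Lemma levelV i x : level i x -> level i x^-1%g.
Proof.
move=> lx; rewrite /level /=.
have -> : unip x^-1%g = - (rho x^-1%g *m unip x).
  by rewrite /unip mulmxBr -rhoM mulVg rho1 mulmx1 opprB.
rewrite -sub0r; apply: upperB; first exact: upper0.
by rewrite -[i]add0n; apply: upperM => //; exact: rho_upper.
Qed.

Lemma symbol1 i : symbol i 1%g = 0.
Proof. by apply/matrixP => a b; rewrite /symbol unip1 !mxE; case: ifP. Qed.

Lemma symbolV i x : (0 < i)%N -> level i x -> symbol i x^-1%g = - symbol i x.
Proof.
move=> i0 lx; apply/eqP; rewrite -addr_eq0 -symbolM //; last exact: levelV.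
by rewrite mulVg symbol1.
Qed.

Lemma levelX i x m : level i x -> level i (x ^+ m)%g.
Proof.
by move=> lx; elim: m => [|m IH]; [rewrite expg0; exact: level1 | rewrite expgS; exact: levelM].
Qed.

Lemma symbolX i x m : (0 < i)%N -> level i x -> symbol i (x ^+ m)%g = symbol i x *+ m.
Proof.
move=> i0 lx; elim: m => [|m IH]; first by rewrite expg0 symbol1.
by rewrite expgS symbolM ?IH ?mulrS //; exact: levelX.
Qed.

(** The commutator of 1 + A and 1 + B is A B - B A up to a unit. *)
Lemma level_comm i x y : level i x -> level i.+1 (x^-1 * y^-1 * x * y)%g.
Proof.
move=> lx; set z := (_ * y)%g; rewrite /level /=.
have -> : unip z = rho (y * x)^-1%g *m (rho (x * y)%g - rho (y * x)%g).
  by rewrite mulmxBr -!rhoM mulVg rho1 /unip /z invgM !mulgA.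
rewrite -[i.+1]add0n; apply: upperM; first exact: rho_upper.
have -> : rho (x * y)%g - rho (y * x)%g = unip x *m unip y - unip y *m unip x.
  rewrite (rhoE (x * y)%g) (rhoE (y * x)%g) opprD addrACA subrr add0r !unipM.
  by rewrite [unip y + unip x]addrC opprD addrACA subrr add0r.
have ly := level_all y.
apply: upperB; first by rewrite -addn1; exact: upperM.
by rewrite -add1n; exact: upperM.
Qed.

(** Compactness: an element of level i with a small symbol is close to the next
    level. *)
Lemma level_near i N : (0 < i)%N -> exists m, forall x, level i x -> mdvd m (symbol i x) ->
  exists2 c, level i.+1 c & (N : set H) (c^-1 * x)%g.
Proof.
move=> i0; apply: contrapT => nm.
pose S m := [set x | [/\ level i x, mdvd m (symbol i x) &
  forall c, level i.+1 c -> ~ (N : set H) (c^-1 * x)%g]].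
have [||x xP] := @rho_cluster S.
- by move=> j j' jj' x [lx xd xN]; split => //; exact: mdvd_anti xd.
- move=> m; apply: contrapT => ne; apply: nm; exists m => x lx xd.
  apply: contrapT => nc; apply: ne; exists x; split => // c lc Nc.
  by apply: nc; exists c.
have lx : level i.+1 x.
  move=> a b ab; apply: pdvd_eq0 => m.
  have [y [ly yd _] yx] := xP m m.
  have e : unip x = unip y - (rho y - rho x).
    by rewrite /unip opprB [RHS]addrC addrA subrK.
  rewrite e mxE [X in _ + X]mxE; apply: pdvdB; last exact: yx.
  have [ba|ba] := ltnP b (a + i); first by rewrite ly //; exact: pdvd0.
  have := yd a b; rewrite mxE ifT //; apply/eqP/anti_leq.
  by rewrite ba andbT -ltnS -addnS.
have [m mN] := rho_near N.
have [y [_ _ yN] yx] := xP 0%N m.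
by apply: (yN x lx); exact: mN.
Qed.

Lemma quo_congX N c y m : (N : set H) (c^-1 * y)%g ->
  (N : set H) ((c ^+ m)^-1 * y ^+ m)%g.
Proof.
have quoX z : quo_proj N (z ^+ m)%g = (quo_proj N z ^+ m)%g.
  by elim: m => [|m IH]; rewrite ?expg0 ?expgS // quo_projMg IH.
by move=> /quo_proj_eqP e; apply/quo_proj_eqP; rewrite !quoX e.
Qed.

(** A high power of p makes the symbol at level i small, which brings the power of x
    into the next level, up to N. *)
Lemma unipotent_pro_p : pro_p H p.
Proof.
move=> N x.
suff h d : forall y, level (n - d).+1 y -> exists m, (N : set H) (y ^+ (p ^ m))%g.
  by apply: (h n); rewrite subnn; exact: level_all.
elim: d => [|d IH] y ly.
  exists 0%N; rewrite (level_top (level_anti _ ly)) ?subn0 //.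
  by rewrite expg1; exact: (@subgroup1 _ N).
have [dn|nd] := ltnP d n; last first.
  apply: IH; apply: level_anti ly; rewrite ltnS.
  by rewrite (eqP (nd : n <= d)%N).
set i := (n - d.+1).+1 in ly; have iE : (n - d)%N = i by rewrite /i subnSK.
have [m mN] := @level_near i N (ltn0Sn _).
have [c cP] := matrix_scale (symbol i y).
have [|z lz zN] := mN (y ^+ (p ^ (m + c)))%g (levelX _ ly).
  rewrite symbolX // -scaler_nat natrX exprD -scalerA.
  by have := mdvd_shift m cP; rewrite addn0.
have [m' zm'] := IH z (eq_ind_r (fun j => level j.+1 z) lz iE).
exists (m + c + m')%N; rewrite expnD expgnA.
have := quo_congX (p ^ m') zN => /(@subgroupM _ N _ _ zm').
by rewrite mulVKg.
Qed.

(** The symbols of level i form a group of matrices, to which subgroup_fg applies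
    with the symbols of N as open subgroups. *)
Lemma level_generators i : (0 < i)%N -> exists gs : seq H, (forall x, x \in gs -> level i x) /\
  forall D : set H, closed_sub D -> (forall x, x \in gs -> D x) -> level i.+1 `<=` D ->
    level i `<=` D.
Proof.
move=> i0.
pose V := [set A | exists2 x, level i x & symbol i x = A].
pose W N := [set A | exists2 x, level i x /\ (N : set H) x & symbol i x = A].
have [vs [vsV vsP]] : exists vs : seq 'M[F]_n, (forall v, v \in vs -> V v) /\
    forall N A, V A -> exists (b : nat -> nat) w, V w /\
      W N (A - \sum_(j < size vs) vs`_j *+ b j - w *+ p).
  apply: (@subgroup_fg p p_pr F n V (open_normal H) W (whole_open_normal H)).
  - by exists 1%g; [exact: level1 | exact: symbol1].
  - move=> _ _ [x lx <-] [y ly <-]; exists (x * y^-1)%g.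
      by apply: levelM => //; exact: levelV.
    by rewrite symbolM ?symbolV //; exact: levelV.
  - by move=> N; exists 1%g; [split; [exact: level1 | exact: (@subgroup1 _ N)] | exact: symbol1].
  - move=> N _ _ [x [lx Nx] <-] [y [ly Ny] <-]; exists (x * y^-1)%g.
      by split; [apply: levelM => //; exact: levelV | apply: (@subgroupM _ N) => //; exact: (@subgroupV _ N)].
    by rewrite symbolM ?symbolV //; exact: levelV.
  - move=> N N'; exists (capN N N') => _ [x [lx [Nx N'x]] <-].
    by split; exists x.
  - move=> N; have [m mN] := @level_near i N i0; exists m => _ [x lx <-] xd.
    have [c lc Nc] := mN x lx xd; exists (c^-1 * x)%g.
      by split => //; apply: levelM => //; apply: levelV; exact: level_anti lc.
    rewrite symbolM ?symbolV //; [|exact: level_anti lc..|].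
      by rewrite [symbol i c]superdiag_upper ?oppr0 ?add0r.
    by apply: levelV; exact: level_anti lc.
have [gs [gsl gsE]] : exists gs : seq H, (forall x, x \in gs -> level i x) /\
    map (symbol i) gs = vs.
  elim: vs vsV {vsP} => [|v vs IH] vsV; first by exists [::].
  have [|gs [gsl gsE]] := IH; first by move=> w wvs; apply: vsV; rewrite inE wvs orbT.
  have [x lx xv] := vsV v (mem_head _ _); exists (x :: gs); split; last by rewrite /= xv gsE.
  by move=> y; rewrite inE => /predU1P [->|/gsl].
exists gs; split => // D [D1 DM DV Dcl] gsD lD x lx; apply: Dcl => N.
have DX y m : D y -> D (y ^+ m)%g.
  by move=> Dy; elim: m => [|m IH]; rewrite ?expg0 ?expgS //; exact: DM.
have comb (b : nat -> nat) : exists2 h, D h /\ level i h &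
    symbol i h = \sum_(j < size vs) vs`_j *+ b j.
  rewrite -gsE; elim: gs gsl gsD b {gsE} => [|y gs IH] gsl gsD b.
    by exists 1%g; [split => //; exact: level1 | rewrite big_ord0 symbol1].
  have ly : level i y by apply: gsl; exact: mem_head.
  have [||h [Dh lh] hE] := IH _ _ (fun j => b j.+1).
  - by move=> z zgs; apply: gsl; rewrite inE zgs orbT.
  - by move=> z zgs; apply: gsD; rewrite inE zgs orbT.
  exists (y ^+ b 0%N * h)%g.
    split; last by apply: levelM => //; exact: levelX.
    by apply: DM => //; apply: DX; apply: gsD; exact: mem_head.
  by rewrite symbolM ?symbolX ?hE ?big_ord_recl //; exact: levelX.
(* subgroup_fg is iterated on the remainder w; once the multiple of p^m is small,
   level_near absorbs it into the next level and N. *)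
have approx m : exists h w nu, [/\ D h /\ level i h, level i w, level i nu, (N : set H) nu &
    symbol i x = symbol i h + symbol i w *+ (p ^ m) + symbol i nu].
  elim: m => [|m [h [w [nu [[Dh lh] lw lnu Nnu xE]]]]].
    exists 1%g, x, 1%g; split => //; try exact: level1; last by rewrite !symbol1 add0r addr0.
      by split; [exact: D1 | exact: level1].
    exact: (@subgroup1 _ N).
  have [|b [_ [[w' lw' <-] [nu' [lnu' Nnu'] nu'E]]]] := vsP N (symbol i w); first by exists w.
  have [h' [Dh' lh'] h'E] := comb b.
  have wE : symbol i w = symbol i h' + symbol i w' *+ p + symbol i nu'.
    by rewrite nu'E h'E [RHS]addrC -(addrA (symbol i w)) -opprD subrK.
  have NX j : (N : set H) (nu' ^+ j)%g.
    elim: j => [|j IH]; first exact: (@subgroup1 _ N).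
    by rewrite expgS; exact: (@subgroupM _ N).
  exists (h * h' ^+ (p ^ m))%g, w', (nu' ^+ (p ^ m) * nu)%g; split => //.
  - by split; [apply: DM => //; exact: DX | apply: levelM => //; exact: levelX].
  - by apply: levelM => //; exact: levelX.
  - exact: (@subgroupM _ N).
  rewrite xE !symbolM ?symbolX //; try exact: levelX.
  by rewrite wE !mulrnDl -mulrnA -expnS !addrA.
have [m mN] := @level_near i N i0; have [c cP] := rho_bounded.
have [h [w [nu [[Dh lh] lw lnu Nnu xE]]]] := approx (m + c)%N.
pose y := ((h * nu)^-1 * x)%g.
have lhn : level i (h * nu)%g by exact: levelM.
have yE : symbol i y = symbol i w *+ (p ^ (m + c)).
  rewrite symbolM ?symbolV //; last exact: levelV.
  by rewrite symbolM // xE opprD addrC addrACA subrr addr0 addrAC subrr add0r.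
have [||z lz Nz] := mN y; first by apply: levelM => //; exact: levelV.
  rewrite yE -scaler_nat natrX exprD -scalerA.
  suff cw : mdvd 0 (p%:R ^+ c *: symbol i w) by have := mdvd_shift m cw; rewrite addn0.
  rewrite -superdiagZ; apply: superdiag_mdvd; rewrite scalerBr; apply: mdvdB => //.
  rewrite -rho1; exact: cP.
exists (h * z)%g; first by apply: DM => //; exact: lD.
have -> : ((h * z)^-1 * x = (z^-1 * nu * z) * (z^-1 * y))%g.
  by rewrite /y !invgM !mulgA mulgK mulgK.
by apply: (@subgroupM _ N) => //; exact: (@normalJ _ N).
Qed.

(** The generators are listed by increasing level, so that the commutators with
    generators of level i, being of level i + 1, are generated by later ones. *)
Lemma unipotent_chain : exists r g, @central_chain H r g.
Proof.
suff [L [Lgen Lcomm]] : exists L : seq H,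
    (forall D : set H, closed_sub D -> (forall x, x \in L -> D x) -> level 1 `<=` D) /\
    forall l h (D : set H), (l < size L)%N -> closed_sub D ->
      (forall j, (l < j)%N -> (j < size L)%N -> D (nth 1%g L j)) ->
      D ((nth 1%g L l)^-1 * h^-1 * nth 1%g L l * h)%g.
  exists (size L), (nth 1%g L); split => // D Dcl DL x.
  by apply: (Lgen D Dcl _ x (level_all x)) => y /(nthP 1%g) [j jL <-]; exact: DL.
suff key d : (d <= n)%N -> exists L : seq H,
    (forall D : set H, closed_sub D -> (forall x, x \in L -> D x) ->
      level (n - d).+1 `<=` D) /\
    forall l h (D : set H), (l < size L)%N -> closed_sub D ->
      (forall j, (l < j)%N -> (j < size L)%N -> D (nth 1%g L j)) ->
      D ((nth 1%g L l)^-1 * h^-1 * nth 1%g L l * h)%g.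
  by have := key n (leqnn n); rewrite subnn.
elim: d => [_|d IH dn].
  exists [::]; split => // D [D1 _ _ _] _ x; rewrite subn0 => lx.
  by rewrite (level_top (level_anti (leqnSn n) lx)).
have [L [Lgen Lcomm]] := IH (ltnW dn).
set i := (n - d.+1).+1; have iE : (n - d)%N = i by rewrite /i subnSK.
rewrite iE in Lgen.
have [gs [gsl gsP]] := @level_generators i (ltn0Sn _).
exists (gs ++ L); split.
  move=> D Dcl DL; apply: gsP => //; first by move=> x xgs; apply: DL; rewrite mem_cat xgs.
  by apply: Lgen => // x xL; apply: DL; rewrite mem_cat xL orbT.
have nth_shift j : nth 1%g (gs ++ L) (size gs + j) = nth 1%g L j.
  by rewrite nth_cat ltnNge leq_addr addKn.
move=> l h D; rewrite size_cat => lL Dcl DL; rewrite nth_cat; have [lgs|gsl'] := ltnP l (size gs).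
  suff lD : level i.+1 `<=` D by apply/lD/level_comm/gsl; exact: mem_nth.
  apply: Lgen => // x /(nthP 1%g) [j jL <-].
  have := DL (size gs + j)%N; rewrite nth_shift; apply.
    exact: leq_trans lgs (leq_addr _ _).
  by rewrite ltn_add2l.
apply: Lcomm => //; first by rewrite ltn_subLR.
move=> j lj jL; have := DL (size gs + j)%N; rewrite nth_shift; apply.
  by rewrite -ltn_subLR.
by rewrite ltn_add2l.
Qed.

End Chain.

(** * Coefficient rings *)

(** A unit modulo p is a unit, by summing a geometric series. *)
Lemma padic_coef_residue (k : comNzRingType) (p : nat) :
  (forall c : k, (exists u, divides p%:R (1 - u * c)) \/ divides p%:R c) ->
  (forall c : k, (forall m, divides (p%:R ^+ m) c) -> c = 0) ->
  (forall u : nat -> k,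
    (forall m, exists n, forall i j, (n <= i)%N -> (n <= j)%N ->
      divides (p%:R ^+ m) (u i - u j)) ->
    exists l, forall m, exists n, forall i, (n <= i)%N -> divides (p%:R ^+ m) (u i - l)) ->
  padic_coef k p.
Proof.
move=> res sep comp; split => // c; case: (res c) => [[u [v uv]]|]; [left | by right].
have dX (t : k) i m : (m <= i)%N -> divides (p%:R ^+ m) (p%:R ^+ i * t).
  by move=> mi; exists (p%:R ^+ (i - m) * t); rewrite mulrA -exprD subnKC.
pose q := p%:R * v; have ucE : u * c = 1 - q by rewrite /q -uv subKr.
pose s i := \sum_(j < i) q ^+ j.
have sM i : u * c * s i = 1 - q ^+ i.
  by rewrite ucE -opprB mulNr -subrX1 opprB.
have [m|l lP] := comp s.
  exists m => i j mi mj.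
  have tail i' : (m <= i')%N -> exists t, s i' - s m = p%:R ^+ m * t.
    move=> /subnK <-; elim: (i' - m)%N => [|d [t tE]]; first by exists 0; rewrite subrr mulr0.
    rewrite addSn /s big_ord_recr /= -/(s _) addrAC tE exprMn -[X in _ + X * _]mulr1.
    have [w ->] := dX 1 (d + m)%N m (leq_addl _ _).
    by exists (t + w * v ^+ (d + m)); rewrite mulrDr mulrA.
  have [[t tE] [t' t'E]] := (tail i mi, tail j mj).
  by exists (t - t'); rewrite mulrBr -tE -t'E opprB addrA subrK.
exists (l * u); rewrite -mulrA mulrC; apply/eqP; rewrite -subr_eq0; apply/eqP/sep => m.
have [n nP] := lP m; have [w wE] := nP (n + m)%N (leq_addr _ _).
exists (- (u * c * w) - p%:R ^+ n * v ^+ (n + m)).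
have -> : u * c * l - 1 = - (u * c * (s (n + m)%N - l)) - q ^+ (n + m).
  by rewrite mulrBr sM opprB -addrA -opprD subrK.
rewrite wE mulrBr mulrN mulrCA /q exprMn; congr (_ - _).
by rewrite mulrA -exprD [(m + n)%N]addnC.
Qed.

Section Residues.
Variables (p : nat) (O : idomainType) (O_cdvr : complete_dvr O).
Hypothesis p_prime : prime_element (p%:R : O).
Implicit Types (x y c : O).

Lemma principalP x y : principal_ideal x y <-> divides x y.
Proof.
split; first by move=> [c _ <-]; exists c; rewrite mulrC.
by move=> [c ->]; exists c; rewrite // mulrC.
Qed.

(** A generator of I divides the prime p, hence is a unit or an associate of p. *)
Lemma over_prime (I : set O) : left_ideal I -> I p%:R ->
  I 1 \/ forall x, I x -> divides p%:R x.
Proof.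
case: p_prime => p0 _ pP; case: O_cdvr => -[pid _] _ Iid Ip.
have [x IE] := pid I Iid; have [_ _ IM] := Iid.
have Ix : I x by rewrite IE; exists 1; rewrite ?mul1r.
have [d _ dx] : principal_ideal x p%:R by rewrite -IE.
case: (pP d x) => [|[e _ ed]|px]; first by exists 1; rewrite // mul1r.
  left; have -> : 1 = e * x; last exact: IM.
  by apply: (mulIf p0); rewrite mul1r -{1}dx -ed mulrAC.
right => y; rewrite IE => -[c _ <-]; have [e _ <-] := px.
by exists (c * e); rewrite mulrA mulrC.
Qed.

Lemma prime_maximal : maximal_ideal (principal_ideal (p%:R : O)).
Proof.
case: p_prime => p0 pU _; split.
- split; first by exists 0; rewrite ?mul0r.
    by move=> _ _ [c _ <-] [d _ <-]; exists (c + d); rewrite ?mulrDl.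
  by move=> a _ [c _ <-]; exists (a * c); rewrite ?mulrA.
- move=> [c _ cp]; case/negP: pU; apply/unitrP; exists c; split => //.
  by rewrite mulrC.
move=> I Iid pI I1; case: (over_prime Iid) => [|//|Id].
  by apply: pI; exists 1; rewrite // mul1r.
by apply/seteqP; split => // x /Id /principalP.
Qed.

Lemma residue_inverse c : (exists u, divides p%:R (1 - u * c)) \/ divides p%:R c.
Proof.
pose I := [set x | exists u v, x = u * c + v * p%:R].
have Iid : left_ideal I.
  split; first by exists 0, 0; rewrite !mul0r addr0.
    move=> _ _ [u [v ->]] [u' [v' ->]]; exists (u + u'), (v + v').
    by rewrite !mulrDl addrACA.
  by move=> a _ [u [v ->]]; exists (a * u), (a * v); rewrite mulrDr !mulrA.
case: (over_prime Iid) => [|[u [v e]]|Id].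
- by exists 0, 1; rewrite mul0r add0r mul1r.
- by left; exists u, v; apply/eqP; rewrite subr_eq [p%:R * v]mulrC addrC -e.
- by right; apply: Id; exists 1, 0; rewrite mul1r mul0r addr0.
Qed.

(** The intersection of the ideals (p^m) is generated by some x, and x / p lies in it
    as well. *)
Lemma dvr_separated c : (forall m, divides (p%:R ^+ m) c) -> c = 0.
Proof.
case: p_prime => p0 pU _; case: O_cdvr => -[pid _] _.
pose I := [set x : O | forall m, divides (p%:R ^+ m) x].
have [x IE] : exists x, I = principal_ideal x.
  apply: pid; split => [m|x y Ix Iy m|a x Ix m]; first by exists 0; rewrite mulr0.
    by have [[x' ->] [y' ->]] := (Ix m, Iy m); exists (x' + y'); rewrite mulrDr.
  by have [x' ->] := Ix m; exists (a * x'); rewrite mulrCA.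
suff x0 : x = 0.
  by move=> Ic; have : I c := Ic; rewrite IE x0 => -[d _ <-]; rewrite mulr0.
apply: contrapT => /eqP x0.
have Ix : I x by rewrite IE; exists 1; rewrite ?mul1r.
have [y xE] := Ix 1%N; rewrite expr1 in xE.
have [d _ dx] : principal_ideal x y.
  rewrite -IE => m; have [z zE] := Ix m.+1; exists z.
  by apply: (mulfI p0); rewrite -xE zE exprS mulrA.
case/negP: pU; apply/unitrP; exists d.
have e : d * p%:R = 1 by apply: (mulIf x0); rewrite mul1r [RHS]xE -dx mulrAC mulrA [p%:R * d]mulrC mulrAC.
by rewrite [p%:R * d]mulrC.
Qed.

Lemma dvr_padic_coef : padic_coef (O : comNzRingType) p.
Proof.
case: O_cdvr => _ /(_ _ prime_maximal) comp.
apply: padic_coef_residue; [exact: residue_inverse | exact: dvr_separated |].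
move=> u uC; have [m|l lP] := comp u.
  have [n nP] := uC m; exists n => i j ni nj; exact/principalP/nP.
by exists l => m; have [n nP] := lP m; exists n => i ni; apply/principalP/nP.
Qed.

Lemma quotient_padic_coef : padic_coef (quotient_by_prime p_prime) p.
Proof.
pose Q := quotient_by_prime p_prime; pose proj : {rmorphism O -> Q} := \pi_Q%qT.
have proj0 x : divides p%:R x -> proj x = 0.
  move=> xd; rewrite -[RHS](rmorph0 proj); apply/eqP.
  by rewrite -Quotient.idealrBE subr0; apply/asboolP/principalP.
have p0 : p%:R = 0 :> Q.
  by rewrite -(rmorph_nat proj); apply: proj0; exists 1; rewrite mulr1.
have div0 m (c : Q) : divides (p%:R ^+ m.+1) c -> c = 0.
  by move=> [y ->]; rewrite p0 expr0n mul0r.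
apply: padic_coef_residue.
- move=> c; rewrite -[c]reprK -/(proj _); case: (residue_inverse (repr c)) => [[u uc]|c0].
    left; exists (proj u); exists 0; rewrite mulr0.
    by rewrite -(rmorph1 proj) -rmorphM -rmorphB; apply: proj0.
  by right; exists 0; rewrite mulr0 proj0.
- by move=> c /(_ 1%N) /div0.
move=> u /(_ 1%N) [n nP]; exists (u n) => m; exists n => i ni.
by exists 0; rewrite mulr0; apply: (@div0 0%N); exact: nP.
Qed.

End Residues.

(** * Conclusion *)

Theorem corollary5p8
    (p : nat) (p_pr : prime p)
    (O : idomainType) (O_cdvr : complete_dvr O)
    (p_prime_in_O : prime_element (p%:R : O))
    (k : comNzRingType)
    (k_coef : k = (O : comNzRingType) \/ k = quotient_by_prime p_prime_in_O)
    (F : fieldExtType (Qp p_pr)) (n : nat)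
    (U : subgroup (padic_unitriangular F n))
    (U_closed : closed (U : set (padic_unitriangular F n)))
    (K : subgroup (subgroup_type U))
    (K_open : open (K : set (subgroup_type U)))
    (K_profinite : profinite (subgroup_type K))
    (kU : algType k)
    (kU_iwasawa : is_augmented_iwasawa_algebra K kU) :
  coherent kU.
Proof.
have [_ K_compact _ _] := K_profinite.
have k_padic : padic_coef k p.
  case: k_coef => ->; [exact: dvr_padic_coef | exact: quotient_padic_coef].
have K_fin := K_finite_quotients K_open K_compact.
have K_conj := K_conjugate K_open K_compact.
have K_un := K_union K_open K_compact.
have rho1 : matK (1%g : subgroup_type K) = 1%:M by [].
have rhoM (x y : subgroup_type K) : matK (x * y)%g = matK x *m matK y by exact: matM.
have rho_inj : injective (@matK p p_pr F n U K).
  by move=> x y /mat_inj e; exact: val_inj.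
have rho_upper (x : subgroup_type K) := mat_upper (subgroup_incl x).
have rho_upper1 (x : subgroup_type K) := mat_upper1 (subgroup_incl x).
have rho_bounded := K_bounded K_compact.
have rho_near := K_near K_open K_compact.
have rho_cluster := decreasing_cluster K_compact.
have K_pro_p : pro_p (subgroup_type K) p.
  exact: (@unipotent_pro_p p p_pr F n (subgroup_type K) (@matK p p_pr F n U K) rho1 rhoM rho_inj rho_upper1 rho_near rho_cluster).
have [r [g K_chain]] :=
  @unipotent_chain p p_pr F n (subgroup_type K) (@matK p p_pr F n U K) rho1 rhoM rho_inj rho_upper rho_upper1 rho_bounded rho_near rho_cluster.
have S_left := completed_left_noetherian p_pr k_padic K_fin K_pro_p K_chain.
have S_right := completed_right_noetherian p_pr k_padic K_fin K_pro_p K_chain.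
have S_gen := completed_generation p_pr k_padic K_fin K_pro_p K_chain.
have [a [b tens]] := kU_iwasawa.
split.
- exact: (augmented_left_coherent tens S_left S_gen K_fin K_conj K_un).
- exact: (augmented_right_coherent tens S_right S_gen K_conj K_un).
Qed.
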